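(* Let $p\in\{2,3,5,7\}$ and let $m\ge 1$ be an integer, written as $m=p^{\alpha}m'$ with $\alpha\ge 0$ and $\gcd(m',p)=1$. Let \[ f_{0,m}^{(p)}(\tau)=q^{-m}+\sum_{n=0}^{\infty}a_{0}^{(p)}(m,n)q^{n} \] be the unique level $p$ modular function which is holomorphic on the upper half-plane, has $q$-expansion at $\infty$ of the form $q^{-m}+O(1)$, and is holomorphic and vanishes at the cusp $0$. Then for every integer $\beta>\alpha$ and every positive integer $n$, \[ \begin{array}{rll} a_{0}^{(2)}(2^{\alpha}m',2^{\beta}n)\equiv0 & \pmod{2^{3(\beta-\alpha)+8}} & \text{if }p=2,\\ a_{0}^{(3)}(3^{\alpha}m',3^{\beta}n)\equiv0 & \pmod{3^{2(\beta-\alpha)+3}} & \text{if }p=3,\\ a_{0}^{(5)}(5^{\alpha}m',5^{\beta}n)\equiv0 & \pmod{5^{(\beta-\alpha)+1}} & \text{if }p=5,\\ a_{0}^{(7)}(7^{\alpha}m',7^{\beta}n)\equiv0 & \pmod{7^{(\beta-\alpha)}} & \text{if }p=7. \end{array} \]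
   Context: Here $q=e^{2\pi i\tau}$ with $\tau$ in the complex upper half-plane. A level $p$ modular function is a holomorphic function $f$ on the upper half-plane with $f\left(\frac{a\tau+b}{c\tau+d}\right)=f(\tau)$ for all $\left(\begin{smallmatrix}a&b\\c&d\end{smallmatrix}\right)\in\Gamma_0(p)$, meromorphic at the cusps of $\Gamma_0(p)$ (for these $p$ the cusps are $\infty$ and $0$; behaviour at $0$ is read off from $f(-1/p\tau)$). Equivalently, with $\eta(\tau)=q^{1/24}\prod_{n\ge1}(1-q^n)$, $\lambda=24/(p-1)$ and $\psi^{(p)}(\tau)=(\eta(\tau)/\eta(p\tau))^{\lambda}$ (which has a simple pole at $\infty$ and a simple zero at $0$), one has $f_{0,m}^{(p)}=(\psi^{(p)})^m-Q(\psi^{(p)})$ where $Q$ is the polynomial of degree $m-1$ with no constant term chosen so that all negative powers of $q$ other than $q^{-m}$ are eliminated; the coefficients $a_0^{(p)}(m,n)$ are integers. *)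

(* Defs.v *)
From Stdlib Require Import Reals ZArith Arith List.
From Coquelicot Require Import Coquelicot.

Open Scope C_scope.

Definition upper_half_plane (tau : C) : Prop := (0 < Im tau)%R.

(* q = e^{2 pi i tau}, by its polar form *)
Definition q (tau : C) : C :=
  RtoC (exp (- (2 * PI * Im tau))) *
  (cos (2 * PI * Re tau), sin (2 * PI * Re tau))%R.

Definition holomorphic_on_H (f : C -> C) : Prop :=
  forall tau : C, upper_half_plane tau ->
    ex_derive (K := C_AbsRing) (V := C_NormedModule) f tau.

Definition Gamma0 (p : nat) (a b c d : Z) : Prop :=
  (a * d - b * c = 1)%Z /\ (Z.of_nat p | c)%Z.

Definition Gamma0_invariant (p : nat) (f : C -> C) : Prop :=
  forall a b c d : Z, Gamma0 p a b c d ->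
  forall tau : C, upper_half_plane tau ->
    f ((RtoC (IZR a) * tau + RtoC (IZR b)) /
       (RtoC (IZR c) * tau + RtoC (IZR d))) = f tau.

(* A holomorphic function on the upper half-plane which is meromorphic at a
   cusp is a holomorphic function of q on the whole punctured unit disc, so its
   q-expansion is valid for every tau, not only for Im tau large. *)
Definition q_expansion (g : C -> C) (c : nat -> C) : Prop :=
  forall tau : C, upper_half_plane tau ->
    is_series (K := C_AbsRing) (V := C_NormedModule)
      (fun n : nat => c n * q tau ^ n) (g tau).

Definition meromorphic_at_infinity (f : C -> C) : Prop :=
  exists (N : nat) (c : nat -> C), q_expansion (fun tau => q tau ^ N * f tau) c.

Definition at_cusp_0 (p : nat) (f : C -> C) : C -> C :=
  fun tau => f (- (1 / (RtoC (INR p) * tau))).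

(* For p prime, infinity and 0 represent all the cusps of Gamma0(p). *)
Definition level_modular_function (p : nat) (f : C -> C) : Prop :=
  holomorphic_on_H f /\
  Gamma0_invariant p f /\
  meromorphic_at_infinity f /\
  meromorphic_at_infinity (at_cusp_0 p f).

Definition vanishes_at_cusp_0 (p : nat) (f : C -> C) : Prop :=
  exists b : nat -> C, b 0%nat = RtoC 0 /\ q_expansion (at_cusp_0 p f) b.

(* f is the function f_{0,m}^{(p)}, with a n = a_0^{(p)}(m, n). *)
Definition is_f0 (p m : nat) (f : C -> C) (a : nat -> C) : Prop :=
  level_modular_function p f /\
  q_expansion (fun tau => f tau - / (q tau ^ m)) a /\
  vanishes_at_cusp_0 p f.

(* x is a rational integer divisible by M. The coefficients are a priori only
   complex numbers, so their integrality is part of the congruence. *)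
Definition cong0_mod (x : C) (M : Z) : Prop :=
  exists k : Z, x = RtoC (IZR k) /\ (M | k)%Z.

(* Main.v *)
(** The function [psi = (eta(t)/eta(p t))^lambda] satisfies [psi(-1/(p t)) = p^(lambda/2) / psi(t)].
    A [Gamma0(p)]-invariant function without poles at the two cusps that vanishes at one of them is zero:
    multiply it by its image under [t -> -1/(p t)] and move every point, by translations and finitely many
    matrices of [Gamma0(p)], to where the q-series is dominated by its first term. Hence [f] is an
    integral polynomial in [psi], and the conjugates of [psi] satisfy a modular equation of degree [p].
    The latter gives a linear recursion for the traces [V(phi^e)] of the integral powers of [phi = 1/psi],
    from which [p U] maps [Z[psi]] into [p Z[psi] + Y Z[Y]], [Y = p^(lambda/2) phi], and [U] gains a fixed
    power of [p] on the lattice spanned by the [p^(w (j - 1)) phi^j]. After [alpha + 1] applications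
    of [U] to [f] the pole at infinity is gone, so the function is a constant plus an element of this
    lattice, and every further application adds the stated power of [p].

    The transformation law of [eta] is proved by exchanging the order of summation in the logarithm of
    [eta], expanded by the partial fractions of the cotangent; subtracting [N] times every [N]-th term
    makes the double series absolutely convergent, and [log N] is the defect of the harmonic sums. *)

Require Import Defs.
From Stdlib Require Import Reals ZArith Arith List Lra Lia Classical.
From Coquelicot Require Import Coquelicot.
Open Scope C_scope.

(** * Complex sums and series *)

(** Every analytic statement is put as one about a q-series valid on the whole half-plane. Cauchy's
    estimate comes from means over roots of unity, and factors are cancelled because power series
    have no zero divisors. Of Gamma0(p) only translations and the matrices with rows (a, -1), (p,
    -k) are used, where a k = p - 1 holds in the integers: for p = 2, 3, 5, 7 the signed divisors of
    p - 1 meet every nonzero residue class, so an inversion can lift every low point. Eta enters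
    through quotients only, hence its law is proved as a relation between four values, in which the
    square root of tau cancels. The exponents of the theorem come from two numbers. Dividing Y by p
    once leaves p^(lambda/2 - 1), that is 2^11, 3^5, 5^2, 7^1, at beta = alpha + 1; each later step
    gains the slope 3, 2, 1, 1. The slope rests on the finitely many traces V(phi^j) with 1 <= j <
    p, which are computed exactly; the recursion carries it to all j because lambda/2 >= 2 w and w
    (p - 1) is at least the slope. *)

Fixpoint Csum (f : nat -> C) (n : nat) : C :=
  match n with O => 0 | S k => Csum f k + f k end.

Definition Cser (a : nat -> C) (l : C) : Prop :=
  is_series (K := C_AbsRing) (V := C_NormedModule) a l.

Definition Clim (u : nat -> C) (l : C) : Prop :=
  forall eps : R, (0 < eps)%R -> exists N, forall n, (N <= n)%nat -> (Cmod (u n - l) < eps)%R.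

Lemma Ceq (x y : C) : Re x = Re y -> Im x = Im y -> x = y.
Proof. destruct x, y; simpl; intros; subst; reflexivity. Qed.

Lemma Csum_ext f g n : (forall k, (k < n)%nat -> f k = g k) -> Csum f n = Csum g n.
Proof.
  induction n; simpl; intros H; auto. rewrite IHn by (intros; apply H; lia).
  now rewrite H by lia.
Qed.

Lemma Csum_plus f g n : Csum (fun k => f k + g k) n = Csum f n + Csum g n.
Proof. induction n; simpl; [ring | rewrite IHn; ring]. Qed.

Lemma Csum_scal c f n : Csum (fun k => c * f k) n = c * Csum f n.
Proof. induction n; simpl; [ring | rewrite IHn; ring]. Qed.

Lemma Csum_minus f g n : Csum (fun k => f k - g k) n = Csum f n - Csum g n.
Proof. induction n; simpl; [ring | rewrite IHn; ring]. Qed.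

Lemma Csum_const c n : Csum (fun _ => c) n = RtoC (INR n) * c.
Proof.
  induction n; [simpl; ring |]. cbn [Csum]. rewrite IHn, S_INR, RtoC_plus. ring.
Qed.

Lemma Csum_add f m n : Csum f (m + n) = Csum f m + Csum (fun k => f (m + k)%nat) n.
Proof.
  induction n; [rewrite Nat.add_0_r; simpl; ring |].
  rewrite Nat.add_succ_r. simpl. rewrite IHn. ring.
Qed.

Lemma Csum_head f n : Csum f (S n) = f 0%nat + Csum (fun k => f (S k)) n.
Proof.
  rewrite <- (Nat.add_1_l n), Csum_add. simpl. ring.
Qed.

Lemma Csum_rev f n : Csum f n = Csum (fun k => f (n - 1 - k)%nat) n.
Proof.
  induction n; auto. rewrite (Csum_head (fun k => f (S n - 1 - k)%nat)).
  cbn [Csum]. rewrite IHn.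
  rewrite (Csum_ext (fun k => f (S n - 1 - S k)%nat) (fun k => f (n - 1 - k)%nat)).
  - replace (S n - 1 - 0)%nat with n by lia. ring.
  - intros; f_equal; lia.
Qed.

Lemma Csum_swap (f : nat -> nat -> C) m n :
  Csum (fun i => Csum (f i) n) m = Csum (fun j => Csum (fun i => f i j) m) n.
Proof.
  induction m; simpl.
  - induction n; simpl; auto. rewrite <- IHn. ring.
  - rewrite IHm, <- Csum_plus. reflexivity.
Qed.

Fixpoint Rsum (f : nat -> R) (n : nat) : R :=
  match n with O => 0%R | S k => (Rsum f k + f k)%R end.

Lemma Rsum_le f g n : (forall k, (k < n)%nat -> (f k <= g k)%R) -> (Rsum f n <= Rsum g n)%R.
Proof.
  induction n; simpl; intros H; [lra |].
  apply Rplus_le_compat; [apply IHn; intros; apply H; lia | apply H; lia].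
Qed.

Lemma Rsum_scal c f n : Rsum (fun k => c * f k)%R n = (c * Rsum f n)%R.
Proof. induction n; simpl; [ring | rewrite IHn; ring]. Qed.

Lemma Rsum_nonneg f n : (forall k, (k < n)%nat -> (0 <= f k)%R) -> (0 <= Rsum f n)%R.
Proof.
  induction n; simpl; intros H; [lra |].
  apply Rplus_le_le_0_compat; [apply IHn; intros; apply H; lia | apply H; lia].
Qed.

Lemma Rsum_const c n : Rsum (fun _ => c) n = (INR n * c)%R.
Proof. induction n; [simpl; ring | cbn [Rsum]; rewrite IHn, S_INR; ring]. Qed.

Lemma Cmod_Csum f n : (Cmod (Csum f n) <= Rsum (fun k => Cmod (f k)) n)%R.
Proof.
  induction n; simpl; [rewrite Cmod_0; lra |].
  eapply Rle_trans; [apply Cmod_triangle |]. lra.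
Qed.

Lemma Csum_RtoC f n : Csum (fun k => RtoC (f k)) n = RtoC (Rsum f n).
Proof. induction n; simpl; auto. now rewrite IHn, RtoC_plus. Qed.

Lemma Re_plus (x y : C) : Re (x + y) = (Re x + Re y)%R.
Proof. reflexivity. Qed.
Lemma Im_plus (x y : C) : Im (x + y) = (Im x + Im y)%R.
Proof. reflexivity. Qed.

Lemma Re_Csum f n : Re (Csum f n) = Rsum (fun k => Re (f k)) n.
Proof. induction n; simpl; auto. rewrite <- IHn. reflexivity. Qed.
Lemma Im_Csum f n : Im (Csum f n) = Rsum (fun k => Im (f k)) n.
Proof. induction n; simpl; auto. rewrite <- IHn. reflexivity. Qed.

Lemma sum_n_Csum (a : nat -> C) n :
  sum_n (G := C_AbelianMonoid) a n = Csum a (S n).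
Proof.
  induction n.
  - rewrite sum_O. simpl. now rewrite Cplus_0_l.
  - rewrite sum_Sn, IHn. reflexivity.
Qed.

Lemma sum_n_Rsum (a : nat -> R) n : sum_n a n = Rsum a (S n).
Proof.
  induction n.
  - rewrite sum_O. simpl. now rewrite Rplus_0_l.
  - rewrite sum_Sn, IHn. reflexivity.
Qed.

Lemma Cmod_le_Re_Im (z : C) : (Cmod z <= Rabs (Re z) + Rabs (Im z))%R.
Proof.
  unfold Cmod. apply Rsqr_incr_0_var.
  - rewrite Rsqr_sqrt by (apply Rplus_le_le_0_compat; apply pow2_ge_0).
    unfold Rsqr. destruct z as [x y]; cbn [fst snd Re Im].
    pose proof (Rabs_pos x). pose proof (Rabs_pos y).
    pose proof (pow2_abs x). pose proof (pow2_abs y). nra.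
  - pose proof (Rabs_pos (Re z)). pose proof (Rabs_pos (Im z)). lra.
Qed.

Lemma im_le_Cmod (z : C) : (Rabs (Im z) <= Cmod z)%R.
Proof. eapply Rle_trans; [apply Rmax_r | apply (Rmax_Cmod z)]. Qed.

Lemma Cser_Clim a l : Cser a l <-> Clim (Csum a) l.
Proof.
  unfold Cser, is_series.
  split.
  - intros H eps He.
    pose proof (proj1 (filterlim_locally_ball_norm (K := C_AbsRing) (U := C_NormedModule) _ l) H) as H1.
    destruct (H1 (mkposreal _ He)) as [N HN].
    exists (S N). intros n Hn. destruct n; [lia |].
    specialize (HN n ltac:(lia)). unfold ball_norm in HN.
    change (sum_n a n) with (sum_n (G := C_AbelianMonoid) a n) in HN. rewrite sum_n_Csum in HN.
    exact HN.
  - intros H. apply (filterlim_locally_ball_norm (K := C_AbsRing) (U := C_NormedModule)).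
    intros eps. destruct (H eps (cond_pos eps)) as [N HN].
    exists N. intros n Hn. unfold ball_norm.
    change (sum_n a n) with (sum_n (G := C_AbelianMonoid) a n). rewrite sum_n_Csum.
    apply HN. lia.
Qed.

Lemma Clim_Re_Im u l :
  Clim u l <-> is_lim_seq (fun n => Re (u n)) (Re l) /\ is_lim_seq (fun n => Im (u n)) (Im l).
Proof.
  split.
  - intros H; split; apply is_lim_seq_spec; intros eps;
      destruct (H eps (cond_pos eps)) as [N HN]; exists N; intros n Hn;
      eapply Rle_lt_trans; try (apply (HN n Hn)).
    + apply (re_le_Cmod (u n - l)).
    + apply (im_le_Cmod (u n - l)).
  - intros [H1 H2] eps He. apply is_lim_seq_spec in H1. apply is_lim_seq_spec in H2.
    assert (He2 : (0 < eps / 2)%R) by lra.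
    destruct (H1 (mkposreal _ He2)) as [N1 HN1]. destruct (H2 (mkposreal _ He2)) as [N2 HN2].
    exists (N1 + N2)%nat. intros n Hn.
    eapply Rle_lt_trans; [apply Cmod_le_Re_Im |].
    specialize (HN1 n ltac:(lia)). specialize (HN2 n ltac:(lia)). simpl in HN1, HN2.
    change (Re (u n - l)) with (Re (u n) - Re l)%R. change (Im (u n - l)) with (Im (u n) - Im l)%R.
    lra.
Qed.

Lemma Clim_ext u v l : (forall n, u n = v n) -> Clim u l -> Clim v l.
Proof. intros E H eps He. destruct (H eps He) as [N HN]. exists N. intros. rewrite <- E. auto. Qed.

Lemma Clim_ext_loc u v l N0 : (forall n, (N0 <= n)%nat -> u n = v n) -> Clim u l -> Clim v l.
Proof.
  intros E H eps He. destruct (H eps He) as [N HN]. exists (N + N0)%nat. intros.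
  rewrite <- E by lia. apply HN. lia.
Qed.

Lemma Clim_unique u l l' : Clim u l -> Clim u l' -> l = l'.
Proof.
  rewrite !Clim_Re_Im. intros [A B] [A' B'].
  apply is_lim_seq_unique in A, B, A', B'.
  apply Ceq; [rewrite A in A' | rewrite B in B']; congruence.
Qed.

Lemma Clim_const c : Clim (fun _ => c) c.
Proof.
  intros eps He. exists 0%nat. intros. replace (c - c) with (RtoC 0) by ring. now rewrite Cmod_0.
Qed.

Lemma Clim_plus u v a b : Clim u a -> Clim v b -> Clim (fun n => u n + v n) (a + b).
Proof.
  rewrite !Clim_Re_Im. intros [A B] [A' B']. split.
  - apply (is_lim_seq_plus' _ _ _ _ A A').
  - apply (is_lim_seq_plus' _ _ _ _ B B').
Qed.

Lemma Clim_mult u v a b : Clim u a -> Clim v b -> Clim (fun n => u n * v n) (a * b).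
Proof.
  rewrite !Clim_Re_Im. intros [A B] [A' B']. split.
  - apply (is_lim_seq_minus' _ _ _ _ (is_lim_seq_mult' _ _ _ _ A A') (is_lim_seq_mult' _ _ _ _ B B')).
  - apply (is_lim_seq_plus' _ _ _ _ (is_lim_seq_mult' _ _ _ _ A B') (is_lim_seq_mult' _ _ _ _ B A')).
Qed.

Lemma Clim_scal c u a : Clim u a -> Clim (fun n => c * u n) (c * a).
Proof. intros; apply Clim_mult; auto using Clim_const. Qed.

Lemma Clim_minus u v a b : Clim u a -> Clim v b -> Clim (fun n => u n - v n) (a - b).
Proof.
  intros. replace (a - b) with (a + -(1) * b) by ring.
  apply Clim_ext with (fun n => u n + -(1) * v n); [intros; ring |].
  apply Clim_plus, Clim_scal; auto.
Qed.

Lemma Clim_RtoC u l : is_lim_seq u (Finite l) -> Clim (fun n => RtoC (u n)) (RtoC l).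
Proof. intros H. apply Clim_Re_Im. split; simpl; [exact H | apply is_lim_seq_const]. Qed.

Lemma Clim_Cmod u l : Clim u l -> is_lim_seq (fun n => Cmod (u n)) (Cmod l).
Proof.
  intros H. apply is_lim_seq_spec. intros eps. destruct (H eps (cond_pos eps)) as [N HN].
  exists N. intros n Hn. eapply Rle_lt_trans; [| apply (HN n Hn)].
  assert (A : (Cmod (u n) <= Cmod l + Cmod (u n - l))%R).
  { replace (u n) with (l + (u n - l)) at 1 by ring. apply Cmod_triangle. }
  assert (B : (Cmod l <= Cmod (u n) + Cmod (u n - l))%R).
  { rewrite <- (Cmod_opp (u n - l)). replace l with (u n + - (u n - l)) at 1 by ring. apply Cmod_triangle. }
  apply Rabs_le. lra.
Qed.

Lemma Clim_inv u (l : C) : l <> 0 -> Clim u l -> Clim (fun n => / u n) (/ l).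
Proof.
  intros Hl H.
  pose proof (Clim_Cmod _ _ H) as Hm.
  rewrite Clim_Re_Im in H. destruct H as [A B].
  assert (Hd : (Re l ^ 2 + Im l ^ 2 <> 0)%R).
  { intros E. apply Hl. apply Cmod_eq_0. unfold Cmod.
    change (fst l) with (Re l). change (snd l) with (Im l). rewrite E. apply sqrt_0. }
  assert (D : is_lim_seq (fun n => (Re (u n) ^ 2 + Im (u n) ^ 2)%R) (Re l ^ 2 + Im l ^ 2)%R).
  { apply is_lim_seq_plus'; simpl;
      repeat apply is_lim_seq_mult'; auto; apply is_lim_seq_const. }
  assert (D' : is_lim_seq (fun n => / (Re (u n) ^ 2 + Im (u n) ^ 2))%R (/ (Re l ^ 2 + Im l ^ 2))%R).
  { apply (is_lim_seq_inv _ (Finite _) D). intros E; injection E; auto. }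
  apply Clim_Re_Im. split.
  - apply (is_lim_seq_mult' _ _ _ _ A D').
  - apply (is_lim_seq_mult' (fun n => - Im (u n))%R _ (- Im l)%R _).
    + apply (proj1 (is_lim_seq_opp _ (Finite _)) B).
    + exact D'.
Qed.

Lemma Clim_incr u l : Clim u l -> Clim (fun n => u (S n)) l.
Proof. intros H eps He. destruct (H eps He) as [N HN]. exists N. intros. apply HN. lia. Qed.

Lemma Clim_subseq u l (f : nat -> nat) : (forall n, (n <= f n)%nat) -> Clim u l -> Clim (fun n => u (f n)) l.
Proof. intros F H eps He. destruct (H eps He) as [N HN]. exists N. intros n Hn. apply HN. specialize (F n). lia. Qed.

Lemma Clim_Cmod_le u l B : (exists N, forall n, (N <= n)%nat -> (Cmod (u n) <= B)%R) -> Clim u l -> (Cmod l <= B)%R.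
Proof.
  intros [N HN] H. apply Clim_Cmod in H.
  apply (is_lim_seq_le_loc (fun n => Cmod (u n)) (fun _ => B) (Cmod l) B).
  - exists N. exact HN.
  - exact H.
  - apply is_lim_seq_const.
Qed.

Lemma Cser_unique a l l' : Cser a l -> Cser a l' -> l = l'.
Proof. rewrite !Cser_Clim. apply Clim_unique. Qed.

Lemma Cser_ext a b l : (forall n, a n = b n) -> Cser a l -> Cser b l.
Proof. intros E. apply is_series_ext. exact E. Qed.

Lemma Cser_plus a b la lb : Cser a la -> Cser b lb -> Cser (fun n => a n + b n) (la + lb).
Proof. apply (is_series_plus (K := C_AbsRing) (V := C_NormedModule)). Qed.

Lemma Cser_scal c a l : Cser a l -> Cser (fun n => c * a n) (c * l).
Proof. apply (is_series_scal (K := C_AbsRing) (V := C_NormedModule)). Qed.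

Lemma Cser_minus a b la lb : Cser a la -> Cser b lb -> Cser (fun n => a n - b n) (la - lb).
Proof.
  intros A B. replace (la - lb) with (la + -(1) * lb) by ring.
  eapply Cser_ext; [| apply (Cser_plus _ _ _ _ A (Cser_scal (-(1)) _ _ B))]. intros; simpl; ring.
Qed.

Lemma Cser_0 : Cser (fun _ => 0) 0.
Proof.
  apply Cser_Clim. apply Clim_ext with (fun _ => 0); [| apply Clim_const].
  intros n. induction n; simpl; auto. rewrite <- IHn. ring.
Qed.

Lemma Cser_Csum (f : nat -> nat -> C) (l : nat -> C) N :
  (forall i, (i < N)%nat -> Cser (f i) (l i)) ->
  Cser (fun n => Csum (fun i => f i n) N) (Csum l N).
Proof.
  induction N; intros H; simpl.
  - apply Cser_0.
  - apply Cser_plus; [apply IHN; intros; apply H; lia | apply H; lia].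
Qed.

Lemma is_series_Rsum (b : nat -> R) x : is_series b x <-> is_lim_seq (Rsum b) x.
Proof.
  split; intros H.
  - apply is_lim_seq_incr_1. eapply is_lim_seq_ext; [| exact H].
    intros n. now rewrite sum_n_Rsum.
  - apply is_lim_seq_incr_1 in H. eapply (is_lim_seq_ext _ (sum_n b)) in H; [exact H |].
    intros n. now rewrite sum_n_Rsum.
Qed.

Lemma Cser_Re_Im a l :
  Cser a l <-> is_series (fun n => Re (a n)) (Re l) /\ is_series (fun n => Im (a n)) (Im l).
Proof.
  rewrite Cser_Clim, Clim_Re_Im, !is_series_Rsum. split; intros [A B]; split;
    [eapply is_lim_seq_ext; [| exact A] | eapply is_lim_seq_ext; [| exact B]
    |eapply is_lim_seq_ext; [| exact A] | eapply is_lim_seq_ext; [| exact B]];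
    intros n; simpl; now rewrite ?Re_Csum, ?Im_Csum.
Qed.

Lemma Cser_ex a : ex_series (fun n => Cmod (a n)) -> exists l, Cser a l.
Proof.
  intros H.
  destruct (ex_series_le (K := C_AbsRing) (V := C_CompleteNormedModule) a (fun n => Cmod (a n))) as [l Hl].
  - intros n. apply Rle_refl.
  - exact H.
  - exists l. exact Hl.
Qed.

Lemma Rsum_le_Series (b : nat -> R) n :
  (forall k, (0 <= b k)%R) -> ex_series b -> (Rsum b n <= Series b)%R.
Proof.
  intros Hb [l Hl]. rewrite (is_series_unique _ _ Hl).
  apply is_series_Rsum in Hl.
  apply (is_lim_seq_incr_compare _ _ Hl). intros k. simpl. specialize (Hb k). lra.
Qed.

Lemma ex_series_bounded (b : nat -> R) B :
  (forall k, (0 <= b k)%R) -> (forall n, (Rsum b n <= B)%R) -> ex_series b.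
Proof.
  intros Hb HB.
  destruct (ex_finite_lim_seq_incr (Rsum b) B) as [l Hl].
  - intros n; simpl. specialize (Hb n). lra.
  - exact HB.
  - exists l. now apply is_series_Rsum.
Qed.

Lemma Cser_Cmod_le a l B :
  (forall n, (Rsum (fun k => Cmod (a k)) n <= B)%R) -> Cser a l -> (Cmod l <= B)%R.
Proof.
  intros H Ha. apply Cser_Clim in Ha. apply (Clim_Cmod_le (Csum a) l B); auto.
  exists 0%nat. intros n _. eapply Rle_trans; [apply Cmod_Csum | apply H].
Qed.

Lemma Clim_term_0 a l : Cser a l -> Clim a 0.
Proof.
  intros H. apply Cser_Clim in H.
  replace (RtoC 0) with (l - l) by ring.
  apply Clim_ext with (fun n => Csum a (S n) - Csum a n); [intros; simpl; ring |].
  apply Clim_minus; auto. now apply Clim_incr.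
Qed.

Lemma Clim_bounded u l : Clim u l -> exists B, (0 <= B)%R /\ forall n, (Cmod (u n) <= B)%R.
Proof.
  intros H. destruct (H 1%R Rlt_0_1) as [N HN].
  assert (A : exists B, (0 <= B)%R /\ forall n, (n < N)%nat -> (Cmod (u n) <= B)%R).
  { clear HN. induction N. exists 0%R. split; [lra | intros; lia].
    destruct IHN as [B [B0 HB]]. exists (Rmax B (Cmod (u N))). split.
    - eapply Rle_trans; [exact B0 | apply Rmax_l].
    - intros n Hn. destruct (Nat.eq_dec n N) as [-> | ?]; [apply Rmax_r |].
      eapply Rle_trans; [apply HB; lia | apply Rmax_l]. }
  destruct A as [B [B0 HB]]. exists (B + (Cmod l + 1))%R.
  pose proof (Cmod_ge_0 l). split; [lra |].
  intros n. destruct (le_lt_dec N n) as [Hn | Hn].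
  - specialize (HN n Hn). replace (u n) with (l + (u n - l)) by ring.
    eapply Rle_trans; [apply Cmod_triangle |]. lra.
  - specialize (HB n Hn). lra.
Qed.

Lemma Rsum_add g K m : Rsum g (K + m) = (Rsum g K + Rsum (fun k => g (K + k)%nat) m)%R.
Proof.
  induction m; [rewrite Nat.add_0_r; simpl; ring |].
  rewrite Nat.add_succ_r. simpl. rewrite IHm. ring.
Qed.

Lemma Cser_tail a l K : Cser a l -> Cser (fun k => a (K + k)%nat) (l - Csum a K).
Proof.
  rewrite !Cser_Clim. intros H eps He. destruct (H eps He) as [N HN].
  exists N. intros n Hn.
  replace (Csum (fun k => a (K + k)%nat) n - (l - Csum a K)) with (Csum a (K + n) - l)
    by (rewrite Csum_add; ring).
  apply HN. lia.
Qed.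

(** Tannery's theorem, the discrete dominated convergence. The majorant is demanded only for n >= N0
    and k >= K0: finitely many columns converge one by one, and in the cotangent limit the
    denominators are controlled only for large k. *)
Lemma Cser_tannery (f : nat -> nat -> C) (S : nat -> C) (F : nat -> C) (g : nat -> R) T N0 K0 :
  (forall n, (N0 <= n)%nat -> Cser (f n) (S n)) ->
  (forall n k, (N0 <= n)%nat -> (K0 <= k)%nat -> (Cmod (f n k) <= g k)%R) ->
  (forall k, (0 <= g k)%R) ->
  ex_series g ->
  (forall k, Clim (fun n => f n k) (F k)) ->
  Cser F T ->
  Clim S T.
Proof.
  intros HS Hf Hgp Hg Hlim HT eps He.
  apply Cser_Clim in HT. destruct (HT (eps / 4)%R ltac:(lra)) as [N1 HN1].
  destruct Hg as [G HG]. apply is_series_Rsum in HG.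
  assert (HGt : forall n, (Rsum g n <= G)%R).
  { intros n. apply (is_lim_seq_incr_compare _ _ HG). intros k; simpl. specialize (Hgp k); lra. }
  apply is_lim_seq_spec in HG.
  destruct (HG (mkposreal (eps / 4) ltac:(lra))) as [N2 HN2].
  set (K := (N1 + N2 + K0)%nat).
  assert (HK : Clim (fun n => Csum (f n) K) (Csum F K)).
  { clear HN1 HN2. generalize K. intros m. induction m; simpl; [apply Clim_const |].
    apply Clim_plus; auto. }
  destruct (HK (eps / 4)%R ltac:(lra)) as [N3 HN3].
  exists (N0 + N3)%nat. intros n Hn.
  specialize (HN3 n ltac:(lia)). specialize (HN1 K ltac:(unfold K; lia)).
  specialize (HN2 K ltac:(unfold K; lia)). simpl in HN2.
  assert (Ht : (Cmod (S n - Csum (f n) K) <= eps / 4)%R).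
  { apply (Cser_Cmod_le (fun k => f n (K + k)%nat)); [| apply Cser_tail, HS; lia].
    intros m. eapply Rle_trans; [apply (Rsum_le _ (fun k => g (K + k)%nat)) |].
    - intros k Hk. apply Hf; unfold K; lia.
    - specialize (HGt (K + m)%nat). rewrite Rsum_add in HGt.
      apply Rabs_def2 in HN2. lra. }
  replace (S n - T)
    with ((Csum (f n) K - Csum F K) + ((Csum F K - T) + (S n - Csum (f n) K))) by ring.
  eapply Rle_lt_trans; [apply Cmod_triangle |].
  pose proof (Cmod_triangle (Csum F K - T) (S n - Csum (f n) K)). lra.
Qed.

Lemma Cser_finite f L : (forall k, (L <= k)%nat -> f k = RtoC 0) -> Cser f (Csum f L).
Proof.
  intros H. apply Cser_Clim. intros eps He. exists L. intros n Hn.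
  replace n with (L + (n - L))%nat by lia. rewrite Csum_add.
  rewrite (Csum_ext (fun k => f (L + k)%nat) (fun _ => 0)) by (intros; apply H; lia).
  rewrite Csum_const. replace (_ - _) with (RtoC 0) by ring. now rewrite Cmod_0.
Qed.

(** The same for finite sums of growing length, extended by zero to full series; the finite
    cotangent sums have this shape. *)
Lemma Csum_tannery (f : nat -> nat -> C) (F : nat -> C) (g : nat -> R) (L : nat -> nat) T N0 K0 :
  (forall n, (n <= L n)%nat) ->
  (forall n k, (N0 <= n)%nat -> (K0 <= k)%nat -> (k < L n)%nat -> (Cmod (f n k) <= g k)%R) ->
  (forall k, (0 <= g k)%R) ->
  ex_series g ->
  (forall k, Clim (fun n => f n k) (F k)) ->
  Cser F T ->
  Clim (fun n => Csum (f n) (L n)) T.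
Proof.
  intros HL Hf Hgp Hg Hlim HT.
  set (f' := fun n k => if le_lt_dec (L n) k then RtoC 0 else f n k).
  apply (Cser_tannery f' _ F g T N0 K0); auto.
  - intros n _. rewrite (Csum_ext (f n) (f' n)).
    + apply Cser_finite. intros k Hk. unfold f'. destruct (le_lt_dec (L n) k); [auto | lia].
    + intros k Hk. unfold f'. destruct (le_lt_dec (L n) k); [lia | auto].
  - intros n k Hn Hk. unfold f'. destruct (le_lt_dec (L n) k).
    + rewrite Cmod_0. apply Hgp.
    + apply Hf; auto.
  - intros k. apply (Clim_ext_loc (fun n => f n k) _ _ (S k)); auto.
    intros n Hn. unfold f'. specialize (HL n). destruct (le_lt_dec (L n) k); [lia | auto].
Qed.

(** The product majorant u_i v_j is what the eta argument can supply: one summable weight for each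
    index. The exchange is Tannery's theorem for the partial sums over columns, dominated by u_i
    times the sum of v. *)
Lemma Cser_fubini (a : nat -> nat -> C) (u v : nat -> R) (r k : nat -> C) :
  (forall i, (0 <= u i)%R) -> (forall j, (0 <= v j)%R) -> ex_series u -> ex_series v ->
  (forall i j, (Cmod (a i j) <= u i * v j)%R) ->
  (forall i, Cser (a i) (r i)) -> (forall j, Cser (fun i => a i j) (k j)) ->
  exists T, Cser r T /\ Cser k T.
Proof.
  intros Hu Hv Eu Ev Ha Hr Hk.
  assert (HV : forall i n, (Rsum (fun j => Cmod (a i j)) n <= u i * Series v)%R).
  { intros i n. eapply Rle_trans; [apply Rsum_le; intros; apply Ha |].
    rewrite Rsum_scal. apply Rmult_le_compat_l; auto. now apply Rsum_le_Series. }
  assert (Eu' : ex_series (fun i => u i * Series v)%R) by now apply (ex_series_scal_r (Series v)).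
  assert (HV0 : (0 <= Series v)%R) by (apply (Rsum_le_Series v 0 Hv Ev)).
  destruct (Cser_ex r) as [T HT].
  { apply (@ex_series_le R_AbsRing R_CompleteNormedModule) with (fun i => u i * Series v)%R; auto.
    intros i. unfold norm; simpl. unfold abs; simpl.
    rewrite Rabs_pos_eq by apply Cmod_ge_0. apply (Cser_Cmod_le (a i)); auto. }
  exists T. split; auto. apply Cser_Clim.
  apply (Cser_tannery (fun J i => Csum (a i) J) _ r (fun i => u i * Series v)%R T 0 0); auto.
  - intros J _. apply (Cser_Csum (fun j i => a i j) k J). auto.
  - intros J i _ _. eapply Rle_trans; [apply Cmod_Csum | apply HV].
  - intros i. apply Rmult_le_pos; auto.
  - intros i. now apply Cser_Clim.
Qed.

Definition conv (a b : nat -> C) (n : nat) : C := Csum (fun k => a k * b (n - k)%nat) (S n).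

Lemma sum_f_R0_Rsum f n : sum_f_R0 f n = Rsum f (S n).
Proof. induction n; simpl; [ring |]. rewrite IHn. simpl. ring. Qed.

Lemma Cser_conv a b la lb :
  Cser a la -> Cser b lb ->
  ex_series (fun n => Cmod (a n)) -> ex_series (fun n => Cmod (b n)) ->
  Cser (conv a b) (la * lb).
Proof.
  rewrite !Cser_Re_Im. intros [A1 A2] [B1 B2] Ea Eb.
  assert (R1 : forall c : nat -> C, ex_series (fun n => Cmod (c n)) -> ex_series (fun n => Rabs (Re (c n)))).
  { intros c. apply (@ex_series_le R_AbsRing R_CompleteNormedModule). intros n.
    unfold norm; simpl; unfold abs; simpl. rewrite Rabs_Rabsolu. apply re_le_Cmod. }
  assert (R2 : forall c : nat -> C, ex_series (fun n => Cmod (c n)) -> ex_series (fun n => Rabs (Im (c n)))).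
  { intros c. apply (@ex_series_le R_AbsRing R_CompleteNormedModule). intros n.
    unfold norm; simpl; unfold abs; simpl. rewrite Rabs_Rabsolu. apply im_le_Cmod. }
  pose proof (is_series_mult _ _ _ _ A1 B1 (R1 _ Ea) (R1 _ Eb)) as P11.
  pose proof (is_series_mult _ _ _ _ A1 B2 (R1 _ Ea) (R2 _ Eb)) as P12.
  pose proof (is_series_mult _ _ _ _ A2 B1 (R2 _ Ea) (R1 _ Eb)) as P21.
  pose proof (is_series_mult _ _ _ _ A2 B2 (R2 _ Ea) (R2 _ Eb)) as P22.
  split.
  - eapply is_series_ext; [| apply (is_series_minus _ _ _ _ P11 P22)].
    intros n. unfold conv. rewrite Re_Csum. rewrite !sum_f_R0_Rsum.
    generalize (S n). intros m. unfold minus, plus, opp; simpl.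
    induction m; simpl; [ring |]. rewrite <- IHm. unfold Re, Im. ring.
  - eapply is_series_ext; [| apply (is_series_plus _ _ _ _ P12 P21)].
    intros n. unfold conv. rewrite Im_Csum. rewrite !sum_f_R0_Rsum.
    generalize (S n). intros m. unfold plus; simpl.
    induction m; simpl; [ring |]. rewrite <- IHm. unfold Re, Im. ring.
Qed.

Lemma ex_series_Rle (a b : nat -> R) :
  (forall n, (0 <= a n <= b n)%R) -> ex_series b -> ex_series a.
Proof.
  intros H. apply (@ex_series_le R_AbsRing R_CompleteNormedModule). intros n.
  change (Rabs (a n) <= b n)%R. rewrite Rabs_pos_eq; apply H.
Qed.

Lemma RtoC_neq0 (x : R) : x <> 0%R -> RtoC x <> 0.
Proof. intros H E. apply H. now apply RtoC_inj. Qed.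

Lemma INR_S_neq0 n : RtoC (INR (S n)) <> 0.
Proof. apply RtoC_neq0, not_0_INR. lia. Qed.

Lemma INR_S_ge1 n : (1 <= INR (S n))%R.
Proof. rewrite S_INR. pose proof (pos_INR n). lra. Qed.

Lemma ex_series_Rscal (c : R) (a : nat -> R) : ex_series a -> ex_series (fun n => c * a n)%R.
Proof. apply (ex_series_scal_l (K := R_AbsRing) c a). Qed.

Lemma exp_le_compat (x y : R) : (x <= y)%R -> (exp x <= exp y)%R.
Proof. intros [H | ->]; [apply Rlt_le, exp_increasing; auto | apply Rle_refl]. Qed.

(** * The complex exponential *)

Definition cexp (z : C) : C := (exp (Re z) * cos (Im z), exp (Re z) * sin (Im z))%R.

Lemma cexp_plus x y : cexp (x + y) = cexp x * cexp y.
Proof.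
  unfold cexp. rewrite Re_plus, Im_plus, exp_plus, cos_plus, sin_plus.
  apply Ceq; simpl; ring.
Qed.

Lemma cexp_0 : cexp 0 = 1.
Proof. unfold cexp; simpl. rewrite exp_0, cos_0, sin_0. apply Ceq; simpl; ring. Qed.

Lemma cexp_opp_l x : cexp (- x) * cexp x = 1.
Proof. rewrite <- cexp_plus. replace (- x + x) with (RtoC 0) by ring. apply cexp_0. Qed.

Lemma cexp_nz x : cexp x <> 0.
Proof.
  intros E. pose proof (cexp_opp_l x) as H. rewrite E, Cmult_0_r in H.
  injection H as H. lra.
Qed.

Lemma cexp_opp x : cexp (- x) = / cexp x.
Proof.
  pose proof (cexp_nz x). rewrite <- (Cmult_1_l (/ cexp x)), <- (cexp_opp_l x). field. auto.
Qed.

Lemma Cmod_cexp x : Cmod (cexp x) = exp (Re x).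
Proof.
  unfold Cmod, cexp; cbn [fst snd].
  replace ((exp (Re x) * cos (Im x)) ^ 2 + (exp (Re x) * sin (Im x)) ^ 2)%R
    with (exp (Re x) * exp (Re x) * (Rsqr (sin (Im x)) + Rsqr (cos (Im x))))%R
    by (unfold Rsqr; ring).
  rewrite sin2_cos2, Rmult_1_r. apply sqrt_square. apply Rlt_le, exp_pos.
Qed.

Lemma cexp_pow x n : cexp x ^ n = cexp (RtoC (INR n) * x).
Proof.
  induction n.
  - simpl. rewrite Cmult_0_l. now rewrite cexp_0.
  - rewrite Cpow_S, IHn, <- cexp_plus, S_INR, RtoC_plus. f_equal. ring.
Qed.

Lemma cexp_2pi_nat n : cexp (2 * PI * Ci * RtoC (INR n)) = 1.
Proof.
  unfold cexp. replace (Re (2 * PI * Ci * RtoC (INR n))) with 0%R by (simpl; ring).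
  replace (Im (2 * PI * Ci * RtoC (INR n))) with (0 + 2 * INR n * PI)%R by (simpl; ring).
  rewrite exp_0, cos_period, sin_period, cos_0, sin_0. apply Ceq; simpl; ring.
Qed.

Lemma cexp_2pi_Z (n : Z) : cexp (2 * PI * Ci * RtoC (IZR n)) = 1.
Proof.
  destruct (Z_le_gt_dec 0 n) as [H | H].
  - rewrite <- (Z2Nat.id n H), <- INR_IZR_INZ. apply cexp_2pi_nat.
  - replace (2 * PI * Ci * RtoC (IZR n)) with (- (2 * PI * Ci * RtoC (INR (Z.to_nat (- n))))).
    + rewrite cexp_opp, cexp_2pi_nat. field.
    + rewrite INR_IZR_INZ, Z2Nat.id, opp_IZR, RtoC_opp by lia. ring.
Qed.

Lemma q_cexp tau : q tau = cexp (2 * PI * Ci * tau).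
Proof.
  unfold q, cexp. destruct tau as [x y].
  replace (Re (2 * PI * Ci * (x, y))) with (- (2 * PI * y))%R by (simpl; ring).
  replace (Im (2 * PI * Ci * (x, y))) with (2 * PI * x)%R by (simpl; ring).
  apply Ceq; simpl; ring.
Qed.

Lemma Cmod_q tau : Cmod (q tau) = exp (- (2 * PI * Im tau)).
Proof.
  rewrite q_cexp, Cmod_cexp. f_equal. destruct tau; simpl; ring.
Qed.

Lemma Cmod_q_lt tau : upper_half_plane tau -> (Cmod (q tau) < 1)%R.
Proof.
  unfold upper_half_plane. intros H. rewrite Cmod_q. rewrite <- exp_0.
  apply exp_increasing. pose proof PI_RGT_0. nra.
Qed.

Lemma q_nz tau : q tau <> 0.
Proof. rewrite q_cexp. apply cexp_nz. Qed.

Lemma Clim_cexp u l : Clim u l -> Clim (fun n => cexp (u n)) (cexp l).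
Proof.
  rewrite !Clim_Re_Im. intros [A B]. unfold cexp; simpl.
  assert (E : is_lim_seq (fun n => exp (Re (u n))) (exp (Re l))).
  { apply (is_lim_seq_continuous exp); auto. apply derivable_continuous_pt, derivable_pt_exp. }
  assert (D : is_lim_seq (fun n => cos (Im (u n))) (cos (Im l))).
  { apply (is_lim_seq_continuous cos); auto. apply continuity_cos. }
  assert (F : is_lim_seq (fun n => sin (Im (u n))) (sin (Im l))).
  { apply (is_lim_seq_continuous sin); auto. apply continuity_sin. }
  split; apply is_lim_seq_mult'; auto.
Qed.

(** The derivative of the exponential at 0 along a real null sequence. With h = 1/N it gives the
    limits of both N (1 - x) and N sin(pi j / N) in the finite cotangent formula. *)
Lemma cexp_derive_0 (w : C) (h : nat -> R) :
  (forall n, h n <> 0%R) -> is_lim_seq h 0%R ->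
  Clim (fun n => (cexp (w * h n) - 1) / h n) w.
Proof.
  intros Hh Hl. destruct w as [x y].
  assert (D : forall (f : R -> R) l, is_derive f 0%R l ->
      is_lim_seq (fun n => ((f (h n) - f 0) / h n)%R) l).
  { intros f l Hf. apply is_derive_Reals in Hf. apply is_lim_seq_spec. intros eps.
    destruct (Hf eps (cond_pos eps)) as [d Hd].
    apply is_lim_seq_spec in Hl. destruct (Hl d) as [N HN].
    exists N. intros n Hn. specialize (HN n Hn). rewrite Rminus_0_r in HN.
    specialize (Hd (h n) (Hh n) HN). rewrite Rplus_0_l in Hd. exact Hd. }
  apply Clim_Re_Im. split.
  - assert (A : is_derive (fun t => exp (x * t) * cos (y * t))%R 0%R x).
    { auto_derive; auto. rewrite !Rmult_0_r, exp_0, cos_0, sin_0. ring. }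
    apply D in A. eapply is_lim_seq_ext; [| exact A]. intros n.
    rewrite !Rmult_0_r, exp_0, cos_0. unfold cexp. simpl. specialize (Hh n).
    replace (x * h n - y * 0)%R with (x * h n)%R by ring.
    replace (x * 0 + y * h n)%R with (y * h n)%R by ring.
    field. auto.
  - assert (A : is_derive (fun t => exp (x * t) * sin (y * t))%R 0%R y).
    { auto_derive; auto. rewrite !Rmult_0_r, exp_0, cos_0, sin_0. ring. }
    apply D in A. eapply is_lim_seq_ext; [| exact A]. intros n.
    rewrite !Rmult_0_r, exp_0, sin_0. unfold cexp. simpl. specialize (Hh n).
    replace (x * h n - y * 0)%R with (x * h n)%R by ring.
    replace (x * 0 + y * h n)%R with (y * h n)%R by ring.
    field. auto.
Qed.

Lemma Cmod_lt_1_nz (x : C) : (Cmod x < 1)%R -> 1 - x <> 0.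
Proof.
  intros H E. assert (x = 1) as ->.
  { replace x with (1 - (1 - x)) by ring. rewrite E. ring. }
  rewrite Cmod_1 in H. lra.
Qed.

Lemma ex_series_geom_Cmod (r : R) : (0 <= r < 1)%R -> ex_series (fun n => r ^ n)%R.
Proof. intros. apply ex_series_geom. rewrite Rabs_pos_eq; lra. Qed.

Lemma Clim_pow_0 (x : C) : (Cmod x < 1)%R -> Clim (fun n => x ^ n) 0.
Proof.
  intros H eps He. assert (L : is_lim_seq (fun n => Cmod x ^ n)%R 0%R).
  { apply is_lim_seq_geom. rewrite Rabs_pos_eq; [auto | apply Cmod_ge_0]. }
  apply is_lim_seq_spec in L. destruct (L (mkposreal _ He)) as [N HN].
  exists N. intros n Hn. specialize (HN n Hn). simpl in HN.
  replace (x ^ n - 0) with (x ^ n) by ring. rewrite Cmod_pow.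
  rewrite Rminus_0_r in HN. rewrite Rabs_pos_eq in HN by (apply pow_le, Cmod_ge_0). exact HN.
Qed.

Lemma Csum_geom (x : C) n : (1 - x) * Csum (fun k => x ^ k) n = 1 - x ^ n.
Proof. induction n; simpl; [ring |]. rewrite Cmult_plus_distr_l, IHn. ring. Qed.

Lemma Cser_geom (x : C) : (Cmod x < 1)%R -> Cser (fun n => x ^ n) (/ (1 - x)).
Proof.
  intros H. pose proof (Cmod_lt_1_nz x H) as N. apply Cser_Clim.
  apply Clim_ext with (fun n => / (1 - x) * (1 - x ^ n)).
  - intros n. rewrite <- Csum_geom. field. auto.
  - eapply eq_ind; [apply Clim_scal, Clim_minus; [apply Clim_const | apply (Clim_pow_0 x H)] |]. ring.
Qed.

Lemma ex_series_log (x : C) : (Cmod x < 1)%R ->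
  ex_series (fun n => Cmod (x ^ S n / RtoC (INR (S n)))).
Proof.
  intros H. apply ex_series_Rle with (fun n => Cmod x ^ n)%R.
  - intros n. split; [apply Cmod_ge_0 |]. pose proof (INR_S_ge1 n) as Hn.
    rewrite Cmod_div by apply INR_S_neq0.
    rewrite Cmod_pow, Cmod_R, (Rabs_pos_eq (INR (S n))) by lra.
    pose proof (Cmod_ge_0 x) as H0. pose proof (pow_le _ n H0).
    apply Rle_div_l; [lra |]. rewrite <- tech_pow_Rmult.
    assert (Cmod x * Cmod x ^ n <= 1 * Cmod x ^ n)%R by (apply Rmult_le_compat_r; lra).
    assert (Cmod x ^ n * 1 <= Cmod x ^ n * INR (S n))%R by (apply Rmult_le_compat_l; lra).
    lra.
  - apply ex_series_geom_Cmod. split; [apply Cmod_ge_0 | auto].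
Qed.

Lemma null_derive_const (f : R -> R) :
  (forall t, (0 <= t <= 1)%R -> is_derive f t 0%R) -> f 1%R = f 0%R.
Proof.
  intros H. destruct (MVT_gen f 0 1 (fun _ => 0%R)) as [c [_ E]].
  - intros t Ht. apply H. rewrite Rmin_left, Rmax_right in Ht; lra.
  - intros t Ht. apply continuity_pt_filterlim. apply (ex_derive_continuous (K := R_AbsRing) (V := R_NormedModule)). exists 0%R. apply H.
    rewrite Rmin_left, Rmax_right in Ht; lra.
  - lra.
Qed.

(** For t from 0 to 1 let f + i g be the logarithmic series at t x. Then exp(f + i g) (1 - t x) has
    derivative zero and equals 1 at t = 0. The argument is componentwise over the reals, so no
    branch of the logarithm has to be chosen. *)
Lemma cexp_log (x l : C) : (Cmod x < 1)%R ->
  Cser (fun n => x ^ S n / RtoC (INR (S n))) l -> cexp (- l) = 1 - x.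
Proof.
  intros Hx Hl.
  set (A := fun n => match n with O => 0%R | S m => Re (x ^ n / RtoC (INR n)) end).
  set (B := fun n => match n with O => 0%R | S m => Im (x ^ n / RtoC (INR n)) end).
  assert (Hdiv : forall n (z : C), z / RtoC (INR (S n)) = RtoC (/ INR (S n)) * z).
  { intros n z. rewrite RtoC_inv by (apply not_0_INR; lia). unfold Cdiv. ring. }
  assert (Hn0 : forall n, INR (S n) <> 0%R) by (intros; apply not_0_INR; lia).
  assert (HA : forall n, (INR (S n) * A (S n) = Re (x ^ S n))%R).
  { intros n. unfold A. rewrite Hdiv, re_scal_l. field. auto. }
  assert (HB : forall n, (INR (S n) * B (S n) = Im (x ^ S n))%R).
  { intros n. unfold B. rewrite Hdiv, im_scal_l. field. auto. }
  assert (Rad : forall D : nat -> R, (forall n, (Rabs (D n) <= Cmod x ^ n)%R) ->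
     forall t, (0 <= t <= 1)%R -> Rbar_lt (Rabs t) (CV_radius D)).
  { intros D HD t Ht.
    (* Since r > 1 and |x| r <= 1, the point t = 1 lies strictly inside the disc of convergence. *)
    set (r := (2 / (1 + Cmod x))%R). pose proof (Cmod_ge_0 x).
    assert (Hr : (1 < r)%R). { unfold r. apply Rlt_div_r; lra. }
    assert (Hr2 : (Cmod x * r <= 1)%R).
    { unfold r. apply Rmult_le_reg_r with (1 + Cmod x)%R; [lra |]. field_simplify; lra. }
    apply Rbar_lt_le_trans with (Finite r); [simpl; rewrite Rabs_pos_eq; lra |].
    apply (proj1 (CV_radius_bounded D)). exists 1%R. intros n.
    rewrite Rabs_mult, <- RPow_abs, (Rabs_pos_eq r) by lra.
    apply Rle_trans with (Cmod x ^ n * r ^ n)%R.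
    - apply Rmult_le_compat_r; [apply pow_le; lra | apply HD].
    - rewrite <- Rpow_mult_distr. rewrite <- (pow1 n). apply pow_incr. split; auto.
      apply Rmult_le_pos; lra. }
  assert (HAb : forall n, (Rabs (A n) <= Cmod x ^ n)%R /\ (Rabs (B n) <= Cmod x ^ n)%R).
  { intros n. assert (Hm : (0 <= Cmod x ^ n)%R) by (apply pow_le, Cmod_ge_0).
    destruct n; [unfold A, B; rewrite Rabs_R0; simpl; lra |].
    assert (Hz : (Cmod (x ^ S n / RtoC (INR (S n))) <= Cmod x ^ S n)%R).
    { rewrite Hdiv, Cmod_mult, Cmod_R, Cmod_pow.
      assert (Hn : (1 <= INR (S n))%R) by (rewrite S_INR; pose proof (pos_INR n); lra).
      assert (0 < / INR (S n) <= 1)%R.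
      { split; [apply Rinv_0_lt_compat; lra |]. rewrite <- Rinv_1. apply Rinv_le_contravar; lra. }
      rewrite Rabs_pos_eq by lra.
      assert (/ INR (S n) * Cmod x ^ S n <= 1 * Cmod x ^ S n)%R by (apply Rmult_le_compat_r; lra).
      lra. }
    split; (eapply Rle_trans; [| exact Hz]); [apply re_le_Cmod | apply im_le_Cmod]. }
  assert (HRA : forall t, (0 <= t <= 1)%R -> Rbar_lt (Rabs t) (CV_radius A)).
  { apply Rad. intros; apply HAb. }
  assert (HRB : forall t, (0 <= t <= 1)%R -> Rbar_lt (Rabs t) (CV_radius B)).
  { apply Rad. intros; apply HAb. }
  assert (Htx : forall t, (0 <= t <= 1)%R -> (Cmod (t * x) < 1)%R).
  { intros t Ht. rewrite Cmod_mult, Cmod_R, Rabs_pos_eq by lra. pose proof (Cmod_ge_0 x). nra. }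
  assert (HD : forall t, (0 <= t <= 1)%R ->
    PSeries (PS_derive A) t = Re (x / (1 - t * x)) /\ PSeries (PS_derive B) t = Im (x / (1 - t * x))).
  { intros t Ht. pose proof (Cser_scal x _ _ (Cser_geom _ (Htx t Ht))) as G.
    apply Cser_Re_Im in G. destruct G as [G1 G2].
    assert (E : forall n, x * (t * x) ^ n = RtoC (t ^ n) * x ^ S n).
    { intros n. rewrite Cpow_mult_l, RtoC_pow. simpl. ring. }
    split; apply is_pseries_unique, is_pseries_R.
    - eapply is_series_ext; [| exact G1]. intros n. cbv beta.
      rewrite E, re_scal_l. unfold PS_derive. rewrite HA. change ((t ^ n * Re (x ^ S n))%R = (Re (x ^ S n) * t ^ n)%R). ring.
    - eapply is_series_ext; [| exact G2]. intros n. cbv beta.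
      rewrite E, im_scal_l. unfold PS_derive. rewrite HB. change ((t ^ n * Im (x ^ S n))%R = (Im (x ^ S n) * t ^ n)%R). ring. }
  set (f := PSeries A). set (g := PSeries B).
  assert (Df : forall t, (0 <= t <= 1)%R -> is_derive f t (Re (x / (1 - t * x)))).
  { intros t Ht. rewrite <- (proj1 (HD t Ht)). apply is_derive_PSeries. auto. }
  assert (Dg : forall t, (0 <= t <= 1)%R -> is_derive g t (Im (x / (1 - t * x)))).
  { intros t Ht. rewrite <- (proj2 (HD t Ht)). apply is_derive_PSeries. auto. }
  destruct x as [x1 x2].
  assert (Rel : forall t, (0 <= t <= 1)%R ->
     let a := Re ((x1, x2) / (1 - t * (x1, x2))) in let b := Im ((x1, x2) / (1 - t * (x1, x2))) in
     (a * (1 - t * x1) + b * (t * x2) = x1 /\ b * (1 - t * x1) - a * (t * x2) = x2)%R).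
  { intros t Ht a b. pose proof (Cmod_lt_1_nz _ (Htx t Ht)) as N.
    assert (E : (a, b) * (1 - t * (x1, x2)) = (x1, x2)).
    { replace (a, b) with ((x1, x2) / (1 - t * (x1, x2))) by (apply Ceq; reflexivity).
      field. exact N. }
    clearbody a b. pose proof (f_equal Re E) as E1. pose proof (f_equal Im E) as E2. simpl in E1, E2. split; lra. }
  (* Real and imaginary parts of exp(f + i g) (1 - t x). *)
  set (u := fun t => (exp (f t) * (cos (g t) * (1 - t * x1) + sin (g t) * (t * x2)))%R).
  set (v := fun t => (exp (f t) * (sin (g t) * (1 - t * x1) - cos (g t) * (t * x2)))%R).
  assert (Hu : u 1%R = u 0%R).
  { apply null_derive_const. intros t Ht. specialize (Rel t Ht). cbv zeta in Rel.
    specialize (Df t Ht). specialize (Dg t Ht).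
    set (a := Re ((x1, x2) / (1 - t * (x1, x2)))) in *. set (b := Im ((x1, x2) / (1 - t * (x1, x2)))) in *.
    unfold u. auto_derive.
    - repeat split; auto; eexists; eauto.
    - replace (Derive (fun t0 => f t0) t) with a by (symmetry; apply is_derive_unique; exact Df).
      replace (Derive (fun t0 => g t0) t) with b by (symmetry; apply is_derive_unique; exact Dg).
      destruct Rel as [R1 R2].
      transitivity (exp (f t) * (cos (g t) * ((a * (1 - t * x1) + b * (t * x2)) - x1)
           - sin (g t) * ((b * (1 - t * x1) - a * (t * x2)) - x2)))%R; [ring |].
      rewrite R1, R2. ring. }
  assert (Hv : v 1%R = v 0%R).
  { apply null_derive_const. intros t Ht. specialize (Rel t Ht). cbv zeta in Rel.
    specialize (Df t Ht). specialize (Dg t Ht).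
    set (a := Re ((x1, x2) / (1 - t * (x1, x2)))) in *. set (b := Im ((x1, x2) / (1 - t * (x1, x2)))) in *.
    unfold v. auto_derive.
    - repeat split; auto; eexists; eauto.
    - replace (Derive (fun t0 => f t0) t) with a by (symmetry; apply is_derive_unique; exact Df).
      replace (Derive (fun t0 => g t0) t) with b by (symmetry; apply is_derive_unique; exact Dg).
      destruct Rel as [R1 R2].
      transitivity (exp (f t) * (sin (g t) * ((a * (1 - t * x1) + b * (t * x2)) - x1)
           + cos (g t) * ((b * (1 - t * x1) - a * (t * x2)) - x2)))%R; [ring |].
      rewrite R1, R2. ring. }
  assert (F0 : f 0%R = 0%R) by (unfold f; rewrite PSeries_0; reflexivity).
  assert (G0 : g 0%R = 0%R) by (unfold g; rewrite PSeries_0; reflexivity).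
  apply Cser_Re_Im in Hl. destruct Hl as [L1 L2].
  assert (F1 : f 1%R = Re l).
  { apply is_pseries_unique, is_pseries_R. apply is_series_decr_1.
    replace (plus _ _) with (Re l) by (unfold plus, opp; simpl; ring).
    eapply is_series_ext; [| exact L1]. intros n. rewrite pow1, Rmult_1_r. reflexivity. }
  assert (G1 : g 1%R = Im l).
  { apply is_pseries_unique, is_pseries_R. apply is_series_decr_1.
    replace (plus _ _) with (Im l) by (unfold plus, opp; simpl; ring).
    eapply is_series_ext; [| exact L2]. intros n. rewrite pow1, Rmult_1_r. reflexivity. }
  unfold u in Hu. unfold v in Hv. rewrite F0, G0, F1, G1, exp_0, cos_0, sin_0 in *.
  assert (E : cexp l * (1 - (x1, x2)) = 1).
  { unfold cexp. apply Ceq; simpl; lra. }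
  rewrite cexp_opp. pose proof (cexp_nz l).
  replace (1 - (x1, x2)) with (/ cexp l * (cexp l * (1 - (x1, x2)))) by (field; auto).
  rewrite E. ring.
Qed.

(** * Partial fractions of the cotangent *)

Definition ee (x : R) : C := cexp (2 * PI * Ci * RtoC x).

Lemma ee_plus x y : ee (x + y) = ee x * ee y.
Proof. unfold ee. rewrite <- cexp_plus, RtoC_plus. f_equal. ring. Qed.

Lemma ee_Z (n : Z) : ee (IZR n) = 1.
Proof. apply cexp_2pi_Z. Qed.

Lemma ee_INR n : ee (INR n) = 1.
Proof. apply cexp_2pi_nat. Qed.

Lemma ee_pow x n : ee x ^ n = ee (INR n * x).
Proof. unfold ee. rewrite cexp_pow, RtoC_mult. f_equal. ring. Qed.

Lemma ee_nz x : ee x <> 0.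
Proof. apply cexp_nz. Qed.

Lemma ee_Re x : Re (ee x) = cos (2 * PI * x).
Proof.
  unfold ee, cexp. replace (Re (2 * PI * Ci * RtoC x)) with 0%R by (simpl; ring).
  replace (Im (2 * PI * Ci * RtoC x)) with (2 * PI * x)%R by (simpl; ring).
  rewrite exp_0. simpl. ring.
Qed.

Lemma Cmod_ee x : Cmod (ee x) = 1%R.
Proof.
  unfold ee. rewrite Cmod_cexp. replace (Re (2 * PI * Ci * RtoC x)) with 0%R by (simpl; ring).
  apply exp_0.
Qed.

Lemma ee_neq1 x : (0 < x < 1)%R -> ee x <> 1.
Proof.
  intros H E. pose proof (f_equal Re E) as E1. rewrite ee_Re in E1. simpl in E1.
  replace (2 * PI * x)%R with (2 * (PI * x))%R in E1 by ring.
  rewrite cos_2a_sin in E1. pose proof PI_RGT_0.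
  assert (0 < sin (PI * x))%R by (apply sin_gt_0; nra). nra.
Qed.

Lemma unity_sum (k : Z) n : (0 < n)%nat ->
  Csum (fun j => ee (IZR k * INR j / INR n)) n
  = if Z.eq_dec (k mod Z.of_nat n) 0 then RtoC (INR n) else 0.
Proof.
  intros Hn. assert (Hn0 : INR n <> 0%R) by (apply not_0_INR; lia).
  set (w := ee (IZR k / INR n)).
  rewrite (Csum_ext _ (fun j => w ^ j)).
  2:{ intros j _. unfold w. rewrite ee_pow. f_equal. field. auto. }
  assert (Hw : w = ee (IZR (k mod Z.of_nat n) / INR n)).
  { unfold w. rewrite (Z.div_mod k (Z.of_nat n)) at 1 by lia.
    rewrite plus_IZR, mult_IZR, <- INR_IZR_INZ.
    replace ((INR n * IZR (k / Z.of_nat n) + IZR (k mod Z.of_nat n)) / INR n)%R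
      with (IZR (k / Z.of_nat n) + IZR (k mod Z.of_nat n) / INR n)%R by (field; auto).
    rewrite ee_plus, ee_Z. ring. }
  destruct (Z.eq_dec (k mod Z.of_nat n) 0) as [E | E].
  - rewrite E in Hw. replace (0 / INR n)%R with (IZR 0) in Hw by (field; auto).
    rewrite ee_Z in Hw. rewrite Hw.
    rewrite (Csum_ext _ (fun _ => 1)) by (intros; apply Cpow_1_l). rewrite Csum_const. ring.
  - assert (Hr : (0 < k mod Z.of_nat n < Z.of_nat n)%Z).
    { pose proof (Z.mod_pos_bound k (Z.of_nat n) ltac:(lia)). lia. }
    assert (N1 : w <> 1).
    { rewrite Hw. apply ee_neq1. destruct Hr as [H1 H2]. apply IZR_lt in H1, H2.
      rewrite <- INR_IZR_INZ in H2. pose proof (lt_0_INR n ltac:(lia)).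
      split; [apply Rdiv_lt_0_compat; lra | apply Rlt_div_l; lra]. }
    pose proof (Csum_geom w n) as G.
    assert (Wn : w ^ n = 1).
    { unfold w. rewrite ee_pow. replace (INR n * (IZR k / INR n))%R with (IZR k) by (field; auto).
      apply ee_Z. }
    rewrite Wn in G. replace (1 - 1) with (RtoC 0) in G by ring.
    assert (N2 : 1 - w <> 0). { intros Z. apply N1. replace w with (1 - (1 - w)) by ring. rewrite Z. ring. }
    replace (Csum (fun j => w ^ j) n) with (/ (1 - w) * ((1 - w) * Csum (fun j => w ^ j) n)) by (field; auto).
    rewrite G. ring.
Qed.

(** Each summand is a finite geometric sum divided by 1 - x^n, because (x zeta^j)^n = x^n; summing
    over j leaves only the exponent 0 by orthogonality. *)
Lemma finite_partial_fraction (x : C) n : (0 < n)%nat -> (Cmod x < 1)%R ->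
  Csum (fun j => / (1 - x * ee (INR j / INR n))) n = RtoC (INR n) / (1 - x ^ n).
Proof.
  intros Hn Hx. assert (Hn0 : INR n <> 0%R) by (apply not_0_INR; lia).
  assert (Hxn : 1 - x ^ n <> 0).
  { apply Cmod_lt_1_nz. rewrite Cmod_pow. pose proof (Cmod_ge_0 x).
    apply pow_lt_1_compat; [lra | auto]. }
  rewrite (Csum_ext _ (fun j => / (1 - x ^ n) * Csum (fun r => x ^ r * ee (IZR (Z.of_nat r) * INR j / INR n)) n)).
  2:{ intros j _. set (y := x * ee (INR j / INR n)).
      assert (Ny : 1 - y <> 0).
      { apply Cmod_lt_1_nz. unfold y. rewrite Cmod_mult, Cmod_ee. lra. }
      assert (Hyn : y ^ n = x ^ n).
      { unfold y. rewrite Cpow_mult_l, ee_pow.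
        replace (INR n * (INR j / INR n))%R with (INR j) by (field; auto).
        rewrite ee_INR. ring. }
      rewrite (Csum_ext (fun r => x ^ r * _) (fun r => y ^ r)).
      - pose proof (Csum_geom y n) as G. rewrite Hyn in G.
        rewrite <- G. field. split; auto.
        intros E. rewrite <- G, E, Cmult_0_r in Hxn. auto.
      - intros r _. unfold y. rewrite Cpow_mult_l, ee_pow, <- INR_IZR_INZ. f_equal. f_equal. field. auto. }
  rewrite Csum_scal, Csum_swap.
  rewrite (Csum_ext _ (fun r => if Nat.eq_dec r 0 then RtoC (INR n) else 0)).
  2:{ intros r Hr. rewrite Csum_scal, unity_sum by auto.
      rewrite Z.mod_small by lia.
      destruct (Z.eq_dec (Z.of_nat r) 0), (Nat.eq_dec r 0); try lia; subst; simpl; ring. }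
  destruct n; [lia |]. rewrite Csum_head.
  rewrite (Csum_ext (fun k => if Nat.eq_dec (S k) 0 then _ else _) (fun _ => 0)) by reflexivity.
  rewrite Csum_const. destruct (Nat.eq_dec 0 0); [| lia]. field. auto.
Qed.

Lemma Csum_pairs F L :
  Csum F (2 * L + 1) = F 0%nat + Csum (fun j => F (S j) + F (2 * L + 1 - S j)%nat) L.
Proof.
  rewrite Csum_plus. replace (2 * L + 1)%nat with (S (L + L)) by lia.
  rewrite Csum_head, Csum_add. f_equal. f_equal.
  rewrite Csum_rev. apply Csum_ext. intros k Hk. f_equal. lia.
Qed.

Lemma ee_cos_pair x : ee x + ee (- x) = RtoC (2 - 4 * (sin (PI * x)) ^ 2).
Proof.
  unfold ee, cexp.
  replace (Re (2 * PI * Ci * RtoC x)) with 0%R by (simpl; ring).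
  replace (Im (2 * PI * Ci * RtoC x)) with (2 * (PI * x))%R by (simpl; ring).
  replace (Re (2 * PI * Ci * RtoC (- x))) with 0%R by (simpl; ring).
  replace (Im (2 * PI * Ci * RtoC (- x))) with (- (2 * (PI * x)))%R by (simpl; ring).
  rewrite exp_0, cos_neg, sin_neg, cos_2a_sin. apply Ceq; simpl; ring.
Qed.

(** For odd N the roots of unity of index j and N - j are inverse to each other and are paired. The
    denominator then separates into (1 - x)^2 and a multiple of sin^2(pi j / N), and both parts have
    finite limits after scaling by N^2. *)
Lemma finite_cot (x : C) L : (Cmod x < 1)%R ->
  let N := (2 * L + 1)%nat in
  RtoC (INR N) / (1 - x ^ N) = / (1 - x) + RtoC (INR L)
   + Csum (fun j => (1 - x ^ 2) / ((1 - x) ^ 2 + 4 * x * RtoC (sin (PI * (INR (S j) / INR N)) ^ 2))) L.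
Proof.
  intros Hx N. assert (HN : (0 < N)%nat) by (unfold N; lia).
  assert (HN0 : INR N <> 0%R) by (apply not_0_INR; lia).
  rewrite <- (finite_partial_fraction x N HN Hx). unfold N. rewrite Csum_pairs. fold N.
  replace (INR 0 / INR N)%R with (IZR 0) by (simpl; field; auto). rewrite ee_Z.
  rewrite (Csum_ext _ (fun j => 1 + (1 - x ^ 2) / ((1 - x) ^ 2 + 4 * x * RtoC (sin (PI * (INR (S j) / INR N)) ^ 2)))).
  - rewrite Csum_plus, Csum_const. replace (1 - x * 1) with (1 - x) by ring. ring.
  - intros j Hj. set (t := (INR (S j) / INR N)%R).
    replace (ee (INR (N - S j) / INR N)) with (ee (- t)).
    2:{ rewrite minus_INR by (unfold N; lia).
        replace ((INR N - INR (S j)) / INR N)%R with (IZR 1 + - t)%R by (unfold t; field; auto).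
        rewrite ee_plus, ee_Z. ring. }
    pose proof (ee_cos_pair t) as E.
    assert (P : ee t * ee (- t) = 1).
    { rewrite <- ee_plus. replace (t + - t)%R with (IZR 0) by (simpl; ring). apply ee_Z. }
    assert (N1 : 1 - x * ee t <> 0).
    { apply Cmod_lt_1_nz. rewrite Cmod_mult, Cmod_ee. lra. }
    assert (N2 : 1 - x * ee (- t) <> 0).
    { apply Cmod_lt_1_nz. rewrite Cmod_mult, Cmod_ee. lra. }
    assert (D : (1 - x) ^ 2 + 4 * x * RtoC (sin (PI * t) ^ 2) = (1 - x * ee t) * (1 - x * ee (- t))).
    { transitivity (1 - x * (ee t + ee (- t)) + x ^ 2 * (ee t * ee (- t))); [| ring].
      rewrite E, P, RtoC_minus, RtoC_mult. ring. }
    rewrite D.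
    transitivity ((2 - x * (ee t + ee (- t))) / ((1 - x * ee t) * (1 - x * ee (- t)))); [field; auto |].
    assert (D2 : (1 - x * ee t) * (1 - x * ee (- t)) + (1 - x ^ 2) = 2 - x * (ee t + ee (- t))).
    { transitivity (2 - x * (ee t + ee (- t)) - x ^ 2 * (1 - (ee t * ee (- t)))); [ring |]. rewrite P. ring. }
    rewrite <- D2. field. auto.
Qed.

(** The slope 1/3 suffices because pi >= 3: it yields N sin(pi j / N) >= j for 2 j <= N, which is
    the domination needed in the limit. *)
Lemma sin_ge_third t : (0 <= t <= PI / 2)%R -> (t / 3 <= sin t)%R.
Proof.
  intros [H1 H2]. pose proof PI_4. pose proof PI_RGT_0.
  destruct (sin_bound t 0 H1 ltac:(lra)) as [B _].
  eapply Rle_trans; [| exact B]. unfold sin_approx, sin_term; simpl.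
  field_simplify. assert (t <= 2)%R by lra. nra.
Qed.

Lemma Cmod_sub_ge (x y : C) : (Cmod x - Cmod y <= Cmod (x + y))%R.
Proof.
  pose proof (Cmod_triangle (x + y) (- y)). rewrite Cmod_opp in H.
  replace (x + y + - y) with x in H by ring. lra.
Qed.

Lemma ex_series_inv_sq : ex_series (fun n => / (INR (S n)) ^ 2)%R.
Proof.
  apply ex_series_bounded with 2%R.
  - intros k. apply Rlt_le, Rinv_0_lt_compat, pow_lt. pose proof (INR_S_ge1 k). lra.
  - assert (H : forall n, (Rsum (fun k => / INR (S k) ^ 2) (S n) <= 2 - / INR (S n))%R).
    { induction n.
      - simpl. lra.
      - cbn [Rsum] in *. pose proof (INR_S_ge1 n).
        assert (/ INR (S (S n)) ^ 2 <= / INR (S n) - / INR (S (S n)))%R; [| lra].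
        rewrite (S_INR (S n)). set (a := INR (S n)) in *.
        replace (/ a - / (a + 1))%R with (/ (a * (a + 1)))%R by (field; lra).
        apply Rinv_le_contravar; nra. }
    intros n. eapply Rle_trans; [| apply Rlt_le].
    2:{ apply Rle_lt_trans with (2 - / INR (S n))%R; [apply H |].
        pose proof (INR_S_ge1 n). pose proof (Rinv_0_lt_compat (INR (S n)) ltac:(lra)). lra. }
    cbn [Rsum]. pose proof (INR_S_ge1 n).
    pose proof (Rinv_0_lt_compat (INR (S n) ^ 2) ltac:(nra)). lra.
Qed.

(** The first bound is the imaginary part of b + a z, the second that of (b + a z) times the
    conjugate of z. *)
Lemma Cmod_ray (a b : R) (z : C) : (0 < Im z)%R ->
  (Rabs a * Im z <= Cmod (RtoC b + RtoC a * z))%R /\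
  (Rabs b * Im z <= Cmod (RtoC b + RtoC a * z) * Cmod z)%R.
Proof.
  intros Hy. split.
  - eapply Rle_trans; [| apply im_le_Cmod].
    replace (Im (RtoC b + RtoC a * z)) with (a * Im z)%R by (destruct z; simpl; ring).
    rewrite Rabs_mult, (Rabs_pos_eq (Im z)); lra.
  - rewrite <- (Cmod_conj z), <- Cmod_mult.
    eapply Rle_trans; [| apply im_le_Cmod].
    replace (Im ((RtoC b + RtoC a * z) * Cconj z)) with (- (b * Im z))%R by (destruct z; simpl; ring).
    rewrite Rabs_Ropp, Rabs_mult, (Rabs_pos_eq (Im z)); lra.
Qed.

Lemma Cmod_pos_Im (z : C) : (0 < Im z)%R -> (0 < Cmod z)%R.
Proof. intros H. apply Cmod_gt_0. intros E. rewrite E in H. simpl in H. lra. Qed.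

(** Factor into (j + m z)(j - m z) and bound each factor in both ways. One constant serves both
    indices; it governs the convergence of the double series in j and m. *)
Lemma sq_minus_lower (z : C) : (0 < Im z)%R ->
  exists c, (0 < c)%R /\ forall j m : nat,
    (c * INR j ^ 2 <= Cmod (RtoC (INR j) ^ 2 - RtoC (INR m) ^ 2 * z ^ 2))%R /\
    (c * INR m ^ 2 <= Cmod (RtoC (INR j) ^ 2 - RtoC (INR m) ^ 2 * z ^ 2))%R.
Proof.
  intros Hy. pose proof (Cmod_pos_Im z Hy) as Hz. set (y := Im z) in *.
  exists (Rmin (y ^ 2) ((y / Cmod z) ^ 2)). split.
  { apply Rmin_glb_lt; [nra |]. apply pow_lt, Rdiv_lt_0_compat; auto. }
  intros j m.
  destruct (Cmod_ray (INR m) (INR j) z Hy) as [A1 A2].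
  destruct (Cmod_ray (- INR m) (INR j) z Hy) as [B1 B2].
  rewrite Rabs_Ropp in B1. fold y in A1, A2, B1, B2.
  rewrite (Rabs_pos_eq (INR m)) in * by apply pos_INR. rewrite (Rabs_pos_eq (INR j)) in * by apply pos_INR.
  replace (RtoC (INR j) ^ 2 - RtoC (INR m) ^ 2 * z ^ 2)
    with ((RtoC (INR j) + RtoC (INR m) * z) * (RtoC (INR j) + RtoC (- INR m) * z)) by (rewrite RtoC_opp; ring).
  rewrite Cmod_mult. set (P := Cmod (RtoC (INR j) + RtoC (INR m) * z)) in *.
  set (Q := Cmod (RtoC (INR j) + RtoC (- INR m) * z)) in *.
  pose proof (pos_INR j). pose proof (pos_INR m).
  split.
  - apply Rle_trans with ((y / Cmod z) ^ 2 * INR j ^ 2)%R.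
    + apply Rmult_le_compat_r; [nra | apply Rmin_r].
    + replace ((y / Cmod z) ^ 2 * INR j ^ 2)%R with ((INR j * y / Cmod z) * (INR j * y / Cmod z))%R
        by (field; lra).
      apply Rle_div_l in A2, B2; auto.
      assert (0 <= INR j * y / Cmod z)%R by (apply Rle_mult_inv_pos; auto; nra).
      apply Rmult_le_compat; auto.
  - apply Rle_trans with (y ^ 2 * INR m ^ 2)%R.
    + apply Rmult_le_compat_r; [nra | apply Rmin_l].
    + replace (y ^ 2 * INR m ^ 2)%R with ((INR m * y) * (INR m * y))%R by ring.
      apply Rmult_le_compat; auto; nra.
Qed.

Lemma ex_cot_series (z : C) (m : nat) : (0 < Im z)%R -> (0 < m)%nat ->
  exists l, Cser (fun j => z / (RtoC (INR (S j)) ^ 2 - RtoC (INR m) ^ 2 * z ^ 2)) l.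
Proof.
  intros Hy Hm. apply Cser_ex. destruct (sq_minus_lower z Hy) as [c [Hc H]].
  apply ex_series_Rle with (fun j => (Cmod z / c) * / (INR (S j)) ^ 2)%R.
  - intros j. split; [apply Cmod_ge_0 |]. destruct (H (S j) m) as [H1 H2].
    pose proof (INR_S_ge1 j) as Hj.
    assert (0 < c * INR (S j) ^ 2)%R by (apply Rmult_lt_0_compat; nra).
    rewrite Cmod_div by (apply Cmod_gt_0; lra).
    replace (Cmod z / c * / INR (S j) ^ 2)%R with (Cmod z / (c * INR (S j) ^ 2))%R by (field; nra).
    apply Rmult_le_compat_l; [apply Cmod_ge_0 |]. apply Rinv_le_contravar; auto.
  - apply ex_series_Rscal, ex_series_inv_sq.
Qed.

Lemma ex_cot_series1 (z : C) : (0 < Im z)%R ->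
  exists l, Cser (fun j => z / (RtoC (INR (S j)) ^ 2 - z ^ 2)) l.
Proof.
  intros Hy. destruct (ex_cot_series z 1 Hy ltac:(lia)) as [l Hl]. exists l.
  eapply Cser_ext; [| exact Hl]. intros j. cbv beta. f_equal. f_equal. change (INR 1) with 1%R. ring.
Qed.

Lemma Clim_INR_inv : is_lim_seq (fun L => / INR (2 * L + 1))%R 0%R.
Proof.
  assert (A : is_lim_seq (fun n => INR (2 * n + 1)) p_infty).
  { apply is_lim_seq_le_p_loc with INR; [| apply is_lim_seq_INR].
    exists 0%nat. intros n _. apply le_INR. lia. }
  apply (is_lim_seq_inv _ _ A). discriminate.
Qed.

(** Euler's passage to the limit: with x = exp(2 pi i z / N) one has x^N = q, so the finite formula
    divided by N has a fixed left side, and Tannery's theorem evaluates the right side as N = 2 L +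
    1 grows. *)
Lemma partial_fraction (z l : C) : (0 < Im z)%R ->
  Cser (fun j => z / (RtoC (INR (S j)) ^ 2 - z ^ 2)) l ->
  / (1 - q z) = / 2 + Ci / (2 * PI * z) - Ci / PI * l.
Proof.
  intros Hy Hl. pose proof PI_RGT_0 as Hpi.
  assert (Nz : z <> 0) by (apply Cmod_gt_0, Cmod_pos_Im; auto).
  assert (Npi : RtoC PI <> 0) by (apply RtoC_neq0; lra).
  set (N := fun L => (2 * L + 1)%nat).
  assert (HN : forall L, (1 <= INR (N L))%R) by (intros L; apply (le_INR 1); unfold N; lia).
  set (w := 2 * PI * Ci * z).
  set (x := fun L => cexp (w * RtoC (/ INR (N L)))).
  assert (Rew : Re w = (- (2 * PI * Im z))%R) by (unfold w; destruct z; simpl; ring).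
  assert (Hmx : forall L, Cmod (x L) = exp (- (2 * PI * Im z) / INR (N L))).
  { intros L. unfold x. rewrite Cmod_cexp, re_scal_r, Rew. reflexivity. }
  assert (Hx : forall L, (Cmod (x L) < 1)%R).
  { intros L. rewrite Hmx, <- exp_0. apply exp_increasing. specialize (HN L).
    apply Rlt_div_l; [lra |]. rewrite Rmult_0_l. nra. }
  assert (Hx0 : forall L, (exp (- (2 * PI * Im z)) <= Cmod (x L))%R).
  { intros L. rewrite Hmx. apply exp_le_compat. specialize (HN L).
    apply Rle_div_r; [lra |]. assert (0 < 2 * PI * Im z)%R by nra. nra. }
  assert (HxN : forall L, x L ^ N L = q z).
  { intros L. unfold x. rewrite cexp_pow, q_cexp. f_equal. fold w.
    rewrite RtoC_inv by (specialize (HN L); lra). field.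
    apply RtoC_neq0. specialize (HN L); lra. }
  assert (L0 : is_lim_seq (fun L => / INR (N L))%R 0%R) by apply Clim_INR_inv.
  assert (hn0 : forall L, (/ INR (N L))%R <> 0%R).
  { intros L. apply Rinv_neq_0_compat. specialize (HN L). lra. }
  assert (NN : forall L, RtoC (INR (N L)) <> 0) by (intros L; apply RtoC_neq0; specialize (HN L); lra).
  assert (A1 : Clim (fun L => RtoC (INR (N L)) * (1 - x L)) (- w)).
  { apply Clim_ext with (fun L => - (1) * ((cexp (w * RtoC (/ INR (N L))) - 1) / RtoC (/ INR (N L)))).
    - intros L. fold (x L). rewrite RtoC_inv by (specialize (HN L); lra). field. auto.
    - replace (- w) with (- (1) * w) by ring. apply Clim_scal, cexp_derive_0; auto. }
  assert (A2 : Clim x 1).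
  { rewrite <- cexp_0. apply Clim_cexp.
    replace (RtoC 0) with (w * RtoC 0) by ring. apply Clim_scal. apply (Clim_RtoC _ _ L0). }
  assert (A3 : Clim (fun L => RtoC (INR (N L)) * (1 - x L ^ 2)) (- (2 * w))).
  { replace (- (2 * w)) with ((- w) * (1 + 1)) by ring.
    apply Clim_ext with (fun L => RtoC (INR (N L)) * (1 - x L) * (1 + x L)); [intros; ring |].
    apply Clim_mult; auto. apply Clim_plus; auto. apply Clim_const. }
  assert (A4 : forall j, Clim (fun L => RtoC (INR (N L) * sin (PI * (INR (S j) / INR (N L))))) (RtoC (PI * INR (S j)))).
  { intros j. apply Clim_RtoC.
    pose proof (cexp_derive_0 (Ci * RtoC (PI * INR (S j))) _ hn0 L0) as D.
    apply Clim_Re_Im in D. destruct D as [_ D].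
    eapply is_lim_seq_ext_loc; [| replace (PI * INR (S j))%R with (Im (Ci * RtoC (PI * INR (S j)))) by (simpl; ring); exact D].
    exists 0%nat. intros L _. cbv beta. unfold Cdiv.
    rewrite <- RtoC_inv by auto. rewrite im_scal_r. rewrite Rinv_inv, Rmult_comm. f_equal.
    rewrite <- Cmult_assoc, <- RtoC_mult.
    assert (E : forall u : R, Im (cexp (Ci * RtoC u) - 1) = sin u).
    { intros u. unfold cexp. replace (Re (Ci * RtoC u)) with 0%R by (simpl; ring).
      replace (Im (Ci * RtoC u)) with u by (simpl; ring). rewrite exp_0. simpl. ring. }
    rewrite E. f_equal. unfold Rdiv. ring. }
  (* The j-th term of the finite formula divided by N, written with numerator and denominator scaled
     by N^2 so that both converge. *)
  set (f := fun L j => (RtoC (INR (N L)) * (1 - x L ^ 2)) /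
     ((RtoC (INR (N L)) * (1 - x L)) ^ 2 + 4 * x L * RtoC (INR (N L) * sin (PI * (INR (S j) / INR (N L)))) ^ 2)).
  assert (Nden : forall j, w ^ 2 + 4 * (RtoC PI ^ 2 * RtoC (INR (S j)) ^ 2) <> 0).
  { intros j. destruct (sq_minus_lower z Hy) as [c [Hc H]]. destruct (H (S j) 1%nat) as [H1 _].
    assert (E : w ^ 2 + 4 * (RtoC PI ^ 2 * RtoC (INR (S j)) ^ 2)
       = (4 * RtoC PI ^ 2) * (RtoC (INR (S j)) ^ 2 - RtoC (INR 1) ^ 2 * z ^ 2)).
    { unfold w. assert (I2 : Ci * Ci = - (1)) by (apply Ceq; simpl; ring).
      replace ((2 * PI * Ci * z) ^ 2) with (4 * PI ^ 2 * (Ci * Ci) * z ^ 2) by ring. rewrite I2.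
      change (INR 1) with 1%R. ring. }
    rewrite E. apply Cmult_neq_0.
    - apply Cmult_neq_0; [apply RtoC_neq0; lra | apply Cpow_nz; auto].
    - apply Cmod_gt_0. pose proof (INR_S_ge1 j). assert (0 < c * INR (S j) ^ 2)%R by (apply Rmult_lt_0_compat; nra). lra. }
  assert (Hlim : forall j, Clim (fun L => f L j) (- (2 * w) / (w ^ 2 + 4 * (RtoC PI ^ 2 * RtoC (INR (S j)) ^ 2)))).
  { intros j. unfold f. apply Clim_mult; auto. apply Clim_inv; auto.
    apply Clim_plus.
    - replace (w ^ 2) with ((- w) * (- w)) by ring.
      apply Clim_ext with (fun L => RtoC (INR (N L)) * (1 - x L) * (RtoC (INR (N L)) * (1 - x L))); [intros; ring |].
      apply Clim_mult; auto.
    - replace (4 * (RtoC PI ^ 2 * RtoC (INR (S j)) ^ 2)) with (4 * 1 * (RtoC (PI * INR (S j)) * RtoC (PI * INR (S j)))) by (rewrite RtoC_mult; ring).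
      apply Clim_mult; [apply Clim_scal; auto |].
      eapply Clim_ext; [| apply Clim_mult; apply (A4 j)]. intros; cbv beta; ring. }
  destruct (Clim_bounded _ _ A1) as [B1 [HB1 B1b]]. destruct (Clim_bounded _ _ A3) as [B3 [HB3 B3b]].
  set (r0 := exp (- (2 * PI * Im z))) in *. assert (Hr0 : (0 < r0)%R) by apply exp_pos.
  (* From [K0] on, 2 r0 (j + 1)^2 exceeds the bound of |N (1 - x)|^2, so the sine part, which is at
     least 4 r0 (j + 1)^2, keeps the denominator above half of that. *)
  destruct (INR_unbounded (B1 ^ 2 / (2 * r0))) as [K0 HK0].
  assert (Hdom : forall L j, (0 <= L)%nat -> (K0 <= j)%nat -> (j < L)%nat ->
     (Cmod (f L j) <= B3 / (2 * r0) * / INR (S j) ^ 2)%R).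
  { intros L j _ Hj HjL. unfold f.
    set (s := (INR (N L) * sin (PI * (INR (S j) / INR (N L))))%R).
    assert (Hs : (INR (S j) <= s)%R).
    { unfold s. specialize (HN L).
      assert (Hjn : (0 <= INR (S j) / INR (N L) <= / 2)%R).
      { split; [apply Rle_mult_inv_pos; [apply pos_INR | lra] |].
        apply Rle_div_l; [lra |].
        assert (2 * INR (S j) <= INR (N L))%R; [| lra].
        replace 2%R with (INR 2) by reflexivity. rewrite <- mult_INR. apply le_INR. unfold N; lia. }
      assert (Hsin := sin_ge_third (PI * (INR (S j) / INR (N L))) ltac:(split; nra)).
      pose proof PI2_3_2.
      apply Rle_trans with (INR (N L) * (PI * (INR (S j) / INR (N L)) / 3))%R.
      - replace (INR (N L) * (PI * (INR (S j) / INR (N L)) / 3))%R with (PI / 3 * INR (S j))%R by (field; lra).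
        pose proof (INR_S_ge1 j). nra.
      - apply Rmult_le_compat_l; lra. }
    pose proof (INR_S_ge1 j) as Hj1.
    set (P := RtoC (INR (N L)) * (1 - x L)).
    assert (Hden : (2 * r0 * INR (S j) ^ 2 <= Cmod (P ^ 2 + 4 * x L * RtoC s ^ 2))%R).
    { rewrite Cplus_comm. eapply Rle_trans; [| apply Cmod_sub_ge].
      rewrite !Cmod_mult, !Cmod_pow, !Cmod_R, !Rabs_pos_eq by lra.
      specialize (Hx0 L). specialize (B1b L). fold P in B1b. pose proof (Cmod_ge_0 P).
      assert (Cmod P ^ 2 <= B1 ^ 2)%R by (apply pow_incr; lra).
      assert (B1 ^ 2 <= 2 * r0 * INR (S j) ^ 2)%R.
      { assert (INR K0 <= INR (S j))%R by (apply le_INR; lia).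
        unfold Rgt in HK0. apply Rlt_div_l in HK0; [| lra].
        assert (INR K0 * (2 * r0) <= INR (S j) ^ 2 * (2 * r0))%R by (apply Rmult_le_compat_r; nra). lra. }
      assert (INR (S j) ^ 2 <= s ^ 2)%R by (apply pow_incr; lra).
      assert (r0 * INR (S j) ^ 2 <= Cmod (x L) * s ^ 2)%R by (apply Rmult_le_compat; nra). lra. }
    assert (0 < 2 * r0 * INR (S j) ^ 2)%R by (apply Rmult_lt_0_compat; nra).
    rewrite Cmod_div by (apply Cmod_gt_0; lra).
    replace (B3 / (2 * r0) * / INR (S j) ^ 2)%R with (B3 * / (2 * r0 * INR (S j) ^ 2))%R by (field; split; nra).
    apply Rmult_le_compat; auto.
    - apply Cmod_ge_0.
    - apply Rlt_le, Rinv_0_lt_compat. lra.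
    - apply Rinv_le_contravar; lra. }
  assert (HF : Cser (fun j => - (2 * w) / (w ^ 2 + 4 * (RtoC PI ^ 2 * RtoC (INR (S j)) ^ 2))) (- (Ci / PI) * l)).
  { eapply Cser_ext; [| apply Cser_scal; exact Hl]. intros j. cbv beta. specialize (Nden j). revert Nden.
    assert (I2 : Ci * Ci = - (1)) by (apply Ceq; simpl; ring).
    assert (W2 : w ^ 2 = - (4 * PI ^ 2 * z ^ 2)).
    { unfold w. replace ((2 * PI * Ci * z) ^ 2) with (4 * PI ^ 2 * (Ci * Ci) * z ^ 2) by ring. rewrite I2. ring. }
    rewrite W2. intros Nd.
    replace (- (4 * RtoC PI ^ 2 * z ^ 2) + 4 * (RtoC PI ^ 2 * RtoC (INR (S j)) ^ 2))
      with (4 * RtoC PI ^ 2 * (RtoC (INR (S j)) ^ 2 - z ^ 2)) in * by ring.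
    unfold w. field. repeat split; auto.
    intros E. apply Nd. rewrite E. ring. }
  assert (HT : Clim (fun L => Csum (f L) L) (- (Ci / PI) * l)).
  { apply (Csum_tannery f (fun j => - (2 * w) / (w ^ 2 + 4 * (RtoC PI ^ 2 * RtoC (INR (S j)) ^ 2)))
      (fun j => B3 / (2 * r0) * / INR (S j) ^ 2)%R (fun L => L) _ 0 K0); auto.
    - intros k. pose proof (INR_S_ge1 k). apply Rmult_le_pos.
      + apply Rle_mult_inv_pos; lra.
      + apply Rlt_le, Rinv_0_lt_compat. nra.
    - apply ex_series_Rscal, ex_series_inv_sq. }
  assert (Hq : 1 - q z <> 0) by (apply Cmod_lt_1_nz, Cmod_q_lt; exact Hy).
  assert (I2 : Ci * Ci = - (1)) by (apply Ceq; simpl; ring).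
  apply (Clim_unique (fun _ => / (1 - q z))); [apply Clim_const |].
  apply Clim_ext with (fun L => RtoC (INR L / INR (N L)) + / (RtoC (INR (N L)) * (1 - x L)) + Csum (f L) L).
  - intros L. pose proof (finite_cot (x L) L (Hx L)) as E. cbv zeta in E. fold (N L) in E. rewrite HxN in E.
    specialize (NN L). pose proof (Cmod_lt_1_nz _ (Hx L)) as Nx.
    assert (E2 : / (1 - q z) = / RtoC (INR (N L)) * (RtoC (INR (N L)) / (1 - q z))) by (field; auto).
    rewrite E2, E. rewrite RtoC_div by (specialize (HN L); lra).
    rewrite !Cmult_plus_distr_l, <- Csum_scal.
    rewrite (Csum_ext (f L) (fun k => / RtoC (INR (N L)) * ((1 - x L ^ 2) / ((1 - x L) ^ 2 + 4 * x L * RtoC (sin (PI * (INR (S k) / INR (N L))) ^ 2))))).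
    + field. auto.
    + intros j Hj. unfold f. rewrite RtoC_mult, RtoC_pow.
      set (D := (1 - x L) ^ 2 + 4 * x L * RtoC (sin (PI * (INR (S j) / INR (N L)))) ^ 2).
      assert (ND : D <> 0).
      { intros E0.
        set (t := (INR (S j) / INR (N L))%R) in *.
        assert (P : ee t * ee (- t) = 1).
        { rewrite <- ee_plus. replace (t + - t)%R with (IZR 0) by (simpl; ring). apply ee_Z. }
        assert (D2 : D = (1 - x L * ee t) * (1 - x L * ee (- t))).
        { unfold D. transitivity (1 - x L * (ee t + ee (- t)) + x L ^ 2 * (ee t * ee (- t))); [| ring].
          rewrite ee_cos_pair, P, RtoC_minus, RtoC_mult, RtoC_pow. ring. }
        rewrite D2 in E0. apply (Cmult_neq_0 _ _) in E0; auto;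
          apply Cmod_lt_1_nz; rewrite Cmod_mult, Cmod_ee, Rmult_1_r; apply Hx. }
      replace ((RtoC (INR (N L)) * (1 - x L)) ^ 2 + 4 * x L * (RtoC (INR (N L)) * RtoC (sin (PI * (INR (S j) / INR (N L))))) ^ 2)
        with (RtoC (INR (N L)) ^ 2 * D) by (unfold D; ring).
      field. auto.
  - replace (/ 2 + Ci / (2 * PI * z) - Ci / PI * l) with (RtoC (/ 2) + / (- w) + - (Ci / PI) * l).
    2:{ unfold w. rewrite RtoC_inv by lra.
        assert (E : / - (2 * PI * Ci * z) = Ci / (2 * PI * z)).
        { transitivity ((- (1)) / (Ci * Ci) * Ci / (2 * PI * z) * 1).
          - field. repeat split; auto using Ci_nz.
          - rewrite I2. field. auto. }
        rewrite E. ring. }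
    apply Clim_plus; auto. apply Clim_plus.
    + apply Clim_RtoC. apply is_lim_seq_ext with (fun L => (/ 2 - / 2 * / INR (N L))%R).
      * intros L. specialize (HN L). unfold N in *. rewrite plus_INR, mult_INR in *. simpl in *. field. lra.
      * replace (Finite (/ 2)) with (Finite (/ 2 - / 2 * 0)) by (f_equal; ring).
        apply is_lim_seq_minus'; [apply is_lim_seq_const |]. apply is_lim_seq_mult'; [apply is_lim_seq_const | auto].
    + apply Clim_inv; auto. unfold w. intros E.
      assert (E2 : 2 * PI * Ci * z = 0) by (replace (2 * PI * Ci * z) with (- - (2 * PI * Ci * z)) by ring; rewrite E; ring).
      revert E2. repeat apply Cmult_neq_0; auto using Ci_nz. apply RtoC_neq0; lra.
Qed.

(** * The sums of 1/n^2 and of 1/n *)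

Lemma nonneg_of_derive (f f' : R -> R) :
  f 0%R = 0%R -> (forall t, is_derive f t (f' t)) -> (forall t, (0 <= t)%R -> (0 <= f' t)%R) ->
  forall u, (0 <= u)%R -> (0 <= f u)%R.
Proof.
  intros H0 D P u Hu. destruct (MVT_gen f 0 u f') as [c [Hc E]].
  - intros; apply D.
  - intros t _. apply continuity_pt_filterlim.
    apply (ex_derive_continuous (K := R_AbsRing) (V := R_NormedModule)). eexists; apply D.
  - rewrite Rmin_left in Hc by lra. specialize (P c ltac:(lra)). nra.
Qed.

(** The alternating Taylor bounds follow from one another: each difference vanishes at 0 and has the
    preceding one as its derivative. *)
Lemma exp_neg_bounds u : (0 <= u)%R ->
  (1 - u <= exp (- u) <= 1 - u + u ^ 2 / 2)%R /\
  (1 - u + u ^ 2 / 2 - u ^ 3 / 6 <= exp (- u) <= 1 - u + u ^ 2 / 2 - u ^ 3 / 6 + u ^ 4 / 24)%R.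
Proof.
  assert (E0 : forall t, (0 <= t -> 0 <= 1 - exp (- t))%R).
  { intros t Ht. rewrite <- exp_0 at 1. assert (exp (- t) <= exp 0)%R by (apply exp_le_compat; lra). lra. }
  assert (E1 : forall t, (0 <= t -> 0 <= exp (- t) - (1 - t))%R).
  { apply (nonneg_of_derive _ (fun t => 1 - exp (- t))%R); auto.
    - rewrite Ropp_0, exp_0. ring.
    - intros t. auto_derive; auto. ring. }
  assert (E2 : forall t, (0 <= t -> 0 <= 1 - t + t ^ 2 / 2 - exp (- t))%R).
  { apply (nonneg_of_derive _ (fun t => exp (- t) - (1 - t))%R); auto.
    - rewrite Ropp_0, exp_0. field.
    - intros t. auto_derive; auto. field. }
  assert (E3 : forall t, (0 <= t -> 0 <= exp (- t) - (1 - t + t ^ 2 / 2 - t ^ 3 / 6))%R).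
  { apply (nonneg_of_derive _ (fun t => 1 - t + t ^ 2 / 2 - exp (- t))%R); auto.
    - rewrite Ropp_0, exp_0. field.
    - intros t. auto_derive; auto. field. }
  assert (E4 : forall t, (0 <= t -> 0 <= 1 - t + t ^ 2 / 2 - t ^ 3 / 6 + t ^ 4 / 24 - exp (- t))%R).
  { apply (nonneg_of_derive _ (fun t => exp (- t) - (1 - t + t ^ 2 / 2 - t ^ 3 / 6))%R); auto.
    - rewrite Ropp_0, exp_0. field.
    - intros t. auto_derive; auto. field. }
  intros Hu. specialize (E1 u Hu). specialize (E2 u Hu). specialize (E3 u Hu). specialize (E4 u Hu). lra.
Qed.

(** The limit 1/12 is B_2 / 2, the linear coefficient in the expansion of 1 / (1 - e^-u) at 0. *)
Lemma bernoulli_bounds u : (0 < u <= 1)%R ->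
  ((1 - u) / 12 <= (/ (1 - exp (- u)) - / 2 - / u) / u <= (1 + u) / 12)%R.
Proof.
  intros Hu. destruct (exp_neg_bounds u ltac:(lra)) as [[A B] [D E]]. set (e := exp (- u)) in *.
  assert (Hd : (0 < 1 - e)%R) by nra.
  assert (P2 : (0 < u ^ 2)%R) by nra. assert (P3 : (0 < u ^ 3)%R) by (apply pow_lt; lra).
  assert (P4 : (0 < u ^ 4)%R) by (apply pow_lt; lra).
  replace ((/ (1 - e) - / 2 - / u) / u)%R with (((1 + u / 2) * e - 1 + u / 2) / (u ^ 2 * (1 - e)))%R
    by (field; lra).
  assert (N1 : (u ^ 3 / 12 - u ^ 4 / 12 <= (1 + u / 2) * e - 1 + u / 2)%R).
  { assert ((1 + u / 2) * (1 - u + u ^ 2 / 2 - u ^ 3 / 6) <= (1 + u / 2) * e)%R by (apply Rmult_le_compat_l; lra). nra. }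
  assert (N2 : ((1 + u / 2) * e - 1 + u / 2 <= u ^ 3 / 12)%R).
  { assert ((1 + u / 2) * e <= (1 + u / 2) * (1 - u + u ^ 2 / 2 - u ^ 3 / 6 + u ^ 4 / 24))%R by (apply Rmult_le_compat_l; lra).
    assert (u * u ^ 4 <= 1 * u ^ 4)%R by (apply Rmult_le_compat_r; lra). nra. }
  assert (Dp : (0 < u ^ 2 * (1 - e))%R) by nra.
  split.
  - apply (proj1 (Rle_div_r _ _ _ Dp)). eapply Rle_trans; [| exact N1].
    assert ((1 - u) / 12 * (u ^ 2 * (1 - e)) <= (1 - u) / 12 * (u ^ 2 * u))%R; [| nra].
    apply Rmult_le_compat_l; [lra |]. apply (Rmult_le_compat_l (u ^ 2)); lra.
  - apply (proj2 (Rle_div_l _ _ _ Dp)). eapply Rle_trans; [exact N2 |].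
    assert ((1 + u) / 12 * (u ^ 2 * (u - u ^ 2 / 2)) <= (1 + u) / 12 * (u ^ 2 * (1 - e)))%R.
    { apply Rmult_le_compat_l; [lra |]. apply (Rmult_le_compat_l (u ^ 2)); lra. }
    assert (u * u ^ 4 <= 1 * u ^ 4)%R by (apply Rmult_le_compat_r; lra). nra.
Qed.

(** The cotangent series at z = i y turns A into the sum of 1 / (n^2 + y^2), which is compared with
    the sum of 1 / n^2 term by term. *)
Lemma basel_approx (y : R) : (0 < y <= 1)%R ->
  let Z := Series (fun n => / INR (S n) ^ 2)%R in
  let A := (PI / y * (/ (1 - exp (- (2 * PI * y))) - / 2 - / (2 * PI * y)))%R in
  (Z * (1 - y ^ 2) <= A <= Z)%R.
Proof.
  intros [Hy Hy1] Z A. pose proof PI_RGT_0 as Hpi.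
  set (z := (0, y)%R : C). assert (Hz : (0 < Im z)%R) by exact Hy.
  destruct (ex_cot_series1 z Hz) as [l Hl].
  pose proof (partial_fraction z l Hz Hl) as PF.
  assert (Ez : forall j, z / (RtoC (INR (S j)) ^ 2 - z ^ 2) = (0, y * / (INR (S j) ^ 2 + y ^ 2))%R).
  { intros j. pose proof (INR_S_ge1 j) as Hj.
    assert (Hp : (INR (S j) ^ 2 + y ^ 2 <> 0)%R) by nra.
    replace (RtoC (INR (S j)) ^ 2 - z ^ 2) with (RtoC (INR (S j) ^ 2 + y ^ 2)) by (apply Ceq; simpl; ring).
    unfold Cdiv. rewrite <- RtoC_inv by auto. apply Ceq; simpl; ring. }
  apply Cser_Re_Im in Hl. destruct Hl as [L1 L2].
  assert (S1 : is_series (fun j => y * / (INR (S j) ^ 2 + y ^ 2))%R (Im l)).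
  { eapply is_series_ext; [| exact L2]. intros j. cbv beta. rewrite Ez. reflexivity. }
  assert (R0 : Re l = 0%R).
  { rewrite <- (is_series_unique _ _ L1). rewrite (Series_ext _ (fun _ => 0 * 0)%R).
    - rewrite Series_scal_l. ring.
    - intros j. rewrite Ez. simpl. ring. }
  assert (EA : A = (Im l / y)%R).
  { assert (Hq : q z = RtoC (exp (- (2 * PI * y)))).
    { unfold q. simpl. rewrite Rmult_0_r, cos_0, sin_0. apply Ceq; simpl; ring. }
    assert (He : (exp (- (2 * PI * y)) < 1)%R).
    { rewrite <- exp_0. apply exp_increasing. nra. }
    rewrite Hq in PF. apply (f_equal Re) in PF.
    rewrite <- RtoC_minus, <- RtoC_inv in PF by lra.
    replace (Re (/ 2 + Ci / (2 * PI * z) - Ci / PI * l)) with (/ 2 + / (2 * PI * y) + Im l / PI)%R in PF.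
    - simpl in PF. unfold A. rewrite PF. field. lra.
    - replace (Ci / (2 * PI * z)) with (RtoC (/ (2 * PI * y))).
      + replace (Ci / PI * l) with (RtoC (/ PI) * (Ci * l)).
        * rewrite <- RtoC_inv by lra. change (Re (RtoC (/ 2) + RtoC (/ (2 * PI * y)) - RtoC (/ PI) * (Ci * l)))
            with (/ 2 + / (2 * PI * y) + - Re (RtoC (/ PI) * (Ci * l)))%R.
          rewrite re_scal_l. replace (Re (Ci * l)) with (- Im l)%R by (destruct l; simpl; ring). unfold Rdiv. ring.
        * rewrite RtoC_inv by lra. unfold Cdiv. ring.
      + replace z with (Ci * RtoC y) by (apply Ceq; simpl; ring).
        rewrite RtoC_inv, !RtoC_mult by nra. field.
        repeat split; try apply RtoC_neq0; try lra. apply Ci_nz. }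
  assert (S2 : is_series (fun j => / (INR (S j) ^ 2 + y ^ 2))%R A).
  { rewrite EA. eapply is_series_ext; [| apply (is_series_scal_r (/ y) _ _ S1)].
    intros j. pose proof (INR_S_ge1 j). cbv beta. unfold mult; simpl. field. nra. }
  rewrite <- (is_series_unique _ _ S2). unfold Z.
  split.
  - rewrite <- Series_scal_r. apply Series_le; [| eexists; exact S2].
    intros j. pose proof (INR_S_ge1 j) as Hj. set (a := INR (S j)) in *.
    assert (0 < a ^ 2)%R by nra. assert (0 < a ^ 2 + y ^ 2)%R by nra.
    split.
    + apply Rmult_le_pos; [apply Rlt_le, Rinv_0_lt_compat; auto | nra].
    + replace (/ a ^ 2 * (1 - y ^ 2))%R with ((1 - y ^ 2) * (a ^ 2 + y ^ 2) * / (a ^ 2 * (a ^ 2 + y ^ 2)))%R by (field; lra).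
      replace (/ (a ^ 2 + y ^ 2))%R with (a ^ 2 * / (a ^ 2 * (a ^ 2 + y ^ 2)))%R by (field; lra).
      apply Rmult_le_compat_r; [apply Rlt_le, Rinv_0_lt_compat; nra |].
      assert (y ^ 2 * 1 <= y ^ 2 * a ^ 2)%R by (apply Rmult_le_compat_l; nra).
      assert (0 <= y ^ 2 * y ^ 2)%R by nra. nra.
  - apply Series_le; [| apply ex_series_inv_sq].
    intros j. pose proof (INR_S_ge1 j) as Hj. set (a := INR (S j)) in *. split.
    + apply Rlt_le, Rinv_0_lt_compat. nra.
    + apply Rinv_le_contravar; nra.
Qed.

(** As y tends to 0 the closed form tends to 2 pi^2 / 12. The exact value matters: it has to match
    the exponent pi i tau / 12 of eta. *)
Lemma basel : is_series (fun n => / INR (S n) ^ 2)%R (PI ^ 2 / 6)%R.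
Proof.
  pose proof PI_RGT_0 as Hpi. pose proof PI_4 as Hpi4.
  set (Z := Series (fun n => / INR (S n) ^ 2)%R).
  replace (PI ^ 2 / 6)%R with Z; [apply Series_correct, ex_series_inv_sq |].
  assert (HZ : (0 <= Z)%R).
  { apply (Rsum_le_Series (fun n => / INR (S n) ^ 2)%R 0); [| apply ex_series_inv_sq].
    intros k. pose proof (INR_S_ge1 k). apply Rlt_le, Rinv_0_lt_compat. nra. }
  assert (Hb : forall y, (0 < y -> 2 * PI * y <= 1 -> Rabs (Z - PI ^ 2 / 6) <= (Z + 2 * PI ^ 3) * y)%R).
  { intros y Hy Hy1. assert (Hy2 : (y <= 1)%R) by (pose proof PI2_3_2; nra).
    destruct (basel_approx y ltac:(lra)) as [B1 B2]. fold Z in B1, B2.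
    destruct (bernoulli_bounds (2 * PI * y) ltac:(split; nra)) as [C1 C2].
    set (G := ((/ (1 - exp (- (2 * PI * y))) - / 2 - / (2 * PI * y)) / (2 * PI * y))%R) in *.
    replace (PI / y * (/ (1 - exp (- (2 * PI * y))) - / 2 - / (2 * PI * y)))%R with (2 * PI ^ 2 * G)%R in B1, B2
      by (unfold G; field; split; [nra | split; [lra | ]]; assert (exp (- (2 * PI * y)) < exp 0)%R by (apply exp_increasing; nra); rewrite exp_0 in *; lra).
    assert (P2 : (0 < 2 * PI ^ 2)%R) by nra.
    assert (D1 : (2 * PI ^ 2 * ((1 - 2 * PI * y) / 12) <= 2 * PI ^ 2 * G)%R) by (apply Rmult_le_compat_l; lra).
    assert (D2 : (2 * PI ^ 2 * G <= 2 * PI ^ 2 * ((1 + 2 * PI * y) / 12))%R) by (apply Rmult_le_compat_l; lra).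
    assert (0 < PI ^ 3 * y)%R by (apply Rmult_lt_0_compat; [apply pow_lt |]; lra).
    assert (Z * y ^ 2 <= Z * y)%R by (apply Rmult_le_compat_l; nra).
    assert (0 <= Z * y)%R by nra.
    apply Rabs_le. split; nra. }
  apply Rminus_diag_uniq. apply cond_eq. intros eps He. rewrite Rminus_0_r.
  set (K := (Z + 2 * PI ^ 3)%R). assert (HK : (0 < K)%R).
  { unfold K. assert (0 < PI ^ 3)%R by (apply pow_lt; lra). lra. }
  set (y := Rmin (eps / (2 * K)) (/ (2 * PI))).
  assert (Hy : (0 < y)%R).
  { apply Rmin_glb_lt; [apply Rdiv_lt_0_compat | apply Rinv_0_lt_compat]; lra. }
  eapply Rle_lt_trans; [apply (Hb y Hy) |].
  - apply Rle_trans with (2 * PI * / (2 * PI))%R; [apply Rmult_le_compat_l; [lra | apply Rmin_r] |].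
    right. field. lra.
  - fold K. apply Rle_lt_trans with (K * (eps / (2 * K)))%R; [apply Rmult_le_compat_l; [lra | apply Rmin_l] |].
    replace (K * (eps / (2 * K)))%R with (eps / 2)%R by (field; lra). lra.
Qed.

Definition harm (M : nat) : R := Rsum (fun k => / INR (S k))%R M.

Lemma harm_diff_lower M d : (ln (INR (M + d + 1)) - ln (INR (M + 1)) <= harm (M + d) - harm M)%R.
Proof.
  unfold harm. induction d.
  - rewrite Nat.add_0_r. lra.
  - replace (M + S d)%nat with (S (M + d)) by lia. cbn [Rsum].
    assert (H : (ln (INR (S (M + d) + 1)) - ln (INR (M + d + 1)) <= / INR (S (M + d)))%R); [| lra].
    pose proof (INR_S_ge1 (M + d)) as H1. replace (M + d + 1)%nat with (S (M + d)) by lia.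
    rewrite <- ln_div by (apply lt_0_INR; lia).
    rewrite <- (ln_exp (/ INR (S (M + d)))). apply ln_le.
    + apply Rdiv_lt_0_compat; [rewrite plus_INR; simpl (INR 1) |]; lra.
    + replace (INR (S (M + d) + 1) / INR (S (M + d)))%R with (1 + / INR (S (M + d)))%R
        by (rewrite plus_INR; simpl (INR 1); field; lra).
      apply exp_ineq1_le.
Qed.

Lemma harm_diff_upper M d : (1 <= M)%nat -> (harm (M + d) - harm M <= ln (INR (M + d)) - ln (INR M))%R.
Proof.
  intros HM. unfold harm. induction d.
  - rewrite Nat.add_0_r. lra.
  - replace (M + S d)%nat with (S (M + d)) by lia. cbn [Rsum].
    assert (H : (/ INR (S (M + d)) <= ln (INR (S (M + d))) - ln (INR (M + d)))%R); [| lra].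
    assert (H1 : (1 <= INR (M + d))%R) by (apply (le_INR 1); lia).
    rewrite S_INR.
    assert (E : (ln (INR (M + d)) - ln (INR (M + d) + 1) <= - / (INR (M + d) + 1))%R); [| lra].
    rewrite <- ln_div by lra. rewrite <- (ln_exp (- / (INR (M + d) + 1))). apply ln_le.
    + apply Rdiv_lt_0_compat; lra.
    + replace (INR (M + d) / (INR (M + d) + 1))%R with (1 + - / (INR (M + d) + 1))%R by (field; lra).
      apply exp_ineq1_le.
Qed.

(** Both estimates come from 1 + x <= e^x. This limit is the source of the factor sqrt N in the law
    of eta. *)
Lemma harm_ln N : (1 <= N)%nat -> is_lim_seq (fun M => harm (N * M) - harm M)%R (ln (INR N)).
Proof.
  intros HN. assert (HN1 : (1 <= INR N)%R) by (apply (le_INR 1); lia).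
  apply is_lim_seq_incr_1.
  apply is_lim_seq_le_le with (fun M => ln (INR N) - / INR (S M))%R (fun _ => ln (INR N)).
  - intros M. set (K := S M). assert (HK : (1 <= INR K)%R) by apply INR_S_ge1.
    replace (N * K)%nat with (K + (N - 1) * K)%nat by nia. split.
    + eapply Rle_trans; [| apply harm_diff_lower].
      replace (K + (N - 1) * K)%nat with (N * K)%nat by nia.
      assert (A : (ln (INR N) + ln (INR K) <= ln (INR (N * K + 1)))%R).
      { rewrite <- ln_mult by lra. rewrite <- mult_INR. apply ln_le; [| apply le_INR; lia].
        apply lt_0_INR. unfold K in *. nia. }
      assert (B : (ln (INR (K + 1)) - ln (INR K) <= / INR K)%R).
      { rewrite <- ln_div by (apply lt_0_INR; lia).
        rewrite <- (ln_exp (/ INR K)). rewrite plus_INR. apply ln_le.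
        - apply Rdiv_lt_0_compat; simpl (INR 1); lra.
        - replace ((INR K + INR 1) / INR K)%R with (1 + / INR K)%R by (simpl (INR 1); field; lra).
          apply exp_ineq1_le. }
      lra.
    + eapply Rle_trans; [apply harm_diff_upper; unfold K; lia |].
      replace (K + (N - 1) * K)%nat with (N * K)%nat by nia.
      rewrite mult_INR, ln_mult by lra. lra.
  - replace (Finite (ln (INR N))) with (Finite (ln (INR N) - 0)) by (f_equal; ring).
    apply is_lim_seq_minus'; [apply is_lim_seq_const |].
    apply (is_lim_seq_incr_1 (fun n => / INR n)%R). apply (is_lim_seq_inv _ p_infty); [apply is_lim_seq_INR | discriminate].
  - apply is_lim_seq_const.
Qed.

(** * The eta function *)

(** Total thanks to the default values of [Series]; it is the sum of the series wherever one
    exists. *)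
Definition Csum_inf (a : nat -> C) : C := (Series (fun n => Re (a n)), Series (fun n => Im (a n))).

Lemma Csum_inf_correct a : (exists l, Cser a l) -> Cser a (Csum_inf a).
Proof.
  intros [l Hl]. assert (l = Csum_inf a) as <-; auto.
  apply Cser_Re_Im in Hl. destruct Hl as [A B].
  apply Ceq; symmetry; apply is_series_unique; auto.
Qed.

Fixpoint Cprod (f : nat -> C) (n : nat) : C :=
  match n with O => 1 | S k => Cprod f k * f k end.

(** A total function, known to be the limit of the Euler product on the open unit disc only. *)
Definition euler (x : C) : C :=
  (real (Lim_seq (fun M => Re (Cprod (fun n => 1 - x ^ S n) M))),
   real (Lim_seq (fun M => Im (Cprod (fun n => 1 - x ^ S n) M)))).

Lemma pow_lt_1_S (r : R) n : (0 <= r < 1)%R -> (0 <= r ^ S n <= r)%R.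
Proof.
  intros [H0 H1]. split; [apply pow_le; auto |]. induction n; [simpl; lra |].
  rewrite <- tech_pow_Rmult. pose proof (pow_le r (S n) H0). nra.
Qed.

Lemma pow_anti (r : R) m n : (0 <= r <= 1)%R -> (m <= n)%nat -> (r ^ n <= r ^ m)%R.
Proof.
  intros Hr Hmn. replace n with (m + (n - m))%nat by lia. rewrite pow_add.
  assert (0 <= r ^ m)%R by (apply pow_le; lra).
  assert (r ^ (n - m) <= 1)%R.
  { rewrite <- (pow1 (n - m)). apply pow_incr. lra. }
  nra.
Qed.

(** The logarithm of the product is minus the double sum of x^(n m) / m. Summed over n first it
    becomes a Lambert series, to whose terms the cotangent expansion applies; the exponential form
    also shows that the product does not vanish. *)
Lemma euler_exp (x : C) : (Cmod x < 1)%R ->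
  exists s, Cser (fun m => x ^ S m / (1 - x ^ S m) / RtoC (INR (S m))) s /\
    Clim (Cprod (fun n => 1 - x ^ S n)) (cexp (- s)).
Proof.
  intros Hx. pose proof (Cmod_ge_0 x) as Hx0. set (r := Cmod x) in *.
  assert (Hxn : forall n, (Cmod (x ^ S n) < 1)%R).
  { intros n. rewrite Cmod_pow. fold r. pose proof (pow_lt_1_S r n ltac:(lra)). lra. }
  set (a := fun n m => (x ^ S n) ^ S m / RtoC (INR (S m))).
  set (L := fun n => Csum_inf (a n)).
  assert (HL : forall n, Cser (a n) (L n)).
  { intros n. apply Csum_inf_correct, Cser_ex, ex_series_log, Hxn. }
  assert (HK : forall m, Cser (fun n => a n m) (x ^ S m / (1 - x ^ S m) / RtoC (INR (S m)))).
  { intros m. pose proof (Cser_scal (x ^ S m / RtoC (INR (S m))) _ _ (Cser_geom _ (Hxn m))) as G.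
    replace (x ^ S m / (1 - x ^ S m) / RtoC (INR (S m))) with (x ^ S m / RtoC (INR (S m)) * / (1 - x ^ S m)).
    - eapply Cser_ext; [| exact G]. intros n. cbv beta. unfold a.
      rewrite <- !Cpow_mult_r. replace (S n * S m)%nat with (S m + S m * n)%nat by lia.
      rewrite Cpow_add_r. unfold Cdiv. ring.
    - field. split; [apply Cmod_lt_1_nz, Hxn | apply INR_S_neq0]. }
  destruct (Cser_fubini a (fun n => r ^ n)%R (fun m => r ^ m)%R L
    (fun m => x ^ S m / (1 - x ^ S m) / RtoC (INR (S m)))) as [s [HR HC]]; auto.
  - intros; apply pow_le; auto.
  - intros; apply pow_le; auto.
  - apply ex_series_geom_Cmod; lra.
  - apply ex_series_geom_Cmod; lra.
  - intros n m. unfold a. rewrite Cmod_div by apply INR_S_neq0.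
    rewrite !Cmod_pow, Cmod_R. fold r. pose proof (INR_S_ge1 m).
    rewrite Rabs_pos_eq by lra. rewrite <- pow_mult, <- pow_add.
    apply Rle_div_l; [lra |]. apply Rle_trans with (r ^ (n + m) * 1)%R.
    + rewrite Rmult_1_r. apply pow_anti; [lra | nia].
    + apply Rmult_le_compat_l; [apply pow_le; auto | lra].
  - exists s. split; auto. apply Cser_Clim in HR.
    apply Clim_ext with (fun M => cexp (- Csum L M)).
    + intros M. induction M; cbn [Csum Cprod].
      * replace (- 0) with (RtoC 0) by ring. apply cexp_0.
      * rewrite <- IHM. replace (- (Csum L M + L M)) with (- Csum L M + - L M) by ring.
        rewrite cexp_plus, (cexp_log (x ^ S M) (L M) (Hxn M) (HL M)). reflexivity.
    + apply Clim_cexp. eapply Clim_ext; [| replace (- s) with (- (1) * s) by ring; apply Clim_scal; exact HR].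
      intros; cbv beta; ring.
Qed.

Lemma euler_lim (x : C) : (Cmod x < 1)%R -> Clim (Cprod (fun n => 1 - x ^ S n)) (euler x).
Proof.
  intros Hx. destruct (euler_exp x Hx) as [s [_ H]].
  assert (euler x = cexp (- s)) as ->; auto.
  apply Clim_Re_Im in H. destruct H as [A B]. apply is_lim_seq_unique in A, B.
  unfold euler. rewrite A, B. apply Ceq; reflexivity.
Qed.

Lemma euler_log (x : C) : (Cmod x < 1)%R ->
  exists s, Cser (fun m => x ^ S m / (1 - x ^ S m) / RtoC (INR (S m))) s /\ euler x = cexp (- s).
Proof.
  intros Hx. destruct (euler_exp x Hx) as [s [A B]]. exists s. split; auto.
  apply (Clim_unique _ _ _ (euler_lim x Hx) B).
Qed.

(** * The transformation law of eta in quotient form *)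

Definition eta (tau : C) : C := cexp (PI * Ci * tau / 12) * euler (q tau).

(** One m-th of the cotangent series at m tau. The division absorbs the weight 1/m of the Lambert
    series and makes the general term symmetric: passing from tau to -1/tau exchanges j and m. *)
Definition hsum (tau : C) (m : nat) : C :=
  Csum_inf (fun j => tau / (RtoC (INR (S j)) ^ 2 - RtoC (INR m) ^ 2 * tau ^ 2)).

Lemma hsum_correct tau m : (0 < Im tau)%R -> (0 < m)%nat ->
  Cser (fun j => tau / (RtoC (INR (S j)) ^ 2 - RtoC (INR m) ^ 2 * tau ^ 2)) (hsum tau m).
Proof. intros. apply Csum_inf_correct, ex_cot_series; auto. Qed.

Lemma q_pow tau n : q tau ^ n = q (RtoC (INR n) * tau).
Proof. rewrite !q_cexp, cexp_pow. f_equal. ring. Qed.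

(** Three pieces of different nature: a divergent harmonic term, a zeta(2) term, and a row of a
    double series that is not absolutely summable. *)
Lemma lambert_term tau m : (0 < Im tau)%R ->
  q tau ^ S m / (1 - q tau ^ S m) / RtoC (INR (S m))
  = - (1) / (2 * RtoC (INR (S m))) + Ci / (2 * PI * tau) * RtoC (/ INR (S m) ^ 2) - Ci / PI * hsum tau (S m).
Proof.
  intros Hy. pose proof PI_RGT_0. set (M := RtoC (INR (S m))). assert (NM : M <> 0) by apply INR_S_neq0.
  assert (Nt : tau <> 0) by (apply Cmod_gt_0, Cmod_pos_Im; auto).
  assert (Npi : RtoC PI <> 0) by (apply RtoC_neq0; lra).
  pose proof (INR_S_ge1 m) as Hm1.
  assert (Hz : (0 < Im (M * tau))%R) by (unfold M; rewrite im_scal_l; nra).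
  pose proof (Cser_scal M _ _ (hsum_correct tau (S m) Hy ltac:(lia))) as Hs.
  pose proof (partial_fraction (M * tau) (M * hsum tau (S m)) Hz) as PF.
  rewrite q_pow. fold M.
  assert (Hq : 1 - q (M * tau) <> 0) by (apply Cmod_lt_1_nz, Cmod_q_lt; exact Hz).
  replace (q (M * tau) / (1 - q (M * tau))) with (/ (1 - q (M * tau)) - 1) by (field; auto).
  rewrite PF.
  - rewrite RtoC_inv, RtoC_pow by (apply pow_nonzero; lra). fold M. field. repeat split; auto.
  - eapply Cser_ext; [| exact Hs]. intros j. cbv beta. fold M.
    replace ((M * tau) ^ 2) with (M ^ 2 * tau ^ 2) by ring. unfold Cdiv. ring.
Qed.

Lemma Csum_blocks F N M : Csum F (N * M) = Csum (fun b => Csum (fun r => F (N * b + r)%nat) N) M.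
Proof.
  induction M; simpl; [now rewrite Nat.mul_0_r |].
  rewrite Nat.mul_succ_r, Csum_add, IHM. reflexivity.
Qed.

(** The exponent 3/2 shares a joint decay of order 3 evenly between the two indices. *)
Definition inv_rt3 (n : nat) : R := (/ (INR (S n) * sqrt (INR (S n))))%R.

Lemma inv_rt3_pos n : (0 <= inv_rt3 n)%R.
Proof.
  unfold inv_rt3. pose proof (INR_S_ge1 n). pose proof (sqrt_lt_R0 (INR (S n)) ltac:(lra)).
  apply Rlt_le, Rinv_0_lt_compat. nra.
Qed.

Lemma ex_series_inv_rt3 : ex_series inv_rt3.
Proof.
  apply ex_series_bounded with 3%R; [apply inv_rt3_pos |].
  assert (H : forall n, (Rsum inv_rt3 (S n) <= 3 - 2 * / sqrt (INR (S n)))%R).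
  { induction n.
    - simpl. unfold inv_rt3. simpl. rewrite sqrt_1. lra.
    - cbn [Rsum] in *.
      assert (inv_rt3 (S n) <= 2 * / sqrt (INR (S n)) - 2 * / sqrt (INR (S (S n))))%R; [| lra].
      unfold inv_rt3. pose proof (INR_S_ge1 n) as H1. rewrite (S_INR (S n)).
      set (a := INR (S n)) in *.
      assert (Hs : (0 < sqrt a)%R) by (apply sqrt_lt_R0; lra).
      assert (Ht : (0 < sqrt (a + 1))%R) by (apply sqrt_lt_R0; lra).
      assert (Es : (sqrt a * sqrt a = a)%R) by (apply sqrt_sqrt; lra).
      assert (Et : (sqrt (a + 1) * sqrt (a + 1) = a + 1)%R) by (apply sqrt_sqrt; lra).
      assert (Hst : (sqrt a <= sqrt (a + 1))%R) by (apply sqrt_le_1; lra).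
      set (s := sqrt a) in *. set (t := sqrt (a + 1)) in *. rewrite <- Et.
      replace (2 * / s - 2 * / t)%R with (2 * / (s * t * (s + t)))%R.
      + apply Rle_trans with (2 * / (t * t * (t + t)))%R.
        * right. field. lra.
        * apply Rmult_le_compat_l; [lra |]. apply Rinv_le_contravar; [nra |].
          assert (s * t <= t * t)%R by nra. nra.
      + assert (E1 : (2 * / (s * t * (s + t)) = 2 * ((t * t - s * s) * / (s * t * (s + t))))%R).
        { rewrite Et, Es. f_equal. ring. }
        rewrite E1. field. lra. }
  intros n. destruct n; [simpl; lra |]. eapply Rle_trans; [apply H |].
  pose proof (INR_S_ge1 n). pose proof (Rinv_0_lt_compat _ (sqrt_lt_R0 (INR (S n)) ltac:(lra))). lra.
Qed.

(** The two terms belong to indices m <= m' that differ by less than N, so their squares differ by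
    at most 2 N m'. One denominator absorbs m' and leaves a factor b + 1; the other is shared
    between j and b. *)
Lemma block_term_bound (tau : C) (N : nat) : (0 < Im tau)%R -> (1 <= N)%nat ->
  exists K, (0 <= K)%R /\ forall b r j, (r < N)%nat ->
    (Cmod (tau / (RtoC (INR (S j)) ^ 2 - RtoC (INR (S (N * b + r))) ^ 2 * tau ^ 2)
         - tau / (RtoC (INR (S j)) ^ 2 - RtoC (INR (N * S b)) ^ 2 * tau ^ 2)) <= K * inv_rt3 b * inv_rt3 j)%R.
Proof.
  intros Hy HN. destruct (sq_minus_lower tau Hy) as [c [Hc H]].
  pose proof (Cmod_pos_Im tau Hy) as Ht.
  exists (Cmod tau ^ 3 * (2 * INR N) / c ^ 2)%R.
  assert (HNp : (1 <= INR N)%R) by (apply (le_INR 1); lia).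
  assert (Ht3 : (0 < Cmod tau ^ 3)%R) by (apply pow_lt; auto).
  split.
  { apply Rle_mult_inv_pos; [| nra]. apply Rmult_le_pos; lra. }
  intros b r j Hr. set (m := S (N * b + r)). set (m' := (N * S b)%nat).
  assert (Hmm' : (m <= m')%nat) by (unfold m, m'; nia).
  assert (Hbm : (S b <= m)%nat) by (unfold m; nia).
  destruct (H (S j) m) as [H1 H2]. destruct (H (S j) m') as [H3 H4].
  set (D := RtoC (INR (S j)) ^ 2 - RtoC (INR m) ^ 2 * tau ^ 2) in *.
  set (D' := RtoC (INR (S j)) ^ 2 - RtoC (INR m') ^ 2 * tau ^ 2) in *.
  set (x := INR (S j)) in *. set (y := INR m) in *. set (y' := INR m') in *. set (B := INR (S b)) in *.
  assert (Hx : (1 <= x)%R) by apply INR_S_ge1. assert (HB : (1 <= B)%R) by apply INR_S_ge1.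
  assert (HBy : (B <= y)%R) by (apply le_INR; auto). assert (Hyy : (y <= y')%R) by (apply le_INR; auto).
  assert (Hdiff : (y' - y <= INR N)%R).
  { unfold y', y. rewrite <- minus_INR by auto. apply le_INR. unfold m, m'. nia. }
  assert (Hcx : (0 < c * x ^ 2)%R) by (apply Rmult_lt_0_compat; nra).
  assert (ND : D <> 0) by (apply Cmod_gt_0; lra).
  assert (ND' : D' <> 0) by (apply Cmod_gt_0; lra).
  replace (tau / D - tau / D') with (tau ^ 3 * RtoC (y ^ 2 - y' ^ 2) / (D * D')).
  2:{ rewrite RtoC_minus, !RtoC_pow. transitivity (tau * (D' - D) / (D * D')).
      - unfold D, D', y, y'. f_equal. ring.
      - field. auto. }
  rewrite Cmod_div by (apply Cmult_neq_0; auto).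
  rewrite !Cmod_mult, Cmod_pow, Cmod_R.
  rewrite Rabs_left1 by nra.
  set (sx := sqrt x). set (sB := sqrt B).
  assert (Esx : (sx * sx = x)%R) by (apply sqrt_sqrt; lra).
  assert (EsB : (sB * sB = B)%R) by (apply sqrt_sqrt; lra).
  assert (Psx : (0 < sx)%R) by (apply sqrt_lt_R0; lra).
  assert (PsB : (0 < sB)%R) by (apply sqrt_lt_R0; lra).
  (* Up to the factor c both x^2 and B^2 are lower bounds, hence so is x^(3/2) B^(1/2), which never
     exceeds the larger of the two. *)
  assert (HD : (c * (x * sx * sB) <= Cmod D)%R).
  { destruct (Rle_dec B x) as [L | L].
    - assert (sB <= sx)%R by (apply sqrt_le_1; lra).
      eapply Rle_trans; [| exact H1]. apply Rmult_le_compat_l; [lra |].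
      replace (x ^ 2)%R with (x * sx * sx)%R by (rewrite Rmult_assoc, Esx; ring).
      apply Rmult_le_compat_l; nra.
    - assert (sx <= sB)%R by (apply sqrt_le_1; lra).
      eapply Rle_trans; [| exact H2]. apply Rmult_le_compat_l; [lra |].
      assert (sx * sB <= B)%R by nra. nra. }
  assert (HD' : (c * (y' * B) <= Cmod D')%R).
  { eapply Rle_trans; [| exact H4]. apply Rmult_le_compat_l; [lra |]. nra. }
  assert (HP : (0 < c ^ 2 * (x * sx * sB) * (y' * B))%R).
  { repeat apply Rmult_lt_0_compat; nra. }
  assert (HDD : (c ^ 2 * (x * sx * sB) * (y' * B) <= Cmod D * Cmod D')%R).
  { replace (c ^ 2 * (x * sx * sB) * (y' * B))%R with (c * (x * sx * sB) * (c * (y' * B)))%R by ring.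
    apply Rmult_le_compat; auto; repeat apply Rmult_le_pos; lra. }
  apply Rle_trans with (Cmod tau ^ 3 * (2 * INR N * y') * / (c ^ 2 * (x * sx * sB) * (y' * B)))%R.
  - unfold Rdiv. apply Rmult_le_compat.
    + apply Rmult_le_pos; [lra | nra].
    + apply Rlt_le, Rinv_0_lt_compat. lra.
    + apply Rmult_le_compat_l; [lra |]. nra.
    + apply Rinv_le_contravar; auto.
  - right. unfold inv_rt3. fold x B sx sB. field. repeat split; lra.
Qed.

Lemma Clim_harm_C N : (1 <= N)%nat ->
  Clim (fun M => Csum (fun m => - (1) / (2 * RtoC (INR (S m)))) (N * M) - Csum (fun m => - (1) / (2 * RtoC (INR (S m)))) M)
       (RtoC (- (ln (INR N) / 2))).
Proof.
  intros HN.
  apply Clim_ext with (fun M => RtoC (- / 2 * (harm (N * M) - harm M))).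
  - intros M. assert (E : forall k, Csum (fun m => - (1) / (2 * RtoC (INR (S m)))) k = RtoC (- / 2 * harm k)).
    { intros k. unfold harm. rewrite <- Rsum_scal, <- Csum_RtoC. apply Csum_ext. intros m _.
      pose proof (INR_S_ge1 m). rewrite RtoC_mult, RtoC_opp, !RtoC_inv by lra. field. apply INR_S_neq0. }
    rewrite !E, <- RtoC_minus. f_equal. ring.
  - apply Clim_RtoC. replace (- (ln (INR N) / 2))%R with (- / 2 * ln (INR N))%R by field.
    apply is_lim_seq_mult'; [apply is_lim_seq_const | apply harm_ln; auto].
Qed.

Lemma Cser_basel : Cser (fun m => RtoC (/ INR (S m) ^ 2)) (RtoC (PI ^ 2 / 6)).
Proof.
  apply Cser_Re_Im. split; simpl; [apply basel |].
  assert (Z := Cser_0). apply Cser_Re_Im in Z. apply (proj2 Z).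
Qed.

Lemma Im_neg_inv (tau : C) : (0 < Im tau)%R -> (0 < Im (- (1) / tau))%R.
Proof.
  intros H. destruct tau as [x y]. simpl in *.
  assert (0 < x * (x * 1) + y * (y * 1))%R by nra.
  replace (- (1) * (- y / (x * (x * 1) + y * (y * 1))) + - 0 * (x / (x * (x * 1) + y * (y * 1))))%R
    with (y / (x * (x * 1) + y * (y * 1)))%R by (field; lra).
  apply Rdiv_lt_0_compat; auto.
Qed.

Lemma eta_log (tau s : C) : (0 < Im tau)%R ->
  Cser (fun m => q tau ^ S m / (1 - q tau ^ S m) / RtoC (INR (S m))) s ->
  eta tau = cexp (PI * Ci * tau / 12 - s).
Proof.
  intros Hy Hs. destruct (euler_log (q tau) (Cmod_q_lt _ Hy)) as [s' [A B]].
  rewrite (Cser_unique _ _ _ A Hs) in B. unfold eta. rewrite B, <- cexp_plus. f_equal.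
Qed.

(** A relation between four values, in which the square root of tau and the root of unity of the
    usual law cancel. One pair of Lambert sums is read off the rows of the array [a], the other pair
    off its columns. *)
Lemma eta_fricke (tau : C) (N : nat) : (0 < Im tau)%R -> (1 <= N)%nat ->
  eta (- (1) / (RtoC (INR N) * tau)) * eta tau
  = RtoC (sqrt (INR N)) * eta (- (1) / tau) * eta (RtoC (INR N) * tau).
Proof.
  intros Hy HN. pose proof PI_RGT_0 as Hpi.
  assert (HN1 : (1 <= INR N)%R) by (apply (le_INR 1); lia).
  set (n := RtoC (INR N)). assert (Nn : n <> 0) by (apply RtoC_neq0; lra).
  assert (Nt : tau <> 0) by (apply Cmod_gt_0, Cmod_pos_Im; auto).
  assert (Npi : RtoC PI <> 0) by (apply RtoC_neq0; lra).
  set (t1 := n * tau). set (t' := - (1) / tau). set (t'' := - (1) / t1).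
  assert (Hy1 : (0 < Im t1)%R) by (unfold t1, n; rewrite im_scal_l; nra).
  assert (Hy' : (0 < Im t')%R) by (apply Im_neg_inv; auto).
  assert (Hy'' : (0 < Im t'')%R) by (apply Im_neg_inv; auto).
  destruct (euler_log _ (Cmod_q_lt _ Hy)) as [s [Hs _]].
  destruct (euler_log _ (Cmod_q_lt _ Hy1)) as [s1 [Hs1 _]].
  destruct (euler_log _ (Cmod_q_lt _ Hy')) as [s' [Hs' _]].
  destruct (euler_log _ (Cmod_q_lt _ Hy'')) as [s'' [Hs'' _]].
  set (g := fun (t : C) m j => t / (RtoC (INR (S j)) ^ 2 - RtoC (INR m) ^ 2 * t ^ 2)).
  assert (Hg1 : forall m j, g t1 m j = n * g tau (N * m)%nat j).
  { intros m j. unfold g, t1. rewrite mult_INR, RtoC_mult. fold n.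
    replace (RtoC (INR m) ^ 2 * (n * tau) ^ 2) with ((n * RtoC (INR m)) ^ 2 * tau ^ 2) by ring.
    unfold Cdiv. ring. }
  (* Inversion exchanges the two summation indices: this is where the transformation law comes
     from. *)
  assert (Hswap : forall t m j, (0 < Im t)%R -> g (- (1) / t) (S j) m = g t (S m) j).
  { intros t m j Ht. unfold g.
    assert (Nt0 : t <> 0) by (apply Cmod_gt_0, Cmod_pos_Im; auto).
    destruct (sq_minus_lower t Ht) as [c [Hc Hl]]. destruct (Hl (S j) (S m)) as [Hl1 _].
    pose proof (INR_S_ge1 j).
    assert (Hcj : (0 < c * INR (S j) ^ 2)%R) by (apply Rmult_lt_0_compat; nra).
    assert (Nd : RtoC (INR (S j)) ^ 2 - RtoC (INR (S m)) ^ 2 * t ^ 2 <> 0) by (apply Cmod_gt_0; lra).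
    assert (E : RtoC (INR (S m)) ^ 2 - RtoC (INR (S j)) ^ 2 * (- (1) / t) ^ 2
      = - (RtoC (INR (S j)) ^ 2 - RtoC (INR (S m)) ^ 2 * t ^ 2) / t ^ 2) by (field; auto).
    rewrite E. revert Nd. generalize (RtoC (INR (S j)) ^ 2 - RtoC (INR (S m)) ^ 2 * t ^ 2). intros D Nd.
    field. auto. }
  (* Row b takes the indices N b + 1, ..., N b + N for tau and subtracts the index b + 1 for N tau,
     which is N times the last of these terms. The subtraction supplies the missing power of
     decay. *)
  set (a := fun b j => Csum (fun r => g tau (S (N * b + r)) j) N - g t1 (S b) j).
  set (R := fun b => Csum (fun r => hsum tau (S (N * b + r))) N - hsum t1 (S b)).
  set (K := fun j => hsum t' (S j) - hsum t'' (S j)).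
  assert (HR : forall b, Cser (a b) (R b)).
  { intros b. unfold a, R. apply Cser_minus.
    - apply (Cser_Csum (fun r j => g tau (S (N * b + r)) j)). intros r Hr. apply hsum_correct; auto. lia.
    - apply hsum_correct; auto. lia. }
  assert (HK : forall j, Cser (fun b => a b j) (K j)).
  { intros j. unfold a, K.
    assert (C1 : Cser (fun m => g tau (S m) j) (hsum t' (S j))).
    { eapply Cser_ext; [| apply (hsum_correct t' (S j) Hy'); lia].
      intros m. apply (Hswap tau m j Hy). }
    assert (C2 : Cser (fun m => g t1 (S m) j) (hsum t'' (S j))).
    { eapply Cser_ext; [| apply (hsum_correct t'' (S j) Hy''); lia].
      intros m. apply (Hswap t1 m j Hy1). }
    apply Cser_minus; auto.
    apply Cser_Clim. apply Cser_Clim in C1.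
    apply Clim_ext with (fun M => Csum (fun m => g tau (S m) j) (N * M)).
    - intros M. apply Csum_blocks.
    - apply (Clim_subseq (Csum (fun m => g tau (S m) j)) _ (fun M => (N * M)%nat)); auto. intros; nia. }
  destruct (block_term_bound tau N Hy HN) as [B [HB0 HB]].
  destruct (Cser_fubini a (fun b => INR N * B * inv_rt3 b)%R inv_rt3 R K) as [T [HT1 HT2]]; auto.
  { intros; apply Rmult_le_pos; [nra | apply inv_rt3_pos]. }
  { apply inv_rt3_pos. }
  { apply ex_series_Rscal, ex_series_inv_rt3. }
  { apply ex_series_inv_rt3. }
  { intros b j. unfold a.
    replace (Csum (fun r => g tau (S (N * b + r)) j) N - g t1 (S b) j)
      with (Csum (fun r => g tau (S (N * b + r)) j - g tau (N * S b)%nat j) N).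
    - eapply Rle_trans; [apply Cmod_Csum |].
      eapply Rle_trans; [apply Rsum_le; intros r Hr; apply HB; auto |].
      rewrite Rsum_const. right; ring.
    - rewrite Csum_minus, Csum_const, Hg1. reflexivity. }
  (* In s' - s'' the harmonic terms cancel index by index. *)
  assert (E1 : s' - s'' = Ci / (2 * PI) * ((n - 1) * tau) * RtoC (PI ^ 2 / 6) - Ci / PI * T).
  { apply (Cser_unique _ _ _ (Cser_minus _ _ _ _ Hs' Hs'')).
    eapply Cser_ext; [| apply Cser_minus; [apply (Cser_scal (Ci / (2 * PI) * ((n - 1) * tau)) _ _ Cser_basel) | apply (Cser_scal (Ci / PI) _ _ HT2)]].
    intros j. cbv beta. rewrite (lambert_term t' j Hy'), (lambert_term t'' j Hy''). unfold K.
    assert (F1 : Ci / (2 * PI * t') = - (Ci / (2 * PI) * tau)) by (unfold t'; field; auto).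
    assert (F2 : Ci / (2 * PI * t'') = - (Ci / (2 * PI) * (n * tau))) by (unfold t'', t1; field; auto).
    rewrite F1, F2. ring. }
  (* Here the rows force the sums to run up to N M for tau but only up to M for N tau, so the
     harmonic terms leave -(ln N) / 2. *)
  assert (E2 : s - s1 = RtoC (- (ln (INR N) / 2)) + Ci / (2 * PI * tau) * ((1 - / n) * RtoC (PI ^ 2 / 6)) - Ci / PI * T).
  { apply (Clim_unique (fun M => Csum (fun m => q tau ^ S m / (1 - q tau ^ S m) / RtoC (INR (S m))) (N * M)
       - Csum (fun m => q t1 ^ S m / (1 - q t1 ^ S m) / RtoC (INR (S m))) M)).
    - apply Clim_minus; [| now apply Cser_Clim].
      apply Cser_Clim in Hs.
      apply (Clim_subseq _ _ (fun M => (N * M)%nat) ltac:(intros; cbv beta; nia) Hs).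
    - apply Clim_ext with (fun M =>
         (Csum (fun m => - (1) / (2 * RtoC (INR (S m)))) (N * M) - Csum (fun m => - (1) / (2 * RtoC (INR (S m)))) M)
         + Ci / (2 * PI * tau) * (Csum (fun m => RtoC (/ INR (S m) ^ 2)) (N * M) - / n * Csum (fun m => RtoC (/ INR (S m) ^ 2)) M)
         - Ci / PI * Csum R M).
      + intros M. unfold R. rewrite (Csum_minus (fun b => Csum (fun r => hsum tau (S (N * b + r))) N)).
        rewrite <- (Csum_blocks (fun m => hsum tau (S m)) N M).
        rewrite (Csum_ext (fun m => q tau ^ S m / _ / _) _ _ (fun m _ => lambert_term tau m Hy)).
        rewrite (Csum_ext (fun m => q t1 ^ S m / _ / _) _ _ (fun m _ => lambert_term t1 m Hy1)).
        rewrite !Csum_minus, !Csum_plus, !Csum_scal.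
        unfold t1 at 2. field. auto.
      + assert (ZB := Cser_basel). apply Cser_Clim in ZB.
        apply Clim_minus; [apply Clim_plus |].
        * apply Clim_harm_C; auto.
        * apply Clim_scal.
          replace ((1 - / n) * RtoC (PI ^ 2 / 6)) with (RtoC (PI ^ 2 / 6) - / n * RtoC (PI ^ 2 / 6)) by ring.
          apply Clim_minus; [| apply Clim_scal; auto].
          apply (Clim_subseq _ _ (fun M => (N * M)%nat) ltac:(intros; cbv beta; nia) ZB).
        * apply Clim_scal. now apply Cser_Clim. }
  rewrite (eta_log _ _ Hy'' Hs''), (eta_log _ _ Hy Hs), (eta_log _ _ Hy' Hs'), (eta_log _ _ Hy1 Hs1).
  replace (RtoC (sqrt (INR N))) with (cexp (RtoC (ln (INR N) / 2))).
  2:{ unfold cexp. rewrite re_RtoC, im_RtoC, cos_0, sin_0.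
      replace (exp (ln (INR N) / 2)) with (sqrt (INR N)); [apply Ceq; simpl; ring |].
      apply Rsqr_inj; [apply sqrt_pos | apply Rlt_le, exp_pos |].
      rewrite Rsqr_sqrt by lra. unfold Rsqr. rewrite <- exp_plus.
      replace (ln (INR N) / 2 + ln (INR N) / 2)%R with (ln (INR N)) by field. rewrite exp_ln; lra. }
  rewrite <- !cexp_plus. f_equal.
  replace s with (s - s1 + s1) by ring. replace s'' with (s' - (s' - s'')) by ring.
  rewrite E1, E2. unfold t'', t', t1.
  rewrite RtoC_opp, !RtoC_div, RtoC_pow by lra. field. auto.
Qed.

(** * Power series in the unit disc *)

Definition psum (c : nat -> C) (g : C -> C) : Prop :=
  forall x : C, (Cmod x < 1)%R -> Cser (fun n => c n * x ^ n) (g x).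

Lemma pseries_term_bound (c : nat -> C) (r : R) l : (0 <= r)%R ->
  Cser (fun n => c n * RtoC r ^ n) l -> exists B, (0 <= B)%R /\ forall n, (Cmod (c n) * r ^ n <= B)%R.
Proof.
  intros Hr H. apply Clim_term_0 in H. destruct (Clim_bounded _ _ H) as [B [HB0 HB]].
  exists B. split; auto. intros n. specialize (HB n). rewrite Cmod_mult, Cmod_pow, Cmod_R, Rabs_pos_eq in HB; auto.
Qed.

Lemma ex_series_geom_dom (c : nat -> C) (B rho r : R) : (0 <= r < rho)%R ->
  (forall n, (Cmod (c n) * rho ^ n <= B)%R) -> ex_series (fun n => Cmod (c n) * r ^ n)%R.
Proof.
  intros Hr HB. apply ex_series_Rle with (fun n => B * (r / rho) ^ n)%R.
  - intros n. assert (0 <= r ^ n)%R by (apply pow_le; lra). split.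
    + apply Rmult_le_pos; auto. apply Cmod_ge_0.
    + specialize (HB n). unfold Rdiv. rewrite Rpow_mult_distr, pow_inv.
      assert (0 < rho ^ n)%R by (apply pow_lt; lra).
      replace (Cmod (c n) * r ^ n)%R with (Cmod (c n) * rho ^ n * (r ^ n * / rho ^ n))%R by (field; lra).
      apply Rmult_le_compat_r; auto. apply Rle_mult_inv_pos; auto.
  - apply ex_series_Rscal, ex_series_geom. rewrite Rabs_pos_eq.
    + apply Rlt_div_l; lra.
    + apply Rle_mult_inv_pos; lra.
Qed.

Lemma psum_abs c g : psum c g -> forall x, (Cmod x < 1)%R -> ex_series (fun n => Cmod (c n * x ^ n)).
Proof.
  intros H x Hx. pose proof (Cmod_ge_0 x). set (rho := ((1 + Cmod x) / 2)%R).
  assert (Hrho : (Cmod (RtoC rho) < 1)%R) by (rewrite Cmod_R, Rabs_pos_eq; unfold rho; lra).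
  destruct (pseries_term_bound c rho _ ltac:(unfold rho; lra) (H _ Hrho)) as [B [_ HB]].
  eapply ex_series_ext; [| apply (ex_series_geom_dom c B rho (Cmod x)); auto; unfold rho; lra].
  intros n. cbv beta. rewrite Cmod_mult, Cmod_pow. reflexivity.
Qed.

Lemma conv_scale c d x n : conv c d n * x ^ n = conv (fun k => c k * x ^ k) (fun k => d k * x ^ k) n.
Proof.
  unfold conv. rewrite Cmult_comm, <- Csum_scal. apply Csum_ext. intros k Hk.
  replace n with (k + (n - k))%nat at 1 by lia. rewrite Cpow_add_r. ring.
Qed.

Lemma psum_mult c d g h : psum c g -> psum d h -> psum (conv c d) (fun x => g x * h x).
Proof.
  intros Hc Hd x Hx. eapply Cser_ext; [intros n; symmetry; apply conv_scale |].
  apply Cser_conv; auto; [apply (psum_abs c g) | apply (psum_abs d h)]; auto.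
Qed.

(** Coefficients that become stationary, with a bound on each smaller disc that is uniform in M,
    pass to the limit by Tannery's theorem. *)
Lemma psum_limit (c : nat -> nat -> C) (c' : nat -> C) (g : nat -> C -> C) (g' : C -> C) :
  (forall M, psum (c M) (g M)) ->
  (forall M n, (n <= M)%nat -> c M n = c' n) ->
  (forall r, (0 <= r < 1)%R -> exists B, forall M n, (Cmod (c M n) * r ^ n <= B)%R) ->
  (forall x, (Cmod x < 1)%R -> Clim (fun M => g M x) (g' x)) ->
  psum c' g'.
Proof.
  intros H Hst Hb Hlim x Hx. pose proof (Cmod_ge_0 x). set (rho := ((1 + Cmod x) / 2)%R).
  destruct (Hb rho ltac:(unfold rho; lra)) as [B HB].
  assert (HB' : forall n, (Cmod (c' n) * rho ^ n <= B)%R).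
  { intros n. rewrite <- (Hst n n) by auto. apply HB. }
  assert (Hterm : forall d : nat -> C, (forall n, (Cmod (d n) * rho ^ n <= B)%R) ->
     forall n, (Cmod (d n * x ^ n) <= B * (Cmod x / rho) ^ n)%R).
  { intros d Hd n. rewrite Cmod_mult, Cmod_pow. specialize (Hd n). unfold Rdiv. rewrite Rpow_mult_distr, pow_inv.
    assert (0 < rho ^ n)%R by (apply pow_lt; unfold rho; lra).
    assert (0 <= Cmod x ^ n)%R by (apply pow_le; lra).
    replace (Cmod (d n) * Cmod x ^ n)%R with (Cmod (d n) * rho ^ n * (Cmod x ^ n * / rho ^ n))%R by (field; lra).
    apply Rmult_le_compat_r; auto. apply Rle_mult_inv_pos; auto. }
  destruct (Cser_ex (fun n => c' n * x ^ n)) as [T HT].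
  { eapply ex_series_ext; [| apply (ex_series_geom_dom c' B rho (Cmod x)); auto; unfold rho; lra].
    intros n. cbv beta. rewrite Cmod_mult, Cmod_pow. reflexivity. }
  assert (C1 : Clim (fun M => g M x) T).
  { apply (Cser_tannery (fun M n => c M n * x ^ n) _ (fun n => c' n * x ^ n) (fun n => B * (Cmod x / rho) ^ n)%R T 0 0); auto.
    - intros M _. apply H; auto.
    - intros n. eapply Rle_trans; [apply Cmod_ge_0 | apply (Hterm c' HB')].
    - apply ex_series_Rscal, ex_series_geom. rewrite Rabs_pos_eq.
      + apply Rlt_div_l; unfold rho; lra.
      + apply Rle_mult_inv_pos; unfold rho; lra.
    - intros n. apply (Clim_ext_loc (fun _ => c' n * x ^ n) _ _ n); [| apply Clim_const].
      intros M HM. rewrite Hst; auto. }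
  rewrite <- (Clim_unique _ _ _ C1 (Hlim x Hx)). exact HT.
Qed.

(** * Integer power series *)

Fixpoint Zsum (f : nat -> Z) (n : nat) : Z :=
  match n with O => 0%Z | S k => (Zsum f k + f k)%Z end.

Definition zconv (a b : nat -> Z) (n : nat) : Z := Zsum (fun k => a k * b (n - k)%nat)%Z (S n).

Definition ZC (z : nat -> Z) (n : nat) : C := RtoC (IZR (z n)).

Lemma ZC_conv a b n : conv (ZC a) (ZC b) n = ZC (zconv a b) n.
Proof.
  unfold conv, ZC, zconv. generalize (S n). intros m. induction m; simpl; auto.
  rewrite IHm, plus_IZR, RtoC_plus, mult_IZR, RtoC_mult. reflexivity.
Qed.

Lemma Zsum_ext f g n : (forall k, (k < n)%nat -> f k = g k) -> Zsum f n = Zsum g n.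
Proof. induction n; simpl; intros H; auto. rewrite IHn, H; auto; intros; apply H; lia. Qed.

Lemma Zsum_single f n i : (i < n)%nat -> (forall k, (k < n)%nat -> k <> i -> f k = 0%Z) -> Zsum f n = f i.
Proof.
  induction n; intros Hi H; [lia |]. simpl. destruct (Nat.eq_dec i n) as [-> | N].
  - rewrite (Zsum_ext f (fun _ => 0%Z)) by (intros; apply H; lia).
    clear. assert (Zsum (fun _ => 0%Z) n = 0%Z) as ->; [induction n; simpl; lia | lia].
  - rewrite IHn, (H n); try lia. intros; apply H; lia.
Qed.

Lemma Zsum_nonneg f n : (forall k, (k < n)%nat -> (0 <= f k)%Z) -> (0 <= Zsum f n)%Z.
Proof. induction n; simpl; intros H; [lia |]. specialize (IHn ltac:(intros; apply H; lia)). specialize (H n ltac:(lia)). lia. Qed.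

Lemma Zsum_ge_term f n i : (i < n)%nat -> (forall k, (k < n)%nat -> (0 <= f k)%Z) -> (f i <= Zsum f n)%Z.
Proof.
  induction n; intros Hi H; [lia |]. simpl.
  destruct (Nat.eq_dec i n) as [-> | N].
  - pose proof (Zsum_nonneg f n ltac:(intros; apply H; lia)). lia.
  - specialize (IHn ltac:(lia) ltac:(intros; apply H; lia)). specialize (H n ltac:(lia)). lia.
Qed.

Lemma Zsum_ge_two f n i j : (i < j)%nat -> (j < n)%nat -> (forall k, (k < n)%nat -> (0 <= f k)%Z) ->
  (f i + f j <= Zsum f n)%Z.
Proof.
  induction n; intros Hi Hj H; [lia |]. simpl.
  destruct (Nat.eq_dec j n) as [-> | N].
  - pose proof (Zsum_ge_term f n i ltac:(lia) ltac:(intros; apply H; lia)). lia.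
  - specialize (IHn ltac:(lia) ltac:(lia) ltac:(intros; apply H; lia)). specialize (H n ltac:(lia)). lia.
Qed.

Definition zone (n : nat) : Z := if Nat.eq_dec n 0 then 1%Z else 0%Z.

Lemma psum_one : psum (ZC zone) (fun _ => 1).
Proof.
  intros x Hx. pose proof (Cser_finite (fun n => ZC zone n * x ^ n) 1) as H.
  replace (Csum (fun n => ZC zone n * x ^ n) 1) with (RtoC 1) in H by (simpl; unfold ZC, zone; simpl; ring).
  apply H. intros k Hk. unfold ZC, zone. destruct (Nat.eq_dec k 0); [lia |]. simpl. ring.
Qed.

Definition zgeom (k n : nat) : Z := if Nat.eq_dec (n mod k) 0 then 1%Z else 0%Z.

Lemma Cser_dilate (a : nat -> C) l k : (0 < k)%nat -> Cser a l ->
  Cser (fun n => if Nat.eq_dec (n mod k) 0 then a (n / k)%nat else 0) l.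
Proof.
  intros Hk H. apply Cser_Clim in H. apply Cser_Clim.
  set (d := fun n => if Nat.eq_dec (n mod k) 0 then a (n / k)%nat else 0).
  assert (E : forall M, Csum d (k * M) = Csum a M).
  { intros M. rewrite Csum_blocks. apply Csum_ext. intros b _.
    destruct k; [lia |]. rewrite Csum_head, Nat.add_0_r. unfold d at 1.
    replace (S k * b)%nat with (b * S k)%nat by lia.
    rewrite Nat.Div0.mod_mul, Nat.div_mul by lia. destruct (Nat.eq_dec 0 0); [| lia].
    rewrite (Csum_ext _ (fun _ => 0)).
    - rewrite Csum_const. ring.
    - intros r Hr. unfold d. replace (b * S k + S r)%nat with (S r + b * S k)%nat by lia.
      rewrite Nat.Div0.mod_add, Nat.mod_small by lia. destruct (Nat.eq_dec (S r) 0); [lia | auto]. }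
  assert (F : forall n, (0 < n)%nat -> Csum d n = Csum a ((n - 1) / k + 1)).
  { intros n Hn. rewrite <- E. set (M := ((n - 1) / k)%nat).
    pose proof (Nat.div_mod (n - 1) k ltac:(lia)). pose proof (Nat.mod_upper_bound (n - 1) k ltac:(lia)).
    fold M in H0.
    replace (k * (M + 1))%nat with (n + (k * (M + 1) - n))%nat by nia.
    rewrite Csum_add. rewrite (Csum_ext (fun k0 => d (n + k0)%nat) (fun _ => 0)).
    - rewrite Csum_const. ring.
    - intros r Hr. unfold d.
      assert (Em : ((n + r) mod k = n + r - k * M)%nat).
      { replace (n + r)%nat with ((n + r - k * M) + M * k)%nat at 1 by nia.
        rewrite Nat.Div0.mod_add, Nat.mod_small; nia. }
      destruct (Nat.eq_dec ((n + r) mod k) 0); [nia | auto]. }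
  intros eps He. destruct (H eps He) as [N HN]. exists (k * N + 1)%nat. intros n Hn.
  rewrite F by lia. apply HN.
  assert (N <= (n - 1) / k)%nat by (apply Nat.div_le_lower_bound; lia). lia.
Qed.

Lemma dilate_term (c : nat -> C) k (x : C) n : (0 < k)%nat ->
  (if Nat.eq_dec (n mod k) 0 then c (n / k)%nat * (x ^ k) ^ (n / k) else 0)
  = (if Nat.eq_dec (n mod k) 0 then c (n / k)%nat else 0) * x ^ n.
Proof.
  intros Hk. destruct (Nat.eq_dec (n mod k) 0) as [E | E]; [| ring].
  rewrite <- Cpow_mult_r. f_equal. f_equal.
  pose proof (Nat.div_mod n k ltac:(lia)). lia.
Qed.

Lemma psum_dilate c g k : (0 < k)%nat -> psum c g ->
  psum (fun n => if Nat.eq_dec (n mod k) 0 then c (n / k)%nat else 0) (fun x => g (x ^ k)).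
Proof.
  intros Hk H x Hx.
  assert (Hxk : (Cmod (x ^ k) < 1)%R).
  { rewrite Cmod_pow. pose proof (Cmod_ge_0 x). apply pow_lt_1_compat; [lra | auto]. }
  specialize (H _ Hxk). apply (Cser_dilate _ _ k Hk) in H.
  eapply Cser_ext; [| exact H]. intros n. apply dilate_term; auto.
Qed.

Lemma psum_ext c d g h : (forall n, c n = d n) -> (forall x, (Cmod x < 1)%R -> g x = h x) -> psum c g -> psum d h.
Proof.
  intros E F H x Hx. rewrite <- F by auto. eapply Cser_ext; [| apply H; auto].
  intros n. simpl. now rewrite E.
Qed.

Lemma psum_geom k : (0 < k)%nat -> psum (ZC (zgeom k)) (fun x => / (1 - x ^ k)).
Proof.
  intros Hk. eapply psum_ext; [| | apply (psum_dilate (fun _ => 1) (fun x => / (1 - x)) k Hk)].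
  - intros n. unfold ZC, zgeom. destruct (Nat.eq_dec (n mod k) 0); reflexivity.
  - reflexivity.
  - intros x Hx. eapply Cser_ext; [| apply Cser_geom; auto]. intros n; simpl; ring.
Qed.

(** * The Euler product and its inverse *)

(** Coefficients of 1 / ((1 - x) ... (1 - x^M)), the numbers of partitions into parts of size at
    most M. *)
Fixpoint part (M : nat) : nat -> Z :=
  match M with O => zone | S k => zconv (part k) (zgeom (S k)) end.

Fixpoint eprod (M : nat) (n : nat) : Z :=
  match M with
  | O => zone n
  | S k => (eprod k n - (if le_lt_dec (S k) n then eprod k (n - S k) else 0))%Z
  end.

Lemma part_nonneg M n : (0 <= part M n)%Z.
Proof.
  revert n. induction M; intros n; simpl.
  - unfold zone. destruct (Nat.eq_dec n 0); lia.
  - apply Zsum_nonneg. intros k _. specialize (IHM k). unfold zgeom.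
    destruct (Nat.eq_dec _ 0); lia.
Qed.

Lemma part_stable_S M n : (n <= M)%nat -> part (S M) n = part M n.
Proof.
  intros H. simpl. unfold zconv. rewrite (Zsum_single _ _ n); [| lia |].
  - rewrite Nat.sub_diag. unfold zgeom. rewrite Nat.Div0.mod_0_l. simpl. lia.
  - intros k Hk Hkn. unfold zgeom. rewrite Nat.mod_small by lia.
    destruct (Nat.eq_dec (n - k) 0); lia.
Qed.

Lemma part_stable M n : (n <= M)%nat -> part M n = part n n.
Proof.
  induction M; intros H; [replace n with 0%nat by lia; auto |].
  destruct (Nat.eq_dec n (S M)) as [-> | ?]; auto.
  rewrite part_stable_S by lia. apply IHM. lia.
Qed.

Lemma eprod_stable M n : (n <= M)%nat -> eprod M n = eprod n n.
Proof.
  induction M; intros H; [replace n with 0%nat by lia; auto |].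
  destruct (Nat.eq_dec n (S M)) as [-> | ?]; auto.
  cbn [eprod]. destruct (le_lt_dec (S M) n); [lia |]. rewrite IHM by lia. lia.
Qed.

(** Dividing by 1 - x^k adds up all shifts by multiples of k, among them the shifts 0 and k that
    occur in multiplying by 1 - x^k. One bound thus serves the Euler product and its inverse. *)
Lemma eprod_le_part M n : (Z.abs (eprod M n) <= part M n)%Z.
Proof.
  revert n. induction M; intros n.
  - simpl. unfold zone. destruct (Nat.eq_dec n 0); lia.
  - cbn [eprod part]. unfold zconv.
    assert (Hp : forall k, (k < S n)%nat -> (0 <= part M k * zgeom (S M) (n - k))%Z).
    { intros k _. pose proof (part_nonneg M k). unfold zgeom. destruct (Nat.eq_dec _ 0); lia. }
    assert (Hn : (part M n * zgeom (S M) (n - n) = part M n)%Z).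
    { rewrite Nat.sub_diag. unfold zgeom. rewrite Nat.Div0.mod_0_l. simpl. lia. }
    destruct (le_lt_dec (S M) n) as [L | L].
    + pose proof (Zsum_ge_two _ (S n) (n - S M) n ltac:(lia) ltac:(lia) Hp) as G.
      cbv beta in G. rewrite Hn in G. replace (n - (n - S M))%nat with (S M) in G by lia.
      assert (E1 : zgeom (S M) (S M) = 1%Z) by (unfold zgeom; rewrite Nat.Div0.mod_same; reflexivity).
      rewrite E1, Z.mul_1_r in G.
      pose proof (IHM n). pose proof (IHM (n - S M)%nat). lia.
    + pose proof (Zsum_ge_term _ (S n) n ltac:(lia) Hp) as G. cbv beta in G. rewrite Hn in G.
      pose proof (IHM n). lia.
Qed.

Lemma Cprod_euler_nz x M : (Cmod x < 1)%R -> Cprod (fun n => 1 - x ^ S n) M <> 0.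
Proof.
  intros Hx. induction M; cbn [Cprod]; [apply C1_nz |]. apply Cmult_neq_0; auto.
  apply Cmod_lt_1_nz. rewrite Cmod_pow. pose proof (Cmod_ge_0 x). apply pow_lt_1_compat; [lra | lia].
Qed.

Lemma psum_part M : psum (ZC (part M)) (fun x => / Cprod (fun n => 1 - x ^ S n) M).
Proof.
  induction M.
  - eapply psum_ext; [| | apply psum_one]; [reflexivity |]. intros; cbn. field.
  - eapply psum_ext; [| | apply (psum_mult _ _ _ _ IHM (psum_geom (S M) ltac:(lia)))].
    + intros n. rewrite ZC_conv. reflexivity.
    + intros x Hx. pose proof (Cprod_euler_nz x M Hx) as N1. pose proof (Cprod_euler_nz x (S M) Hx) as N2.
      cbn [Cprod] in *. field. split; auto. intros E. apply N2. rewrite E. ring.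
Qed.

Lemma psum_plus c d g h : psum c g -> psum d h -> psum (fun n => c n + d n) (fun x => g x + h x).
Proof.
  intros Hc Hd x Hx. eapply Cser_ext; [| apply (Cser_plus _ _ _ _ (Hc x Hx) (Hd x Hx))].
  intros n; simpl; ring.
Qed.

Lemma Cser_shift a l k : Cser a l -> Cser (fun n => if le_lt_dec k n then a (n - k)%nat else 0) l.
Proof.
  rewrite !Cser_Clim. intros H eps He. destruct (H eps He) as [N HN]. exists (N + k)%nat. intros n Hn.
  replace n with (k + (n - k))%nat by lia. rewrite Csum_add.
  rewrite (Csum_ext (fun n => if le_lt_dec k n then _ else _) (fun _ => 0)).
  - rewrite Csum_const. rewrite (Csum_ext _ a).
    + replace (RtoC (INR k) * 0 + Csum a (n - k) - l) with (Csum a (n - k) - l) by ring. apply HN. lia.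
    + intros i Hi. destruct (le_lt_dec k (k + i)); [f_equal; lia | lia].
  - intros i Hi. destruct (le_lt_dec k i); [lia | auto].
Qed.

Lemma psum_shift c g k : psum c g -> psum (fun n => if le_lt_dec k n then c (n - k)%nat else 0) (fun x => x ^ k * g x).
Proof.
  intros H x Hx. specialize (H x Hx). apply (Cser_scal (x ^ k)) in H. apply (Cser_shift _ _ k) in H.
  eapply Cser_ext; [| exact H]. intros n. cbv beta. destruct (le_lt_dec k n) as [L | L]; [| ring].
  assert (E : x ^ n = x ^ k * x ^ (n - k)) by (rewrite <- Cpow_add_r; f_equal; lia).
  rewrite E. ring.
Qed.

Lemma psum_scal a c g : psum c g -> psum (fun n => a * c n) (fun x => a * g x).
Proof.
  intros H x Hx. eapply Cser_ext; [| apply (Cser_scal a _ _ (H x Hx))]. intros n; simpl; ring.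
Qed.

Lemma psum_eprod M : psum (ZC (eprod M)) (fun x => Cprod (fun n => 1 - x ^ S n) M).
Proof.
  induction M.
  - apply psum_one.
  - pose proof (psum_plus _ _ _ _ IHM (psum_scal (- (1)) _ _ (psum_shift _ _ (S M) IHM))) as H.
    eapply psum_ext; [| | exact H].
    + intros n. unfold ZC. cbn [eprod]. rewrite minus_IZR, RtoC_minus.
      destruct (le_lt_dec (S M) n); simpl; ring.
    + intros x Hx. cbn [Cprod]. ring.
Qed.

(** The coefficients are nonnegative, so each term is at most the value of the series at r, and
    these values converge as M grows. *)
Lemma part_bound r : (0 <= r < 1)%R -> exists B, forall M n, (IZR (part M n) * r ^ n <= B)%R.
Proof.
  intros Hr. assert (Hx : (Cmod (RtoC r) < 1)%R) by (rewrite Cmod_R, Rabs_pos_eq; lra).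
  destruct (euler_log _ Hx) as [s [_ Hs]].
  assert (Ne : euler (RtoC r) <> 0) by (rewrite Hs; apply cexp_nz).
  pose proof (Clim_inv _ _ Ne (euler_lim _ Hx)) as L. destruct (Clim_bounded _ _ L) as [B [HB0 HB]].
  exists B. intros M n. pose proof (psum_part M _ Hx) as P.
  apply Cser_Re_Im in P. destruct P as [P _]. apply is_series_Rsum in P.
  assert (Et : forall k, Re (ZC (part M) k * RtoC r ^ k) = (IZR (part M k) * r ^ k)%R).
  { intros k. rewrite <- RtoC_pow. unfold ZC. rewrite <- RtoC_mult. reflexivity. }
  assert (Hpos : forall k, (0 <= Re (ZC (part M) k * RtoC r ^ k))%R).
  { intros k. rewrite Et. apply Rmult_le_pos; [apply IZR_le, part_nonneg | apply pow_le; lra]. }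
  pose proof (is_lim_seq_incr_compare _ _ P) as Q.
  set (G := / Cprod (fun n => 1 - RtoC r ^ S n) M) in *.
  assert (Q' : (Rsum (fun k => Re (ZC (part M) k * RtoC r ^ k)) (S n) <= Re G)%R).
  { apply Q. intros k. cbn [Rsum]. specialize (Hpos k). lra. }
  specialize (HB M). cbv beta in HB. fold G in HB.
  pose proof (Rle_abs (Re G)). pose proof (re_le_Cmod G).
  cbn [Rsum] in Q'. rewrite Et in Q'.
  assert (0 <= Rsum (fun k => Re (ZC (part M) k * RtoC r ^ k)) n)%R by (apply Rsum_nonneg; auto). lra.
Qed.

Definition eul (n : nat) : Z := eprod n n.
Definition npart (n : nat) : Z := part n n.

Lemma euler_nz x : (Cmod x < 1)%R -> euler x <> 0.
Proof. intros Hx. destruct (euler_log x Hx) as [s [_ ->]]. apply cexp_nz. Qed.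

Lemma psum_npart : psum (ZC npart) (fun x => / euler x).
Proof.
  apply (psum_limit (fun M => ZC (part M)) _ (fun M x => / Cprod (fun n => 1 - x ^ S n) M)).
  - apply psum_part.
  - intros M n H. unfold ZC, npart. now rewrite part_stable.
  - intros r Hr. destruct (part_bound r Hr) as [B HB]. exists B. intros M n.
    unfold ZC. rewrite Cmod_R, Rabs_pos_eq; [apply HB | apply IZR_le, part_nonneg].
  - intros x Hx. apply Clim_inv; [apply euler_nz | apply euler_lim]; auto.
Qed.

Lemma psum_eul : psum (ZC eul) euler.
Proof.
  apply (psum_limit (fun M => ZC (eprod M)) _ (fun M x => Cprod (fun n => 1 - x ^ S n) M)).
  - apply psum_eprod.
  - intros M n H. unfold ZC, eul. now rewrite eprod_stable.
  - intros r Hr. destruct (part_bound r Hr) as [B HB]. exists B. intros M n.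
    eapply Rle_trans; [| apply (HB M n)]. apply Rmult_le_compat_r; [apply pow_le; lra |].
    unfold ZC. rewrite Cmod_R, <- abs_IZR. apply IZR_le, eprod_le_part.
  - intros x Hx. apply euler_lim; auto.
Qed.

(** * q-expansions *)

Definition QE (g : C -> C) (c : nat -> C) : Prop := q_expansion g c.

Lemma QE_psum c g : psum c g -> QE (fun tau => g (q tau)) c.
Proof. intros H tau Ht. apply H. now apply Cmod_q_lt. Qed.

Lemma QE_ext g h c : (forall tau, upper_half_plane tau -> g tau = h tau) -> QE g c -> QE h c.
Proof. intros E H tau Ht. rewrite <- E by auto. now apply H. Qed.

Lemma QE_ext_coef g c d : (forall n, c n = d n) -> QE g c -> QE g d.
Proof. intros E H tau Ht. eapply Cser_ext; [| apply (H tau Ht)]. intros n; simpl. now rewrite E. Qed.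

Lemma q_imag (y : R) : q (0, y)%R = RtoC (exp (- (2 * PI * y))).
Proof. unfold q. simpl. rewrite Rmult_0_r, cos_0, sin_0. apply Ceq; simpl; ring. Qed.

Lemma QE_term_bound g c (y : R) : QE g c -> (0 < y)%R ->
  exists B, (0 <= B)%R /\ forall n, (Cmod (c n) * exp (- (2 * PI * y)) ^ n <= B)%R.
Proof.
  intros H Hy. specialize (H (0, y)%R Hy). rewrite q_imag in H.
  apply (pseries_term_bound _ _ _ (Rlt_le _ _ (exp_pos _)) H).
Qed.

Lemma QE_abs g c tau : QE g c -> upper_half_plane tau -> ex_series (fun n => Cmod (c n * q tau ^ n)).
Proof.
  intros H Ht. unfold upper_half_plane in Ht. pose proof PI_RGT_0.
  destruct (QE_term_bound g c (Im tau / 2) H ltac:(lra)) as [B [_ HB]].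
  assert (Hr : (0 <= Cmod (q tau) < exp (- (2 * PI * (Im tau / 2))))%R).
  { split; [apply Cmod_ge_0 |]. rewrite Cmod_q. apply exp_increasing. nra. }
  eapply ex_series_ext; [| apply (ex_series_geom_dom c B _ (Cmod (q tau)) Hr HB)].
  intros n. cbv beta. rewrite Cmod_mult, Cmod_pow. reflexivity.
Qed.

Lemma QE_plus g h c d : QE g c -> QE h d -> QE (fun t => g t + h t) (fun n => c n + d n).
Proof.
  intros A B tau Ht. eapply Cser_ext; [| apply (Cser_plus _ _ _ _ (A tau Ht) (B tau Ht))].
  intros n; simpl; ring.
Qed.

Lemma QE_scal a g c : QE g c -> QE (fun t => a * g t) (fun n => a * c n).
Proof.
  intros A tau Ht. eapply Cser_ext; [| apply (Cser_scal a _ _ (A tau Ht))]. intros n; simpl; ring.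
Qed.

Lemma QE_minus g h c d : QE g c -> QE h d -> QE (fun t => g t - h t) (fun n => c n - d n).
Proof.
  intros A B tau Ht. eapply Cser_ext; [| apply (Cser_minus _ _ _ _ (A tau Ht) (B tau Ht))].
  intros n; simpl; ring.
Qed.

Lemma QE_mult g h c d : QE g c -> QE h d -> QE (fun t => g t * h t) (conv c d).
Proof.
  intros A B tau Ht. eapply Cser_ext; [intros n; symmetry; apply conv_scale |].
  apply Cser_conv; [apply A | apply B | apply (QE_abs g) | apply (QE_abs h)]; auto.
Qed.

Lemma QE_1 : QE (fun _ => 1) (ZC zone).
Proof. apply (QE_psum _ (fun _ => 1) psum_one). Qed.

Lemma QE_const a : QE (fun _ => a) (fun n => a * ZC zone n).
Proof. eapply QE_ext; [| apply (QE_scal a _ _ QE_1)]. intros; simpl; ring. Qed.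

Lemma QE_mulq g c k : QE g c -> QE (fun t => q t ^ k * g t) (fun n => if le_lt_dec k n then c (n - k)%nat else 0).
Proof.
  intros H tau Ht. specialize (H tau Ht). apply (Cser_scal (q tau ^ k)) in H. apply (Cser_shift _ _ k) in H.
  eapply Cser_ext; [| exact H]. intros n. cbv beta. destruct (le_lt_dec k n) as [L | L]; [| ring].
  assert (E : q tau ^ n = q tau ^ k * q tau ^ (n - k)) by (rewrite <- Cpow_add_r; f_equal; lia).
  rewrite E. ring.
Qed.

Lemma QE_divq g c k : QE g c -> (forall n, (n < k)%nat -> c n = 0) -> QE (fun t => g t / q t ^ k) (fun n => c (k + n)%nat).
Proof.
  intros H H0 tau Ht. specialize (H tau Ht). apply (Cser_tail _ _ k) in H.
  rewrite (Csum_ext _ (fun _ => 0)) in H by (intros i Hi; rewrite H0 by auto; ring).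
  rewrite Csum_const in H. replace (g tau - RtoC (INR k) * 0) with (g tau) in H by ring.
  assert (N : q tau ^ k <> 0) by (apply Cpow_nz, q_nz).
  apply (Cser_scal (/ q tau ^ k)) in H. unfold Cdiv. rewrite Cmult_comm.
  eapply Cser_ext; [| exact H]. intros n. cbv beta. rewrite Cpow_add_r. field. auto.
Qed.

Lemma q_plus (tau : C) (x : R) : q (tau + RtoC x) = q tau * ee x.
Proof. rewrite !q_cexp. unfold ee. rewrite <- cexp_plus. f_equal. ring. Qed.

Lemma uhp_shift tau (x : R) : upper_half_plane tau -> upper_half_plane (tau + RtoC x).
Proof. unfold upper_half_plane. intros H. rewrite Im_plus, im_RtoC. lra. Qed.

Lemma uhp_scal (r : R) tau : (0 < r)%R -> upper_half_plane tau -> upper_half_plane (RtoC r * tau).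
Proof. unfold upper_half_plane. intros Hr H. rewrite im_scal_l. nra. Qed.

Lemma uhp_div (r : R) tau : (0 < r)%R -> upper_half_plane tau -> upper_half_plane (tau / RtoC r).
Proof.
  intros Hr H. unfold Cdiv. rewrite Cmult_comm, <- RtoC_inv by lra.
  apply uhp_scal; auto. now apply Rinv_0_lt_compat.
Qed.

(** Cauchy's inequality on the line Im tau = y, with the integral replaced by the mean of N
    equidistant values. *)
Lemma QE_cauchy_approx g c M (y : R) : QE g c -> (0 < y)%R -> (0 <= M)%R ->
  (forall tau, upper_half_plane tau -> (Cmod (g tau) <= M)%R) ->
  forall n, (Cmod (c n) * exp (- (2 * PI * y)) ^ n <= M)%R.
Proof.
  intros H Hy HM0 HM n. set (r := exp (- (2 * PI * y))).
  assert (Hr : (0 < r)%R) by apply exp_pos.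
  assert (Ht0 : upper_half_plane (0, y)%R) by exact Hy.
  assert (Eabs := QE_abs g c _ H Ht0). rewrite q_imag in Eabs. fold r in Eabs.
  (* Averaging over the N-th roots of unity isolates the coefficients of index n mod N. *)
  assert (Av : forall N, (0 < N)%nat ->
    Cser (fun k => (if Z.eq_dec ((Z.of_nat k - Z.of_nat n) mod Z.of_nat N) 0 then 1 else 0) * (c k * RtoC r ^ k))
      (/ RtoC (INR N) * Csum (fun j => ee (- (INR n * INR j / INR N)) * g ((0, y)%R + RtoC (INR j / INR N))) N)).
  { intros N HN. assert (HN0 : INR N <> 0%R) by (apply not_0_INR; lia).
    assert (NN : RtoC (INR N) <> 0) by (apply RtoC_neq0; auto).
    assert (A : Cser (fun k => Csum (fun j => ee (- (INR n * INR j / INR N)) * (c k * q ((0, y)%R + RtoC (INR j / INR N)) ^ k)) N)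
       (Csum (fun j => ee (- (INR n * INR j / INR N)) * g ((0, y)%R + RtoC (INR j / INR N))) N)).
    { apply (Cser_Csum (fun j k => ee (- (INR n * INR j / INR N)) * (c k * q ((0, y)%R + RtoC (INR j / INR N)) ^ k))).
      intros j _. apply Cser_scal. apply H. now apply uhp_shift. }
    apply (Cser_scal (/ RtoC (INR N))) in A. eapply Cser_ext; [| exact A].
    intros k. cbv beta.
    rewrite (Csum_ext _ (fun j => (c k * RtoC r ^ k) * ee (IZR (Z.of_nat k - Z.of_nat n) * INR j / INR N))).
    - rewrite Csum_scal, unity_sum by auto.
      destruct (Z.eq_dec ((Z.of_nat k - Z.of_nat n) mod Z.of_nat N) 0); field; auto.
    - intros j _. rewrite q_plus, q_imag. fold r. rewrite Cpow_mult_l, ee_pow.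
      rewrite minus_IZR, <- !INR_IZR_INZ.
      replace ((INR k - INR n) * INR j / INR N)%R with (- (INR n * INR j / INR N) + INR k * (INR j / INR N))%R by (field; auto).
      rewrite ee_plus. ring. }
  apply le_epsilon. intros eps He.
  destruct Eabs as [L HL]. apply is_series_Rsum in HL.
  assert (HLt : forall m, (Rsum (fun k => Cmod (c k * RtoC r ^ k)) m <= L)%R).
  { intros m. apply (is_lim_seq_incr_compare _ _ HL). intros k; cbn [Rsum]. pose proof (Cmod_ge_0 (c k * RtoC r ^ k)). lra. }
  apply is_lim_seq_spec in HL. destruct (HL (mkposreal _ He)) as [N0 HN0].
  set (N := (N0 + n + 1)%nat). specialize (HN0 N ltac:(unfold N; lia)). cbn [pos] in HN0.
  pose proof (Av N ltac:(unfold N; lia)) as A.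
  assert (HNp : (0 < INR N)%R) by (apply lt_0_INR; unfold N; lia).
  set (l := / RtoC (INR N) * Csum (fun j => ee (- (INR n * INR j / INR N)) * g ((0, y)%R + RtoC (INR j / INR N))) N) in A.
  assert (Bl : (Cmod l <= M)%R).
  { unfold l. rewrite Cmod_mult, <- RtoC_inv, Cmod_R, Rabs_pos_eq by (try lra; apply Rlt_le, Rinv_0_lt_compat; auto).
    apply Rle_trans with (/ INR N * (INR N * M))%R; [| right; field; lra].
    apply Rmult_le_compat_l; [apply Rlt_le, Rinv_0_lt_compat; auto |].
    eapply Rle_trans; [apply Cmod_Csum |]. rewrite <- Rsum_const. apply Rsum_le. intros j _.
    rewrite Cmod_mult, Cmod_ee, Rmult_1_l. apply HM. now apply uhp_shift. }
  (* Since N > n, the only index below N congruent to n is n itself; the aliased indices lie in a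
     tail of size at most eps. *)
  apply (Cser_tail _ _ N) in A.
  assert (EN : Csum (fun k => (if Z.eq_dec ((Z.of_nat k - Z.of_nat n) mod Z.of_nat N) 0 then 1 else 0) * (c k * RtoC r ^ k)) N = c n * RtoC r ^ n).
  { set (d := fun k => (if Z.eq_dec ((Z.of_nat k - Z.of_nat n) mod Z.of_nat N) 0 then 1 else 0) * (c k * RtoC r ^ k)).
    assert (Hd : forall k, (k < N)%nat -> k <> n -> d k = 0).
    { intros k Hk Hkn. unfold d. destruct (Z.eq_dec _ 0) as [E | E]; [| ring]. exfalso.
      apply Z.mod_divide in E; [| unfold N; lia]. destruct E as [t Et].
      assert (HnN : (n < N)%nat) by (unfold N; lia). clearbody N.
      assert (t = 0 \/ 1 <= t \/ t <= -1)%Z as [-> | [Ht | Ht]] by lia; nia. }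
    replace (Csum d N) with (Csum d (n + (1 + (N - n - 1)))) by (f_equal; unfold N; lia).
    rewrite !Csum_add.
    rewrite (Csum_ext d (fun _ => 0)) by (intros; apply Hd; unfold N in *; lia).
    rewrite (Csum_ext (fun k => d (n + (1 + k))%nat) (fun _ => 0)) by (intros; apply Hd; unfold N in *; lia).
    rewrite !Csum_const. cbn [Csum]. rewrite Nat.add_0_r. unfold d. rewrite Z.sub_diag, Z.mod_0_l by (unfold N; lia).
    destruct (Z.eq_dec 0 0); [ring | lia]. }
  rewrite EN in A.
  assert (Bt : (Cmod (l - c n * RtoC r ^ n) <= eps)%R).
  { apply (Cser_Cmod_le _ _ eps) in A; auto. intros m.
    apply Rle_trans with (Rsum (fun k => Cmod (c (N + k)%nat * RtoC r ^ (N + k))) m).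
    - apply Rsum_le. intros k _. rewrite Cmod_mult. pose proof (Cmod_ge_0 (c (N + k)%nat * RtoC r ^ (N + k))).
      destruct (Z.eq_dec _ 0); rewrite ?Cmod_1, ?Cmod_0; lra.
    - specialize (HLt (N + m)%nat). rewrite Rsum_add in HLt. apply Rabs_def2 in HN0. lra. }
  replace (Cmod (c n) * r ^ n)%R with (Cmod (c n * RtoC r ^ n)) by (rewrite Cmod_mult, Cmod_pow, Cmod_R, Rabs_pos_eq; lra).
  replace (c n * RtoC r ^ n) with (l + - (l - c n * RtoC r ^ n)) by ring.
  eapply Rle_trans; [apply Cmod_triangle |]. rewrite Cmod_opp. lra.
Qed.

(** The bound M holds at every height, so y may tend to 0, where the radius tends to 1. *)
Lemma QE_cauchy g c M : QE g c -> (0 <= M)%R ->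
  (forall tau, upper_half_plane tau -> (Cmod (g tau) <= M)%R) -> forall n, (Cmod (c n) <= M)%R.
Proof.
  intros H HM0 HM n. pose proof PI_RGT_0.
  assert (L : is_lim_seq (fun k => Cmod (c n) * exp (- (2 * PI * / INR (S k))) ^ n)%R (Cmod (c n) * 1)%R).
  { apply is_lim_seq_mult'; [apply is_lim_seq_const |].
    apply is_lim_seq_ext with (fun k => exp (- (2 * PI * INR n) * / INR (S k)))%R.
    - intros k. rewrite <- Rpower_pow by apply exp_pos. unfold Rpower. rewrite ln_exp. f_equal. ring.
    - rewrite <- exp_0. replace (Finite (exp 0)) with (Finite (exp (- (2 * PI * INR n) * 0))) by (f_equal; f_equal; ring).
      apply (is_lim_seq_continuous exp); [apply derivable_continuous_pt, derivable_pt_exp |].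
      apply is_lim_seq_mult'; [apply is_lim_seq_const |].
      apply (is_lim_seq_incr_1 (fun n => / INR n)%R). apply (is_lim_seq_inv _ p_infty); [apply is_lim_seq_INR | discriminate]. }
  rewrite Rmult_1_r in L.
  apply (is_lim_seq_le _ (fun _ => M) _ (Finite M)) in L; auto.
  - intros k. apply (QE_cauchy_approx g c M (/ INR (S k))); auto.
    apply Rinv_0_lt_compat. pose proof (INR_S_ge1 k). lra.
  - apply is_lim_seq_const.
Qed.

Lemma QE_unique g c d : QE g c -> QE g d -> forall n, c n = d n.
Proof.
  intros A B n. assert (H := QE_minus _ _ _ _ A B).
  assert (E : (Cmod (c n - d n) <= 0)%R).
  { apply (QE_cauchy _ _ 0%R H); [lra |]. intros tau _. replace (g tau - g tau) with (RtoC 0) by ring. rewrite Cmod_0. lra. }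
  assert (E0 : c n - d n = 0) by (apply Cmod_eq_0; pose proof (Cmod_ge_0 (c n - d n)); lra).
  apply Ceq_minus. exact E0.
Qed.

(** The sum over the translates by l / p annihilates the k-th term unless p divides k. *)
Lemma QE_trace g c p : (0 < p)%nat -> QE g c ->
  QE (fun t => Csum (fun l => g ((t + RtoC (INR l)) / RtoC (INR p))) p) (fun n => RtoC (INR p) * c (p * n)%nat).
Proof.
  intros Hp H tau Ht. assert (Hp0 : INR p <> 0%R) by (apply not_0_INR; lia).
  assert (Np : RtoC (INR p) <> 0) by (apply RtoC_neq0; auto).
  assert (Hpp : (0 < INR p)%R) by (apply lt_0_INR; lia).
  assert (A : Cser (fun k => Csum (fun l => c k * q ((tau + RtoC (INR l)) / RtoC (INR p)) ^ k) p)
     (Csum (fun l => g ((tau + RtoC (INR l)) / RtoC (INR p))) p)).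
  { apply (Cser_Csum (fun l k => c k * q ((tau + RtoC (INR l)) / RtoC (INR p)) ^ k)).
    intros l _. apply H. apply uhp_div; auto. now apply uhp_shift. }
  set (t0 := tau / RtoC (INR p)).
  assert (Ek : forall k, Csum (fun l => c k * q ((tau + RtoC (INR l)) / RtoC (INR p)) ^ k) p
     = (if Z.eq_dec (Z.of_nat k mod Z.of_nat p) 0 then RtoC (INR p) else 0) * (c k * q t0 ^ k)).
  { intros k. rewrite (Csum_ext _ (fun l => (c k * q t0 ^ k) * ee (IZR (Z.of_nat k) * INR l / INR p))).
    - rewrite Csum_scal, unity_sum by auto. ring.
    - intros l _. replace ((tau + RtoC (INR l)) / RtoC (INR p)) with (t0 + RtoC (INR l / INR p))
        by (unfold t0; rewrite RtoC_div by auto; field; auto).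
      rewrite q_plus, Cpow_mult_l, ee_pow, <- INR_IZR_INZ.
      replace (INR k * INR l / INR p)%R with (INR k * (INR l / INR p))%R by (field; auto). ring. }
  apply Cser_Clim in A. apply Cser_Clim.
  apply (Clim_subseq _ _ (fun M => (p * M)%nat) ltac:(intros; cbv beta; nia)) in A.
  eapply Clim_ext; [| exact A]. intros M. cbv beta. rewrite Csum_blocks. apply Csum_ext. intros b _.
  destruct p; [lia |]. rewrite Csum_head, Nat.add_0_r, Ek.
  rewrite Nat2Z.inj_mul, Z.mul_comm, Z.mod_mul by lia. destruct (Z.eq_dec 0 0); [| lia].
  rewrite (Csum_ext (fun r => Csum _ (S p)) (fun _ => 0)).
  - rewrite Csum_const, q_pow, (q_pow tau). replace (RtoC (INR (S p * b)) * t0) with (RtoC (INR b) * tau).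
    + ring.
    + unfold t0. rewrite mult_INR, RtoC_mult. field. auto.
  - intros r Hr. rewrite Ek. rewrite Nat2Z.inj_add, Nat2Z.inj_mul, Z.add_comm, Z.mul_comm, Z.mod_add, Z.mod_small by lia.
    destruct (Z.eq_dec _ 0); [lia | ring].
Qed.

Lemma QE_Vp g c p : (0 < p)%nat -> QE g c ->
  QE (fun t => g (RtoC (INR p) * t)) (fun n => if Nat.eq_dec (n mod p) 0 then c (n / p)%nat else 0).
Proof.
  intros Hp H tau Ht.
  assert (Ht' : upper_half_plane (RtoC (INR p) * tau)) by (apply uhp_scal; [apply lt_0_INR; lia | auto]).
  specialize (H _ Ht'). rewrite <- q_pow in H. apply (Cser_dilate _ _ p Hp) in H.
  eapply Cser_ext; [| exact H]. intros n. apply dilate_term; auto.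
Qed.

(** * Functions without poles at the cusps *)

Definition W (p : nat) (tau : C) : C := - (1 / (RtoC (INR p) * tau)).

(* Invariance under the matrices [[a, -1], [p, -k]], written in the variable s = p t - k. *)
Definition star_inv (p : nat) (g : C -> C) : Prop :=
  forall a k : Z, (a * k = Z.of_nat p - 1)%Z -> forall s : C, upper_half_plane s ->
    g ((RtoC (IZR a) - / s) / RtoC (INR p)) = g ((s + RtoC (IZR k)) / RtoC (INR p)).

Lemma q_shift_Z tau (n : Z) : q (tau + RtoC (IZR n)) = q tau.
Proof. rewrite q_plus, ee_Z. ring. Qed.

Lemma QE_periodic g c (n : Z) tau : QE g c -> upper_half_plane tau -> g (tau + RtoC (IZR n)) = g tau.
Proof.
  intros H Ht. pose proof (H _ (uhp_shift tau (IZR n) Ht)) as A. rewrite q_shift_Z in A.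
  apply (Cser_unique _ _ _ A (H tau Ht)).
Qed.

Lemma first_nonzero (c : nat -> C) : (exists n, c n <> 0) ->
  exists i, c i <> 0 /\ forall j, (j < i)%nat -> c j = 0.
Proof.
  intros [n Hn]. revert Hn. induction n as [n IH] using lt_wf_ind. intros Hn.
  destruct (classic (exists j, (j < n)%nat /\ c j <> 0)) as [[j [Hj Hc]] | N].
  - apply (IH j Hj Hc).
  - exists n. split; auto. intros j Hj. apply NNPP. intros E. apply N. exists j. auto.
Qed.

(** The product of the two lowest nonzero coefficients survives. This permits cancelling a function
    whose zeros are not known. *)
Lemma conv_domain c d : (forall n, conv c d n = 0) -> (forall n, c n = 0) \/ (forall n, d n = 0).
Proof.
  intros H. destruct (classic (exists n, c n <> 0)) as [Hc | Hc].
  2:{ left. intros n. apply NNPP. intros E. apply Hc. now exists n. }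
  destruct (classic (exists n, d n <> 0)) as [Hd | Hd].
  2:{ right. intros n. apply NNPP. intros E. apply Hd. now exists n. }
  exfalso. destruct (first_nonzero c Hc) as [i [Hi Hi0]]. destruct (first_nonzero d Hd) as [j [Hj Hj0]].
  specialize (H (i + j)%nat). unfold conv in H.
  replace (S (i + j)) with (i + (1 + j))%nat in H by lia. rewrite !Csum_add in H.
  rewrite (Csum_ext _ (fun _ => 0)) in H by (intros k Hk; rewrite Hi0 by auto; ring).
  rewrite (Csum_ext (fun k => c (i + (1 + k))%nat * _) (fun _ => 0)) in H.
  2:{ intros k Hk. rewrite (Hj0 (i + j - (i + (1 + k)))%nat) by lia. ring. }
  rewrite !Csum_const in H. cbn [Csum] in H. rewrite Nat.add_0_r in H.
  replace (i + j - i)%nat with j in H by lia.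
  apply (Cmult_neq_0 _ _ Hi Hj). etransitivity; [| exact H]. ring.
Qed.

Lemma uhp_nz tau : upper_half_plane tau -> tau <> 0.
Proof. intros H. apply Cmod_gt_0, Cmod_pos_Im. exact H. Qed.

Lemma Im_inv (s : C) : Im (/ s) = (- Im s / Cmod s ^ 2)%R.
Proof. rewrite Cmod2_alt. destruct s; simpl. reflexivity. Qed.

Lemma uhp_neg_inv s : upper_half_plane s -> upper_half_plane (- / s).
Proof.
  unfold upper_half_plane. intros H. pose proof (Cmod_pos_Im s H).
  change (Im (- / s)) with (- Im (/ s))%R. rewrite Im_inv.
  replace (- (- Im s / Cmod s ^ 2))%R with (Im s / Cmod s ^ 2)%R by (field; lra).
  apply Rdiv_lt_0_compat; auto. nra.
Qed.

Lemma W_neg_inv p tau : (0 < p)%nat -> upper_half_plane tau -> W p tau = - / (RtoC (INR p) * tau).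
Proof. intros. unfold W, Cdiv. ring. Qed.

Lemma uhp_W p tau : (0 < p)%nat -> upper_half_plane tau -> upper_half_plane (W p tau).
Proof.
  intros Hp Ht. rewrite W_neg_inv by auto. apply uhp_neg_inv, uhp_scal; auto. apply lt_0_INR; lia.
Qed.

Lemma W_invol p tau : (0 < p)%nat -> upper_half_plane tau -> W p (W p tau) = tau.
Proof.
  intros Hp Ht. unfold W. field. split; [now apply uhp_nz | apply RtoC_neq0, not_0_INR; lia].
Qed.

(** Conjugation by the Fricke involution turns the matrix of the pair (a, k) into that of (-k, -a),
    again with product p - 1. *)
Lemma star_inv_W p g : (0 < p)%nat -> star_inv p g -> star_inv p (fun t => g (W p t)).
Proof.
  intros Hp H a k Hak s Hs.
  assert (Np : RtoC (INR p) <> 0) by (apply RtoC_neq0, not_0_INR; lia).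
  assert (Hpp : (0 < INR p)%R) by (apply lt_0_INR; lia).
  assert (Ek : RtoC (IZR a) * RtoC (IZR k) = RtoC (INR p) - 1).
  { rewrite <- RtoC_mult, <- mult_IZR, Hak, minus_IZR, <- INR_IZR_INZ, RtoC_minus. reflexivity. }
  assert (Hsk : upper_half_plane (s + RtoC (IZR k))) by now apply uhp_shift.
  assert (Nsk : s + RtoC (IZR k) <> 0) by now apply uhp_nz.
  set (s' := RtoC (IZR a) - RtoC (INR p) / (s + RtoC (IZR k))).
  assert (Hs' : upper_half_plane s').
  { unfold s'. replace (RtoC (IZR a) - RtoC (INR p) / (s + RtoC (IZR k)))
      with (RtoC (INR p) * (- / (s + RtoC (IZR k))) + RtoC (IZR a)) by (field; auto).
    apply uhp_shift, uhp_scal, uhp_neg_inv; auto. }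
  assert (Ns : s <> 0) by now apply uhp_nz. assert (Ns' : s' <> 0) by now apply uhp_nz.
  assert (Es' : s' * (s + RtoC (IZR k)) = RtoC (IZR a) * s - 1).
  { unfold s'. replace ((RtoC (IZR a) - RtoC (INR p) / (s + RtoC (IZR k))) * (s + RtoC (IZR k)))
      with (RtoC (IZR a) * s + (RtoC (IZR a) * RtoC (IZR k)) - RtoC (INR p)) by (field; auto).
    rewrite Ek. ring. }
  assert (Nas : RtoC (IZR a) * s - 1 <> 0) by (rewrite <- Es'; apply Cmult_neq_0; auto).
  specialize (H (- k)%Z (- a)%Z ltac:(lia) s' Hs').
  rewrite !opp_IZR, !RtoC_opp in H.
  replace ((- RtoC (IZR k) - / s') / RtoC (INR p)) with (W p ((RtoC (IZR a) - / s) / RtoC (INR p))) in H.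
  - replace ((s' + - RtoC (IZR a)) / RtoC (INR p)) with (W p ((s + RtoC (IZR k)) / RtoC (INR p))) in H; auto.
    unfold W, s'. field. auto.
  - assert (Einv : / s' = (s + RtoC (IZR k)) / (RtoC (IZR a) * s - 1)) by (rewrite <- Es'; field; auto).
    rewrite Einv. unfold W.
    replace ((- RtoC (IZR k) - (s + RtoC (IZR k)) / (RtoC (IZR a) * s - 1)) / RtoC (INR p))
      with (- ((RtoC (IZR a) * RtoC (IZR k) + 1) * s) / (RtoC (IZR a) * s - 1) / RtoC (INR p)) by (field; auto).
    rewrite Ek. field. repeat split; auto.
Qed.

(** The equation a k = p - 1 is one between integers, not a congruence. It can be met in every
    nonzero residue class because for these p the divisors of p - 1, taken with both signs,
    represent all of them. *)
Lemma residues p (n : Z) : In p (2 :: 3 :: 5 :: 7 :: nil)%nat ->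
  (exists t, n = Z.of_nat p * t)%Z \/
  (exists a k t, a * k = Z.of_nat p - 1 /\ n = k + Z.of_nat p * t)%Z.
Proof.
  intros Hp. pose proof (Z.div_mod n (Z.of_nat p)) as D. pose proof (Z.mod_pos_bound n (Z.of_nat p)) as B.
  set (t := (n / Z.of_nat p)%Z) in *. set (r := (n mod Z.of_nat p)%Z) in *. clearbody t r.
  assert (L : forall a k d : Z, (a * k = Z.of_nat p - 1 -> r = k + Z.of_nat p * d -> n = Z.of_nat p * t + r ->
     exists a k t, a * k = Z.of_nat p - 1 /\ n = k + Z.of_nat p * t)%Z).
  { intros a k d H1 H2 H3. exists a, k, (t + d)%Z. split; auto. nia. }
  destruct Hp as [<- | [<- | [<- | [<- | []]]]]; specialize (D ltac:(lia)); specialize (B ltac:(lia)); cbn in B.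
  - assert (r = 0 \/ r = 1)%Z as [E | E] by lia; [left; exists t; lia |].
    right. apply (L 1 1 0)%Z; lia.
  - assert (r = 0 \/ r = 1 \/ r = 2)%Z as [E | [E | E]] by lia; [left; exists t; lia | |]; right;
      [apply (L 2 1 0)%Z | apply (L 1 2 0)%Z]; lia.
  - assert (r = 0 \/ r = 1 \/ r = 2 \/ r = 3 \/ r = 4)%Z as [E | [E | [E | [E | E]]]] by lia;
      [left; exists t; lia | | | |]; right;
      [apply (L 4 1 0)%Z | apply (L 2 2 0)%Z | apply (L (-2) (-2) 1)%Z | apply (L 1 4 0)%Z]; lia.
  - assert (r = 0 \/ r = 1 \/ r = 2 \/ r = 3 \/ r = 4 \/ r = 5 \/ r = 6)%Z as [E | [E | [E | [E | [E | [E | E]]]]]] by lia;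
      [left; exists t; lia | | | | | |]; right;
      [apply (L 6 1 0)%Z | apply (L 3 2 0)%Z | apply (L 2 3 0)%Z | apply (L (-2) (-3) 1)%Z | apply (L (-3) (-2) 1)%Z | apply (L 1 6 0)%Z]; lia.
Qed.

Lemma In_primes_pos p : In p (2 :: 3 :: 5 :: 7 :: nil)%nat -> (2 <= p <= 7)%nat.
Proof. simpl. lia. Qed.

(** With s = p tau - n and n the nearest integer, |Re s| <= 1/2 and Im s < 0.86 < sqrt 3 / 2 give
    |s|^2 <= 0.99, so the inversion of s raises the height by a fixed factor. The residue of n
    decides between the Fricke involution and a matrix of Gamma0(p). *)
Lemma reduction_step p F d : In p (2 :: 3 :: 5 :: 7 :: nil)%nat ->
  QE F d -> star_inv p F -> (forall t, upper_half_plane t -> F (W p t) = F t) ->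
  forall tau, upper_half_plane tau -> (INR p * Im tau < 0.86)%R ->
  exists t', upper_half_plane t' /\ F t' = F tau /\ (Im tau * / 0.99 <= Im t')%R.
Proof.
  intros Hp HF HS HW tau Ht Hy. pose proof (In_primes_pos p Hp) as Hp2.
  assert (Hpp : (2 <= INR p)%R) by (apply (le_INR 2); lia).
  assert (Np : RtoC (INR p) <> 0) by (apply RtoC_neq0; lra).
  unfold upper_half_plane in Ht.
  (* The integer nearest to p Re tau. *)
  set (n := up (INR p * Re tau - / 2)). destruct (archimed (INR p * Re tau - / 2)) as [A1 A2]. fold n in A1, A2.
  set (s := RtoC (INR p) * tau - RtoC (IZR n)).
  assert (Res : Re s = (INR p * Re tau - IZR n)%R) by (unfold s; destruct tau; simpl; ring).
  assert (Ims : Im s = (INR p * Im tau)%R) by (unfold s; destruct tau; simpl; ring).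
  assert (Hs : upper_half_plane s) by (unfold upper_half_plane; rewrite Ims; nra).
  assert (Ns : s <> 0) by now apply uhp_nz.
  assert (Hm : (Cmod s ^ 2 <= 0.99)%R).
  { rewrite Cmod2_alt, Ims, Res.
    assert (P1 : (-(/2) <= INR p * Re tau - IZR n <= / 2)%R) by lra.
    assert (P2 : (0 <= INR p * Im tau < 0.86)%R) by (split; nra).
    set (u := (INR p * Re tau - IZR n)%R) in *. set (v := (INR p * Im tau)%R) in *. nra. }
  assert (Hm0 : (0 < Cmod s ^ 2)%R) by (pose proof (Cmod_pos_Im s Hs); nra).
  assert (Hinv : (/ 0.99 <= / Cmod s ^ 2)%R) by (apply Rinv_le_contravar; lra).
  assert (Imn : Im (- / s) = (INR p * (Im tau * / Cmod s ^ 2))%R).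
  { change (Im (- / s)) with (- Im (/ s))%R. rewrite Im_inv, Ims. field. pose proof (Cmod_pos_Im s Hs). lra. }
  assert (Hb : (Im tau * / 0.99 <= Im tau * / Cmod s ^ 2)%R) by (apply Rmult_le_compat_l; lra).
  assert (Hb0 : (0 < Im tau * / 0.99)%R) by (apply Rmult_lt_0_compat; lra).
  destruct (residues p n Hp) as [[t Et] | [a [k [t [Hak Et]]]]].
  - exists (- / s). split; [now apply uhp_neg_inv |]. split.
    + replace (- / s) with (W p (s / RtoC (INR p))) by (unfold W; field; auto).
      assert (Hsp : upper_half_plane (s / RtoC (INR p))) by (apply uhp_div; [lra | auto]).
      rewrite HW by auto. rewrite <- (QE_periodic F d t _ HF Hsp). f_equal.
      unfold s. rewrite Et, mult_IZR, <- INR_IZR_INZ, RtoC_mult. field. auto.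
    + rewrite Imn. nra.
  - exists ((RtoC (IZR a) - / s) / RtoC (INR p)). split; [| split].
    + apply uhp_div; [lra |]. unfold Cminus. rewrite Cplus_comm. apply uhp_shift. now apply uhp_neg_inv.
    + rewrite (HS a k Hak s Hs).
      assert (Hsk : upper_half_plane ((s + RtoC (IZR k)) / RtoC (INR p))) by (apply uhp_div; [lra | now apply uhp_shift]).
      rewrite <- (QE_periodic F d t _ HF Hsk). f_equal.
      unfold s. rewrite Et, plus_IZR, mult_IZR, <- INR_IZR_INZ, RtoC_plus, RtoC_mult. field. auto.
    + unfold Cdiv. rewrite <- RtoC_inv, im_scal_r by lra.
      replace (Im (RtoC (IZR a) - / s)) with (Im (- / s)) by (destruct (/ s); simpl; ring).
      rewrite Imn. replace (INR p * (Im tau * / Cmod s ^ 2) * / INR p)%R with (Im tau * / Cmod s ^ 2)%R by (pose proof (Cmod_pos_Im s Hs); field; repeat split; lra).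
      lra.
Qed.

(** Each step multiplies the height by at least 1 / 0.99, so finitely many suffice; dividing by 7,
    the largest p, makes the final height uniform. *)
Lemma reduction p F d : In p (2 :: 3 :: 5 :: 7 :: nil)%nat ->
  QE F d -> star_inv p F -> (forall t, upper_half_plane t -> F (W p t) = F t) ->
  forall tau, upper_half_plane tau -> exists t', (0.86 / 7 <= Im t')%R /\ F t' = F tau.
Proof.
  intros Hp HF HS HW. pose proof (In_primes_pos p Hp) as Hp2.
  assert (Hpp : (2 <= INR p <= 7)%R).
  { split; [apply (le_INR 2) | replace 7%R with (INR 7) by (simpl; ring); apply le_INR]; lia. }
  assert (Ind : forall N tau, upper_half_plane tau -> (0.86 <= INR p * Im tau * (/ 0.99) ^ N)%R ->
     exists t', (0.86 / 7 <= Im t')%R /\ F t' = F tau).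
  { induction N; intros tau Ht HN.
    - exists tau. split; auto. unfold upper_half_plane in Ht. simpl in HN.
      assert (INR p * Im tau <= 7 * Im tau)%R by (apply Rmult_le_compat_r; lra). lra.
    - destruct (Rlt_le_dec (INR p * Im tau) 0.86) as [L | L].
      + destruct (reduction_step p F d Hp HF HS HW tau Ht L) as [t1 [H1 [E1 I1]]].
        destruct (IHN t1 H1) as [t2 [H2 E2]].
        * eapply Rle_trans; [exact HN |]. rewrite <- tech_pow_Rmult.
          assert (0 < (/ 0.99) ^ N)%R by (apply pow_lt; lra).
          replace (INR p * Im tau * (/ 0.99 * (/ 0.99) ^ N))%R with (INR p * (Im tau * / 0.99) * (/ 0.99) ^ N)%R by ring.
          apply Rmult_le_compat_r; [lra |]. apply Rmult_le_compat_l; lra.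
        * exists t2. split; auto. congruence.
      + exists tau. split; auto. unfold upper_half_plane in Ht.
        assert (INR p * Im tau <= 7 * Im tau)%R by (apply Rmult_le_compat_r; lra). lra. }
  intros tau Ht. unfold upper_half_plane in Ht.
  destruct (Pow_x_infinity (/ 0.99)) with (b := (0.86 / (INR p * Im tau))%R) as [N HN].
  { rewrite Rabs_pos_eq; lra. }
  apply (Ind N tau Ht). specialize (HN N (Nat.le_refl N)). unfold Rge in HN.
  rewrite Rabs_pos_eq in HN by (apply pow_le; lra).
  assert (Hq : (0 < INR p * Im tau)%R) by nra.
  assert (HN2 : (0.86 / (INR p * Im tau) <= (/ 0.99) ^ N)%R) by (destruct HN; lra).
  apply (Rmult_le_compat_l (INR p * Im tau)) in HN2; [| lra].
  replace (INR p * Im tau * (0.86 / (INR p * Im tau)))%R with 0.86%R in HN2 by (field; nra). lra.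
Qed.

(** For r < 1/2 the sum r + r^2 + ... is less than 1; it will be the contraction factor. *)
Lemma q_radius_bound : (exp (- (2 * PI * (0.86 / 7))) < / 2)%R.
Proof.
  pose proof PI2_3_2.
  apply Rle_lt_trans with (exp (- (6 * (0.86 / 7)))).
  - apply exp_le_compat. lra.
  - destruct (exp_neg_bounds (6 * (0.86 / 7)) ltac:(lra)) as [_ [_ B]]. lra.
Qed.

(** A bound M for F also bounds its coefficients; at a point of reduced height the series without
    constant term is then at most M r / (1 - r). Repetition drives the bound to 0, which replaces a
    maximum principle. *)
Lemma invariant_cusp_form_zero p F d : In p (2 :: 3 :: 5 :: 7 :: nil)%nat ->
  QE F d -> d 0%nat = 0 -> star_inv p F -> (forall t, upper_half_plane t -> F (W p t) = F t) ->
  forall tau, upper_half_plane tau -> F tau = 0.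
Proof.
  intros Hp HF Hd0 HS HW. set (y0 := (0.86 / 7)%R). set (r := exp (- (2 * PI * y0))).
  assert (Hr : (0 < r < / 2)%R) by (split; [apply exp_pos | apply q_radius_bound]).
  assert (Hred := reduction p F d Hp HF HS HW). fold y0 in Hred.
  assert (Hq : forall t, (y0 <= Im t)%R -> (Cmod (q t) <= r)%R).
  { intros t Ht. rewrite Cmod_q. apply exp_le_compat. pose proof PI_RGT_0. nra. }
  assert (Hy0 : forall t, (y0 <= Im t)%R -> upper_half_plane t) by (intros t Ht; unfold upper_half_plane, y0 in *; lra).
  (* A first finite bound: absolute convergence at height [y0] dominates F at every reduced point,
     hence everywhere. *)
  assert (B0 : exists B, (0 <= B)%R /\ forall t, upper_half_plane t -> (Cmod (F t) <= B)%R).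
  { assert (H0 : upper_half_plane (0, y0)%R) by (unfold upper_half_plane, y0; simpl; lra).
    pose proof (QE_abs F d _ HF H0) as E. rewrite q_imag in E. fold r in E.
    exists (Series (fun n => Cmod (d n * RtoC r ^ n))). split.
    - apply (Rsum_le_Series (fun n => Cmod (d n * RtoC r ^ n)) 0); auto. intros; apply Cmod_ge_0.
    - intros t Ht. destruct (Hred t Ht) as [t' [Ht' <-]].
      apply (Cser_Cmod_le (fun n => d n * q t' ^ n)); [| apply HF; auto].
      intros n. eapply Rle_trans; [| apply (Rsum_le_Series _ n); [intros; apply Cmod_ge_0 | exact E]].
      apply Rsum_le. intros k _. rewrite !Cmod_mult, !Cmod_pow, Cmod_R, Rabs_pos_eq by lra.
      apply Rmult_le_compat_l; [apply Cmod_ge_0 |]. apply pow_incr. split; [apply Cmod_ge_0 | auto]. }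
  assert (Contr : forall M, (0 <= M)%R -> (forall t, upper_half_plane t -> (Cmod (F t) <= M)%R) ->
     forall t, upper_half_plane t -> (Cmod (F t) <= M * (r / (1 - r)))%R).
  { intros M HM0 HM t Ht. pose proof (QE_cauchy F d M HF HM0 HM) as HC.
    destruct (Hred t Ht) as [t' [Ht' <-]].
    apply (Cser_Cmod_le (fun n => d n * q t' ^ n)); [| apply HF; auto].
    intros n.
    assert (G : forall m, (Rsum (fun k => Cmod (d k * q t' ^ k)) (S m) <= M * (r / (1 - r)) * (1 - r ^ m))%R).
    { induction m.
      - simpl. rewrite Hd0, Cmult_0_l, Cmod_0. lra.
      - cbn [Rsum] in *. rewrite (Cmod_mult (d (S m))), (Cmod_pow (q t') (S m)).
        assert (Cmod (d (S m)) * Cmod (q t') ^ S m <= M * r ^ S m)%R.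
        { apply Rmult_le_compat; auto; [apply Cmod_ge_0 | apply pow_le, Cmod_ge_0 |].
          apply pow_incr. split; [apply Cmod_ge_0 | auto]. }
        replace (M * (r / (1 - r)) * (1 - r ^ S m))%R with (M * (r / (1 - r)) * (1 - r ^ m) + M * r ^ S m)%R; [lra |].
        simpl. field. lra. }
    apply Rle_trans with (M * (r / (1 - r)) * (1 - r ^ n))%R.
    - eapply Rle_trans; [| apply G]. cbn [Rsum]. pose proof (Cmod_ge_0 (d n * q t' ^ n)). lra.
    - assert (0 <= M * (r / (1 - r)))%R by (apply Rmult_le_pos; [auto | apply Rle_mult_inv_pos; lra]).
      assert (0 < r ^ n)%R by (apply pow_lt; lra). nra. }
  destruct B0 as [B [HB0 HB]]. set (th := (r / (1 - r))%R).
  assert (Hth : (0 <= th < 1)%R).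
  { unfold th. split; [apply Rle_mult_inv_pos; lra | apply Rlt_div_l; lra]. }
  assert (It : forall k t, upper_half_plane t -> (Cmod (F t) <= B * th ^ k)%R).
  { induction k; intros t Ht.
    - simpl. rewrite Rmult_1_r. auto.
    - rewrite <- tech_pow_Rmult. replace (B * (th * th ^ k))%R with (B * th ^ k * th)%R by ring.
      apply Contr; auto. apply Rmult_le_pos; auto. apply pow_le; lra. }
  intros t Ht. apply Cmod_eq_0.
  assert (L : is_lim_seq (fun k => B * th ^ k)%R (B * 0)%R).
  { apply is_lim_seq_mult'; [apply is_lim_seq_const |]. apply is_lim_seq_geom. rewrite Rabs_pos_eq; lra. }
  rewrite Rmult_0_r in L.
  pose proof (is_lim_seq_le (fun _ => Cmod (F t)) _ (Cmod (F t)) (Finite 0) (fun k => It k t Ht) (is_lim_seq_const _) L) as Q.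
  simpl in Q. pose proof (Cmod_ge_0 (F t)). lra.
Qed.

(** The product of g with its Fricke image is invariant under the involution as well and has no
    constant term, so it vanishes. One of the two q-series is then zero, and either of them
    determines g. *)
Lemma liouville p g c b : In p (2 :: 3 :: 5 :: 7 :: nil)%nat ->
  QE g c -> QE (fun t => g (W p t)) b -> star_inv p g -> c 0%nat = 0 \/ b 0%nat = 0 ->
  forall tau, upper_half_plane tau -> g tau = 0.
Proof.
  intros Hp Hc Hb HS H0. pose proof (In_primes_pos p Hp) as Hp2.
  assert (HF := QE_mult _ _ _ _ Hc Hb).
  assert (Z : forall t, upper_half_plane t -> g t * g (W p t) = 0).
  { apply (invariant_cusp_form_zero p _ _ Hp HF).
    - unfold conv. cbn [Csum]. rewrite Nat.sub_diag. destruct H0 as [-> | ->]; ring.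
    - intros a k Hak s Hs. rewrite (HS a k Hak s Hs). f_equal.
      apply (star_inv_W p g ltac:(lia) HS a k Hak s Hs).
    - intros t Ht. rewrite W_invol by (auto; lia). ring. }
  assert (Zc : forall n, conv c b n = 0).
  { intros n. rewrite (QE_unique _ _ (fun n => 0 * ZC zone n) HF); [ring |].
    eapply QE_ext; [| apply (QE_const 0)]. intros t Ht. symmetry. now apply Z. }
  assert (Zero : forall (h : C -> C) e, QE h e -> (forall n, e n = 0) -> forall t, upper_half_plane t -> h t = 0).
  { intros h e He E t Ht. specialize (He t Ht).
    apply (Cser_unique _ _ _ He). eapply Cser_ext; [| apply Cser_0]. intros n. simpl. rewrite E. ring. }
  destruct (conv_domain c b Zc) as [E | E].
  - apply (Zero g c Hc E).
  - intros t Ht. rewrite <- (W_invol p t ltac:(lia) Ht).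
    apply (Zero _ b Hb E). apply uhp_W; auto. lia.
Qed.

(** * The Hauptmodul *)

Definition lam (p : nat) : nat := (24 / (p - 1))%nat.
Definition half_lam (p : nat) : nat := (12 / (p - 1))%nat.

Lemma lam_half_lam p : In p (2 :: 3 :: 5 :: 7 :: nil)%nat -> (lam p = 2 * half_lam p /\ lam p * (p - 1) = 24)%nat.
Proof. intros [<- | [<- | [<- | [<- | []]]]]; split; reflexivity. Qed.

(** Written with Euler products in q rather than with eta: invariance under integer translations and
    integral coefficients are then immediate, and [psi_eta] recovers the quotient of eta powers. *)
Definition psi (p : nat) (tau : C) : C := / q tau * (euler (q tau) / euler (q tau ^ p)) ^ lam p.
Definition phi (p : nat) (tau : C) : C := q tau * (euler (q tau ^ p) / euler (q tau)) ^ lam p.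

Definition etap (l : nat) (tau : C) : C := eta tau ^ l.

Lemma eta_nz tau : upper_half_plane tau -> eta tau <> 0.
Proof. intros H. apply Cmult_neq_0; [apply cexp_nz | apply euler_nz, Cmod_q_lt; auto]. Qed.

Lemma etap_nz l tau : upper_half_plane tau -> etap l tau <> 0.
Proof. intros H. apply Cpow_nz, eta_nz; auto. Qed.

Lemma Cmod_q_pow_lt tau p : (0 < p)%nat -> upper_half_plane tau -> (Cmod (q tau ^ p) < 1)%R.
Proof.
  intros Hp Ht. rewrite Cmod_pow. pose proof (Cmod_ge_0 (q tau)). pose proof (Cmod_q_lt tau Ht).
  apply pow_lt_1_compat; [lra | auto].
Qed.

Lemma psi_phi p tau : (0 < p)%nat -> upper_half_plane tau -> psi p tau * phi p tau = 1.
Proof.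
  intros Hp Ht. unfold psi, phi.
  pose proof (euler_nz _ (Cmod_q_lt tau Ht)). pose proof (euler_nz _ (Cmod_q_pow_lt tau p Hp Ht)).
  pose proof (q_nz tau).
  replace (euler (q tau ^ p) / euler (q tau)) with (/ (euler (q tau) / euler (q tau ^ p))) by (field; auto).
  rewrite Cpow_inv by (apply Cmult_neq_0; [auto | intros E; apply (Cmult_neq_0 _ _ C1_nz C1_nz); apply (f_equal (Cmult (euler (q tau ^ p)))) in E; rewrite Cinv_r, Cmult_0_r in E by auto; rewrite E; ring]).
  field. split; auto. apply Cpow_nz.
  intros E. assert (E2 : euler (q tau) = 0); [| auto].
  replace (euler (q tau)) with (euler (q tau) / euler (q tau ^ p) * euler (q tau ^ p)) by (field; auto).
  rewrite E. ring.
Qed.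

Lemma psi_nz p tau : (0 < p)%nat -> upper_half_plane tau -> psi p tau <> 0.
Proof.
  intros Hp Ht E. pose proof (psi_phi p tau Hp Ht) as H. rewrite E, Cmult_0_l in H. apply C1_nz. auto.
Qed.

Lemma phi_nz p tau : (0 < p)%nat -> upper_half_plane tau -> phi p tau <> 0.
Proof.
  intros Hp Ht E. pose proof (psi_phi p tau Hp Ht) as H. rewrite E, Cmult_0_r in H. apply C1_nz. auto.
Qed.

Lemma phi_inv p tau : (0 < p)%nat -> upper_half_plane tau -> phi p tau = / psi p tau.
Proof.
  intros Hp Ht. pose proof (psi_nz p tau Hp Ht). pose proof (psi_phi p tau Hp Ht) as H0.
  rewrite <- (Cmult_1_r (/ psi p tau)), <- H0. field. auto.
Qed.

Lemma Cpow_div (a b : C) n : b <> 0 -> (a / b) ^ n = a ^ n / b ^ n.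
Proof. intros H. unfold Cdiv. rewrite Cpow_mult_l, Cpow_inv by auto. reflexivity. Qed.

Lemma psi_eta p tau : In p (2 :: 3 :: 5 :: 7 :: nil)%nat -> upper_half_plane tau ->
  psi p tau = etap (lam p) tau / etap (lam p) (RtoC (INR p) * tau).
Proof.
  intros Hp Ht. destruct (lam_half_lam p Hp) as [_ L]. pose proof (In_primes_pos p Hp) as Hp2.
  unfold etap, eta. rewrite !Cpow_mult_l, !cexp_pow, <- q_pow.
  pose proof (euler_nz _ (Cmod_q_lt tau Ht)) as N1.
  pose proof (euler_nz _ (Cmod_q_pow_lt tau p ltac:(lia) Ht)) as N2.
  assert (E : / q tau = cexp (RtoC (INR (lam p)) * (PI * Ci * tau / 12)) / cexp (RtoC (INR (lam p)) * (PI * Ci * (RtoC (INR p) * tau) / 12))).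
  { unfold Cdiv at 1. rewrite <- cexp_opp, <- cexp_plus, q_cexp, <- cexp_opp. f_equal.
    assert (E24 : RtoC (INR (lam p)) * (RtoC (INR p) - 1) = 24).
    { rewrite <- RtoC_minus, <- RtoC_mult. f_equal. replace (INR p - 1)%R with (INR (p - 1)) by (rewrite minus_INR by lia; reflexivity).
      rewrite <- mult_INR, L. simpl. ring. }
    transitivity (- (24 * (PI * Ci * tau / 12))); [field | rewrite <- E24; field]. }
  unfold psi. rewrite Cpow_div by auto. rewrite E. field.
  repeat split; try apply cexp_nz; apply Cpow_nz; auto.
Qed.

Lemma etap_fricke l tau N : upper_half_plane tau -> (1 <= N)%nat ->
  etap (2 * l) (- / (RtoC (INR N) * tau)) * etap (2 * l) tau
  = RtoC (INR N) ^ l * (etap (2 * l) (- / tau) * etap (2 * l) (RtoC (INR N) * tau)).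
Proof.
  intros Ht HN. pose proof (eta_fricke tau N Ht HN) as E.
  replace (- (1) / (RtoC (INR N) * tau)) with (- / (RtoC (INR N) * tau)) in E by (unfold Cdiv; ring).
  replace (- (1) / tau) with (- / tau) in E by (unfold Cdiv; ring).
  unfold etap. rewrite <- !Cpow_mult_l, E, !Cpow_mult_l.
  replace (RtoC (sqrt (INR N)) ^ (2 * l)) with (RtoC (INR N) ^ l).
  - ring.
  - rewrite Cpow_mult_r. f_equal. rewrite <- RtoC_pow. f_equal. simpl. rewrite Rmult_1_r, sqrt_sqrt; auto. apply pos_INR.
Qed.

(** The number p^(lambda/2): 4096, 729, 125, 49. *)
Definition fricke_const (p : nat) : Z := (Z.of_nat p ^ Z.of_nat (half_lam p))%Z.

Lemma fricke_const_INR p : RtoC (IZR (fricke_const p)) = RtoC (INR p) ^ half_lam p.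
Proof.
  unfold fricke_const. rewrite <- RtoC_pow. f_equal. rewrite INR_IZR_INZ, pow_IZR. reflexivity.
Qed.

(** The quotient law of eta with N = p, raised to the power lambda, which turns sqrt p into
    p^(lambda/2). *)
Lemma psi_W p tau : In p (2 :: 3 :: 5 :: 7 :: nil)%nat -> upper_half_plane tau ->
  psi p (W p tau) = RtoC (IZR (fricke_const p)) * phi p tau.
Proof.
  intros Hp Ht. destruct (lam_half_lam p Hp) as [L _]. pose proof (In_primes_pos p Hp) as Hp2.
  assert (Np : RtoC (INR p) <> 0) by (apply RtoC_neq0, not_0_INR; lia).
  assert (Nt : tau <> 0) by now apply uhp_nz.
  assert (HW : upper_half_plane (W p tau)) by (apply uhp_W; auto; lia).
  rewrite (phi_inv p tau) by (auto; lia). rewrite (psi_eta p _ Hp HW), (psi_eta p tau Hp Ht), fricke_const_INR.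
  replace (RtoC (INR p) * W p tau) with (- / tau) by (unfold W; field; auto).
  rewrite W_neg_inv by (auto; lia). rewrite L.
  pose proof (etap_fricke (half_lam p) tau p Ht ltac:(lia)) as E.
  assert (Hpt : upper_half_plane (RtoC (INR p) * tau)) by (apply uhp_scal; auto; apply lt_0_INR; lia).
  pose proof (etap_nz (2 * half_lam p) tau Ht) as N1. pose proof (etap_nz (2 * half_lam p) _ Hpt) as N2.
  pose proof (etap_nz (2 * half_lam p) _ (uhp_neg_inv tau Ht)) as N3.
  replace (etap (2 * half_lam p) (- / (RtoC (INR p) * tau))) with
    (RtoC (INR p) ^ half_lam p * (etap (2 * half_lam p) (- / tau) * etap (2 * half_lam p) (RtoC (INR p) * tau)) / etap (2 * half_lam p) tau).
  - field. repeat split; auto.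
  - rewrite <- E. field. auto.
Qed.

Lemma psi_shift p tau (n : Z) : psi p (tau + RtoC (IZR n)) = psi p tau.
Proof. unfold psi. now rewrite q_shift_Z. Qed.

Lemma phi_shift p tau (n : Z) : phi p (tau + RtoC (IZR n)) = phi p tau.
Proof. unfold phi. now rewrite q_shift_Z. Qed.

(** * Invariance of psi under the matrices with rows (a, -1) and (p, -k) *)

Definition star_pair (p : nat) (a k : Z) : Prop :=
  forall s : C, upper_half_plane s ->
    psi p ((RtoC (IZR a) - / s) / RtoC (INR p)) = psi p ((s + RtoC (IZR k)) / RtoC (INR p)).

(** Replacing s by -1/s passes to the inverse matrix. *)
Lemma star_pair_swap p a k : star_pair p a k -> star_pair p k a.
Proof.
  intros H s Hs. pose proof (uhp_nz s Hs). specialize (H (- / s) (uhp_neg_inv s Hs)).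
  replace (RtoC (IZR a) - / - / s) with (s + RtoC (IZR a)) in H by (field; auto).
  replace (- / s + RtoC (IZR k)) with (RtoC (IZR k) - / s) in H by ring. auto.
Qed.

Lemma Cser_Cconj a l : Cser a l -> Cser (fun n => Cconj (a n)) (Cconj l).
Proof.
  rewrite !Cser_Re_Im. intros [A B]. split; auto.
  apply (is_series_opp (V := R_NormedModule)) in B. exact B.
Qed.

Lemma Cmult_conj a b : Cconj (a * b) = Cconj a * Cconj b.
Proof. destruct a, b. apply Ceq; simpl; ring. Qed.

Lemma euler_conj x : (Cmod x < 1)%R -> euler (Cconj x) = Cconj (euler x).
Proof.
  intros Hx. assert (Hx' : (Cmod (Cconj x) < 1)%R) by now rewrite Cmod_conj.
  apply (Cser_unique _ _ _ (psum_eul _ Hx')).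
  eapply Cser_ext; [| apply (Cser_Cconj _ _ (psum_eul x Hx))].
  intros n. cbv beta. rewrite Cmult_conj, Cpow_conj. f_equal. unfold ZC. apply Ceq; simpl; ring.
Qed.

(** Reflection in the imaginary axis. As psi has real coefficients, it conjugates the values of psi;
    this reverses both signs of a pair (a, k). *)
Definition refl (tau : C) : C := - Cconj tau.

Lemma uhp_refl tau : upper_half_plane tau -> upper_half_plane (refl tau).
Proof. unfold upper_half_plane, refl. destruct tau; simpl. lra. Qed.

Lemma q_refl tau : q (refl tau) = Cconj (q tau).
Proof.
  unfold q, refl. destruct tau as [x y]; simpl.
  replace (2 * PI * - x)%R with (- (2 * PI * x))%R by ring. rewrite cos_neg, sin_neg.
  replace (- - y)%R with y by ring.
  apply Ceq; simpl; ring.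
Qed.

Lemma psi_refl p tau : (0 < p)%nat -> upper_half_plane tau -> psi p (refl tau) = Cconj (psi p tau).
Proof.
  intros Hp Ht. unfold psi. pose proof (q_nz tau).
  pose proof (Cmod_q_lt tau Ht). pose proof (Cmod_q_pow_lt tau p Hp Ht).
  pose proof (euler_nz (q tau ^ p) ltac:(auto)).
  rewrite Cmult_conj, Cpow_conj, Cinv_conj, Cdiv_conj by auto.
  rewrite q_refl, <- Cpow_conj, !euler_conj by auto. reflexivity.
Qed.

Lemma star_pair_refl p a k : (0 < p)%nat -> star_pair p a k -> star_pair p (- a) (- k).
Proof.
  intros Hp H s Hs. pose proof (uhp_refl s Hs) as Hr. specialize (H (refl s) Hr).
  assert (Hpp : (0 < INR p)%R) by (apply lt_0_INR; lia).
  assert (Np : RtoC (INR p) <> 0) by (apply RtoC_neq0; lra).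
  assert (Ns := uhp_nz s Hs).
  assert (Er : forall x : R, Cconj (RtoC x) = RtoC x) by (intros; apply Ceq; simpl; ring).
  replace ((RtoC (IZR a) - / refl s) / RtoC (INR p)) with (refl ((RtoC (IZR (- a)) - / s) / RtoC (INR p))) in H.
  2:{ unfold refl. rewrite Cdiv_conj by auto. rewrite opp_IZR, RtoC_opp.
      replace (Cconj (- RtoC (IZR a) - / s)) with (- RtoC (IZR a) - Cconj (/ s)) by (apply Ceq; simpl; ring).
      rewrite Cinv_conj, Er by auto. field. split; auto.
      intros E. apply Ns. replace s with (Cconj (Cconj s)) by (destruct s; apply Ceq; simpl; ring). rewrite E. apply Ceq; simpl; ring. }
  replace ((refl s + RtoC (IZR k)) / RtoC (INR p)) with (refl ((s + RtoC (IZR (- k))) / RtoC (INR p))) in H.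
  2:{ unfold refl. rewrite Cdiv_conj by auto. rewrite opp_IZR, RtoC_opp, Er.
      replace (Cconj (s + - RtoC (IZR k))) with (Cconj s + - RtoC (IZR k)) by (destruct s; apply Ceq; simpl; ring).
      field. auto. }
  rewrite !psi_refl in H; auto.
  - apply (f_equal Cconj) in H.
    assert (Ec : forall z, Cconj (Cconj z) = z) by (intros [u v]; apply Ceq; simpl; ring).
    rewrite !Ec in H. exact H.
  - apply uhp_div; auto. now apply uhp_shift.
  - apply uhp_div; auto. unfold Cminus. rewrite Cplus_comm. now apply uhp_shift, uhp_neg_inv.
Qed.

(** For a = 1 the matrix is, up to a translation, the Fricke conjugate of a translation: the points
    [t] and [y] have images under [W] that differ by 1. *)
Lemma star_pair_1 p : In p (2 :: 3 :: 5 :: 7 :: nil)%nat -> star_pair p 1 (Z.of_nat p - 1).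
Proof.
  intros Hp s Hs. pose proof (In_primes_pos p Hp) as Hp2.
  assert (Hpp : (0 < INR p)%R) by (apply lt_0_INR; lia).
  assert (Np : RtoC (INR p) <> 0) by (apply RtoC_neq0; lra).
  assert (Ns := uhp_nz s Hs).
  set (y := (s - 1) / RtoC (INR p)).
  assert (Hs1 : upper_half_plane (s - 1)) by (unfold Cminus; rewrite <- RtoC_opp; now apply uhp_shift).
  assert (Hy : upper_half_plane y) by (apply uhp_div; auto).
  assert (Ns1 := uhp_nz _ Hs1).
  replace ((s + RtoC (IZR (Z.of_nat p - 1))) / RtoC (INR p)) with (y + RtoC (IZR 1)).
  2:{ unfold y. rewrite minus_IZR, <- INR_IZR_INZ, RtoC_minus. field. auto. }
  rewrite psi_shift.
  set (t := (RtoC 1 - / s) / RtoC (INR p)).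
  assert (Ht : upper_half_plane t).
  { apply uhp_div; auto. unfold Cminus. rewrite Cplus_comm. now apply uhp_shift, uhp_neg_inv. }
  assert (EW : W p t = W p y + RtoC (IZR (-1))).
  { unfold W, t, y. replace (RtoC (IZR (-1))) with (- (1)) by (apply Ceq; simpl; ring). field. repeat split; auto. }
  pose proof (psi_W p t Hp Ht) as E1. pose proof (psi_W p y Hp Hy) as E2.
  rewrite EW, psi_shift, E2 in E1.
  assert (Nc : RtoC (IZR (fricke_const p)) <> 0) by (rewrite fricke_const_INR; apply Cpow_nz; auto).
  assert (E3 : phi p y = phi p t).
  { replace (phi p y) with (/ RtoC (IZR (fricke_const p)) * (RtoC (IZR (fricke_const p)) * phi p y)) by (field; auto).
    rewrite E1. field. auto. }
  pose proof (psi_phi p y ltac:(lia) Hy) as P1. pose proof (psi_phi p t ltac:(lia) Ht) as P2.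
  pose proof (phi_nz p t ltac:(lia) Ht) as N. rewrite E3 in P1.
  replace (psi p t) with (psi p t * phi p t / phi p t) by (field; auto).
  replace (psi p y) with (psi p y * phi p t / phi p t) by (field; auto). rewrite P1, P2. reflexivity.
Qed.

(** ** The case of the elliptic elements *)

(* eta_fricke says that this multiplier does not change when tau is replaced by N tau. *)
Definition eta_mult (l : nat) (tau : C) : C := etap (2 * l) (- / tau) / (tau ^ l * etap (2 * l) tau).

Lemma eta_mult_nz l tau : upper_half_plane tau -> eta_mult l tau <> 0.
Proof.
  intros H E. pose proof (etap_nz (2 * l) _ (uhp_neg_inv tau H)) as N.
  pose proof (etap_nz (2 * l) tau H). pose proof (Cpow_nz tau l (uhp_nz tau H)).
  apply N. replace (etap (2 * l) (- / tau)) with (eta_mult l tau * (tau ^ l * etap (2 * l) tau)) by (unfold eta_mult; field; auto).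
  rewrite E. ring.
Qed.

Lemma eta_mult_S l tau : upper_half_plane tau -> etap (2 * l) (- / tau) = eta_mult l tau * tau ^ l * etap (2 * l) tau.
Proof.
  intros H. unfold eta_mult. field. split; [apply etap_nz; auto | apply Cpow_nz, uhp_nz; auto].
Qed.

Lemma eta_mult_scale l N tau : (1 <= N)%nat -> upper_half_plane tau -> eta_mult l (RtoC (INR N) * tau) = eta_mult l tau.
Proof.
  intros HN Ht. assert (HNp : (0 < INR N)%R) by (apply lt_0_INR; lia).
  assert (NN : RtoC (INR N) <> 0) by (apply RtoC_neq0; lra).
  pose proof (etap_fricke l tau N Ht HN) as E.
  pose proof (uhp_scal _ tau HNp Ht) as Ht1.
  pose proof (etap_nz (2 * l) tau Ht). pose proof (etap_nz (2 * l) _ Ht1). pose proof (uhp_nz tau Ht).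
  unfold eta_mult. rewrite Cpow_mult_l.
  replace (etap (2 * l) (- / (RtoC (INR N) * tau))) with
   (RtoC (INR N) ^ l * (etap (2 * l) (- / tau) * etap (2 * l) (RtoC (INR N) * tau)) / etap (2 * l) tau)
   by (rewrite <- E; field; auto).
  field. repeat split; auto; apply Cpow_nz; auto.
Qed.

Lemma eta_mult_scale' l N M s t : (1 <= N)%nat -> (1 <= M)%nat -> upper_half_plane s -> upper_half_plane t ->
  RtoC (INR N) * s = RtoC (INR M) * t -> eta_mult l s = eta_mult l t.
Proof. intros HN HM Hs Ht E. rewrite <- (eta_mult_scale l N s), E, eta_mult_scale; auto. Qed.

Lemma eta_mult_inv l tau : upper_half_plane tau -> eta_mult l (- / tau) * eta_mult l tau = (- (1)) ^ l.
Proof.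
  intros H. pose proof (uhp_nz tau H) as Nt. unfold eta_mult.
  replace (- / - / tau) with tau by (field; auto).
  replace ((- / tau) ^ l) with ((- (1)) ^ l / tau ^ l).
  2:{ rewrite <- Cpow_div by auto. f_equal. unfold Cdiv. ring. }
  assert (S2 : (- (1)) ^ l * (- (1)) ^ l = 1).
  { rewrite <- Cpow_mult_l. replace (- (1) * - (1)) with (RtoC 1) by ring. apply Cpow_1_l. }
  assert (N1 : (- (1)) ^ l <> 0) by (apply Cpow_nz; intros E; injection E; lra).
  transitivity (/ (- (1)) ^ l).
  - field. repeat split; auto using etap_nz, uhp_neg_inv; try (apply Cpow_nz; auto).
  - replace (/ (- (1)) ^ l) with ((- (1)) ^ l * (- (1)) ^ l * / (- (1)) ^ l) at 1 by (rewrite S2; ring). field. auto.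
Qed.

(** The factor e^(pi i l / 6) that eta^(2l) acquires under tau + 1. *)
Definition eps (l : nat) : C := cexp (PI * Ci / 12) ^ (2 * l).

Lemma eps_nz l : eps l <> 0.
Proof. apply Cpow_nz, cexp_nz. Qed.

Lemma etap_T l tau : etap (2 * l) (tau + 1) = eps l * etap (2 * l) tau.
Proof.
  unfold etap, eps, eta. rewrite <- Cpow_mult_l. f_equal.
  replace (q (tau + 1)) with (q tau) by (symmetry; apply (q_shift_Z tau 1)).
  rewrite Cmult_assoc, <- cexp_plus. f_equal. f_equal. field.
Qed.

Lemma etap_Tn l tau n : etap (2 * l) (tau + RtoC (INR n)) = eps l ^ n * etap (2 * l) tau.
Proof.
  induction n; [simpl; rewrite Cplus_0_r; ring |].
  rewrite S_INR, RtoC_plus, Cplus_assoc, etap_T, IHn. simpl. ring.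
Qed.

(** The cubic relation between S and T, expressed by multipliers: eta^(2l) at t / (t + 1) is
    computed once from -1/u and once from 1 - 1/(t + 1), where u + 1 = -1/t. *)
Lemma eta_mult_cocycle l t : upper_half_plane t ->
  eta_mult l (- ((t + 1) / t)) * eta_mult l t = (- (1)) ^ l * eps l ^ 3 * eta_mult l (t + 1).
Proof.
  intros Ht. assert (Ht1 : upper_half_plane (t + 1)) by now apply uhp_shift.
  assert (Nt := uhp_nz t Ht). assert (Nt1 := uhp_nz _ Ht1).
  set (u := - ((t + 1) / t)). assert (Eu : u + 1 = - / t) by (unfold u; field; auto).
  assert (Hu : upper_half_plane u).
  { replace u with (- / t + RtoC (-1)) by (rewrite <- Eu; ring). apply uhp_shift, uhp_neg_inv; auto. }
  assert (E1 : etap (2 * l) (- / u) = eps l * (eta_mult l (t + 1) * (t + 1) ^ l * (eps l * etap (2 * l) t))).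
  { replace (- / u) with (- / (t + 1) + 1) by (unfold u; field; auto).
    rewrite etap_T, eta_mult_S, etap_T by auto. reflexivity. }
  assert (E2 : eps l * etap (2 * l) u = eta_mult l t * t ^ l * etap (2 * l) t).
  { rewrite <- etap_T, Eu. apply eta_mult_S; auto. }
  assert (E3 : u ^ l = (- (1)) ^ l * ((t + 1) ^ l / t ^ l)).
  { rewrite <- Cpow_div, <- Cpow_mult_l by auto. f_equal. unfold u. ring. }
  assert (S2 : (- (1)) ^ l * (- (1)) ^ l = 1).
  { rewrite <- Cpow_mult_l. replace (- (1) * - (1)) with (RtoC 1) by ring. apply Cpow_1_l. }
  pose proof (eta_mult_S l u Hu) as E4. rewrite E1, E3 in E4.
  pose proof (etap_nz (2 * l) t Ht) as N1. pose proof (eps_nz l) as N2.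
  assert (N3 : t ^ l <> 0) by (apply Cpow_nz; auto). assert (N4 : (t + 1) ^ l <> 0) by (apply Cpow_nz; auto).
  assert (E5 : etap (2 * l) u = eta_mult l t * t ^ l * etap (2 * l) t / eps l) by (rewrite <- E2; field; auto).
  rewrite E5 in E4.
  assert (E6 : eta_mult l u * eta_mult l t * ((- (1)) ^ l * ((t + 1) ^ l * etap (2 * l) t / eps l)) =
     eps l * (eta_mult l (t + 1) * (t + 1) ^ l * (eps l * etap (2 * l) t))) by (rewrite E4; field; auto).
  transitivity ((- (1)) ^ l * ((- (1)) ^ l * (eta_mult l u * eta_mult l t))); [rewrite Cmult_assoc, S2; ring |].
  transitivity ((- (1)) ^ l * (eta_mult l u * eta_mult l t * ((- (1)) ^ l * ((t + 1) ^ l * etap (2 * l) t / eps l)) * eps l / ((t + 1) ^ l * etap (2 * l) t)));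
   [field; auto |].
  rewrite E6. field. auto.
Qed.

(** For p = 5 and p = 7 the matrix is elliptic and is not generated by translations and their Fricke
    conjugates, so here the multiplier of eta has to be followed along a word. *)
Lemma star_pair_2 p k : In p (2 :: 3 :: 5 :: 7 :: nil)%nat -> (p = 2 * k + 1)%nat -> star_pair p 2 (Z.of_nat k).
Proof.
  intros Hp Hk s Hs. pose proof (In_primes_pos p Hp) as Hp2. destruct (lam_half_lam p Hp) as [L _].
  assert (Hpp : (0 < INR p)%R) by (apply lt_0_INR; lia).
  assert (Np : RtoC (INR p) <> 0) by (apply RtoC_neq0; lra).
  assert (Ep : RtoC (INR p) = 2 * RtoC (INR k) + 1).
  { rewrite Hk, plus_INR, mult_INR, RtoC_plus, RtoC_mult. reflexivity. }
  rewrite <- INR_IZR_INZ. set (n := RtoC (INR k)) in *. set (P := RtoC (INR p)) in *.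
  assert (Ns := uhp_nz s Hs).
  assert (Hd : upper_half_plane (2 * s - 1)).
  { unfold Cminus. rewrite <- RtoC_opp. apply uhp_shift, uhp_scal; auto. lra. }
  assert (Nd := uhp_nz _ Hd).
  assert (Hsk : upper_half_plane (s + n)) by now apply uhp_shift. assert (Nsk := uhp_nz _ Hsk).
  set (y := (s + n) / P). assert (Hy : upper_half_plane y) by (apply uhp_div; auto). assert (Ny := uhp_nz _ Hy).
  set (x2 := (2 * s - 1) / (s + n)).
  assert (Ex2 : x2 = - / y + RtoC (INR 2)) by (unfold x2, y; change (INR 2) with 2%R; field_simplify_eq; [rewrite Ep; ring | auto]).
  assert (Hx2 : upper_half_plane x2) by (rewrite Ex2; apply uhp_shift, uhp_neg_inv; auto).
  assert (Nx2 := uhp_nz _ Hx2).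
  set (x1 := - (P * s / (2 * s - 1))).
  assert (Ex1 : x1 + n = - / x2).
  { unfold x1, x2. rewrite Ep. field. auto. }
  assert (Hx1 : upper_half_plane x1).
  { replace x1 with (- / x2 + RtoC (- INR k)) by (rewrite RtoC_opp, <- Ex1; fold n; ring). apply uhp_shift, uhp_neg_inv; auto. }
  assert (Nx1 := uhp_nz _ Hx1).
  set (t := (RtoC 2 - / s) / P).
  assert (Et : t = - / x1) by (unfold t, x1; field; auto).
  assert (Ht : upper_half_plane t) by (rewrite Et; apply uhp_neg_inv; auto).
  set (h := half_lam p) in *. set (E := etap (2 * h)). set (K := eta_mult h).
  (* The matrix is the word S T^-k S T^2 S; the multipliers met along it at t and at p t are matched by
     the cocycle relation and by the invariance of the multiplier under dilations. *)
  assert (C1 : E t = K x1 * x1 ^ h * E x1) by (rewrite Et; apply eta_mult_S; auto).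
  assert (C2 : eps h ^ k * E x1 = K x2 * x2 ^ h * E x2).
  { unfold E. rewrite <- etap_Tn. fold n. rewrite Ex1. apply eta_mult_S; auto. }
  assert (C3 : E x2 = eps h ^ 2 * (K y * y ^ h * E y)).
  { unfold E. rewrite Ex2, etap_Tn, eta_mult_S by auto. reflexivity. }
  assert (C4 : E (P * t) = eps h ^ 2 * (K s * s ^ h * E s)).
  { unfold E. replace (P * t) with (- / s + RtoC (INR 2)) by (unfold t; change (INR 2) with 2%R; field; auto).
    rewrite etap_Tn, eta_mult_S by auto. reflexivity. }
  assert (C5 : E (P * y) = eps h ^ k * E s).
  { unfold E. replace (P * y) with (s + n) by (unfold y; field; auto). apply etap_Tn. }
  assert (sg : (- (1)) ^ h * (- (1)) ^ h = 1).
  { rewrite <- Cpow_mult_l. replace (- (1) * - (1)) with (RtoC 1) by ring. apply Cpow_1_l. }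
  (* At t = 2 s - 1 the point -(t + 1)/t is 2 x1 / p, so dilations by 2 and p turn the multipliers
     of the cocycle relation into those at x1, 2 s - 1 and s. *)
  assert (D1 : K x1 * K (2 * s - 1) = (- (1)) ^ h * eps h ^ 3 * K s).
  { pose proof (eta_mult_cocycle h (2 * s - 1) Hd) as D. replace (2 * s - 1 + 1) with (2 * s) in D by ring.
    assert (F1 : eta_mult h (2 * s) = K s) by (apply (eta_mult_scale h 2 s); [lia | auto]).
    assert (Hu : upper_half_plane (- (2 * s / (2 * s - 1)))).
    { replace (- (2 * s / (2 * s - 1))) with (2 * (/ RtoC (INR p) * x1)) by (unfold x1; fold P; field; auto).
      rewrite <- RtoC_inv by lra. apply uhp_scal; [lra |]. apply uhp_scal; auto. apply Rinv_0_lt_compat; auto. }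
    assert (F2 : eta_mult h (- (2 * s / (2 * s - 1))) = K x1).
    { apply (eta_mult_scale' h p 2); auto; try lia. fold P. change (RtoC (INR 2)) with (RtoC 2). unfold x1. field. auto. }
    rewrite F1, F2 in D. exact D. }
  assert (D2 : K (- / x2) * K (2 * s - 1) = (- (1)) ^ h * eps h ^ 3 * K y).
  { set (v := (2 * s - 1) / P). assert (Hv : upper_half_plane v) by (apply uhp_div; auto). assert (Nv := uhp_nz _ Hv).
    pose proof (eta_mult_cocycle h v Hv) as D.
    assert (Ev : v + 1 = 2 * y) by (unfold v, y; field_simplify_eq; [rewrite Ep; ring | auto]).
    rewrite Ev in D.
    assert (F1 : eta_mult h (2 * y) = K y) by (apply (eta_mult_scale h 2 y); [lia | auto]).
    assert (F3 : eta_mult h v = K (2 * s - 1)).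
    { apply (eta_mult_scale' h p 1); auto; try lia. fold P. change (RtoC (INR 1)) with (RtoC 1). unfold v. field. auto. }
    assert (F2 : eta_mult h (- (2 * y / v)) = K (- / x2)).
    { assert (Hu : upper_half_plane (- / x2)) by (apply uhp_neg_inv; auto).
      replace (- (2 * y / v)) with (RtoC (INR 2) * (- / x2)).
      - apply eta_mult_scale; [lia | auto].
      - change (RtoC (INR 2)) with (RtoC 2). unfold y, v, x2. field. auto. }
    rewrite F1, F2, F3 in D. exact D. }
  assert (D3 : K (- / x2) * K x2 = (- (1)) ^ h) by (apply eta_mult_inv; auto).
  pose proof (eta_mult_nz h x1 Hx1) as N1. pose proof (eta_mult_nz h x2 Hx2) as N2. pose proof (eta_mult_nz h y Hy) as N3.
  pose proof (eta_mult_nz h s Hs) as N4. pose proof (eta_mult_nz h _ Hd) as N5. fold K in N1, N2, N3, N4, N5.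
  pose proof (eps_nz h) as Ne.
  assert (Nsg : (- (1)) ^ h <> 0) by (apply Cpow_nz; intros Q; injection Q; lra).
  (* Eliminates the multiplier at 2 s - 1, which occurs in both cocycle relations. *)
  assert (Main : (- (1)) ^ h * (K x1 * K x2 * K y) = K s).
  { assert (A1 : K y * K x2 * eps h ^ 3 = K (2 * s - 1)).
    { transitivity ((- (1)) ^ h * (((- (1)) ^ h * eps h ^ 3 * K y) * K x2)); [rewrite <- !Cmult_assoc, (Cmult_assoc ((- (1)) ^ h) ((- (1)) ^ h)), sg; ring |].
      rewrite <- D2. transitivity ((- (1)) ^ h * (K (- / x2) * K x2) * K (2 * s - 1)); [ring |]. rewrite D3, sg. ring. }
    assert (A2 : eps h ^ 3 * ((- (1)) ^ h * (K x1 * K x2 * K y)) = eps h ^ 3 * K s).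
    { transitivity ((- (1)) ^ h * (K x1 * (K y * K x2 * eps h ^ 3))); [ring |]. rewrite A1, D1.
      transitivity ((- (1)) ^ h * (- (1)) ^ h * (eps h ^ 3 * K s)); [ring |]. rewrite sg. ring. }
    assert (Ne3 : eps h ^ 3 <> 0) by (apply Cpow_nz; auto).
    transitivity (/ eps h ^ 3 * (eps h ^ 3 * ((- (1)) ^ h * (K x1 * K x2 * K y)))); [field; auto |].
    rewrite A2. field; auto. }
  assert (Prod : x1 ^ h * x2 ^ h * y ^ h = (- (1)) ^ h * s ^ h).
  { rewrite <- !Cpow_mult_l. f_equal. unfold x1, x2, y. field. auto. }
  rewrite (psi_eta p t Hp Ht), (psi_eta p y Hp Hy). rewrite L. fold h E P. rewrite C4, C5.
  assert (Nek : eps h ^ k <> 0) by (apply Cpow_nz; auto).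
  assert (Et' : E t = eps h ^ 2 * ((- (1)) ^ h * (K x1 * K x2 * K y)) * s ^ h * E y / eps h ^ k).
  { rewrite C1. replace (E x1) with (eps h ^ k * E x1 / eps h ^ k) by (field; auto).
    rewrite C2, C3.
    transitivity (eps h ^ 2 * (K x1 * K x2 * K y) * (x1 ^ h * x2 ^ h * y ^ h) * E y / eps h ^ k); [field; auto |].
    rewrite Prod. field; auto. }
  rewrite Et', Main. field.
  assert (Es : E s <> 0) by (apply etap_nz; auto). repeat split; auto; apply Cpow_nz; auto.
Qed.

(** Up to order and a common sign, every factorisation of p - 1 is 1 times p - 1 or 2 times (p -
    1)/2, the two cases settled above. *)
Lemma star_psi p : In p (2 :: 3 :: 5 :: 7 :: nil)%nat -> star_inv p (psi p).
Proof.
  intros Hp a k Hak. change (star_pair p a k).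
  pose proof (In_primes_pos p Hp) as Hp2.
  pose proof (star_pair_1 p Hp) as P1.
  assert (Hfull : forall a k, (star_pair p a k -> star_pair p k a /\ star_pair p (- a) (- k) /\ star_pair p (- k) (- a))%Z).
  { intros a' k' H. repeat split; [apply star_pair_swap | apply star_pair_refl; [lia |] | apply star_pair_swap, star_pair_refl; [lia |]]; auto. }
  destruct (Hfull _ _ P1) as [P2 [P3 P4]].
  assert (Hb : (1 <= Z.of_nat p - 1 <= 6)%Z) by lia.
  assert (Ha : (- 6 <= a <= 6)%Z).
  { assert (Hd : (Z.abs a * Z.abs k = Z.of_nat p - 1)%Z) by (rewrite <- Z.abs_mul, Hak; lia).
    assert (1 <= Z.abs k)%Z by (destruct (Z.eq_dec k 0) as [-> | ?]; lia).
    assert (Z.abs a * 1 <= Z.abs a * Z.abs k)%Z by (apply Z.mul_le_mono_nonneg_l; lia). lia. }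
  assert (Hcase : (a = -6 \/ a = -5 \/ a = -4 \/ a = -3 \/ a = -2 \/ a = -1 \/ a = 0 \/
     a = 1 \/ a = 2 \/ a = 3 \/ a = 4 \/ a = 5 \/ a = 6)%Z) by lia.
  assert (Q : forall n, (p = 2 * n + 1)%nat -> star_pair p 2 (Z.of_nat n)) by (intros; now apply star_pair_2).
  destruct Hp as [<- | [<- | [<- | [<- | []]]]].
  - repeat (destruct Hcase as [-> | Hcase]); try subst a; try (exfalso; lia);
      match goal with |- star_pair _ ?a' _ => first [replace k with 1%Z by lia | replace k with (-1)%Z by lia] end; auto.
  - repeat (destruct Hcase as [-> | Hcase]); try subst a; try (exfalso; lia);
      first [replace k with 1%Z by lia | replace k with (-1)%Z by lia | replace k with 2%Z by lia | replace k with (-2)%Z by lia]; auto.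
  - pose proof (Q 2%nat ltac:(lia)) as Q1. destruct (Hfull _ _ Q1) as [Q2 [Q3 Q4]].
    repeat (destruct Hcase as [-> | Hcase]); try subst a; try (exfalso; lia);
      first [replace k with 1%Z by lia | replace k with (-1)%Z by lia | replace k with 2%Z by lia
        | replace k with (-2)%Z by lia | replace k with 4%Z by lia | replace k with (-4)%Z by lia]; auto.
  - pose proof (Q 3%nat ltac:(lia)) as Q1. destruct (Hfull _ _ Q1) as [Q2 [Q3 Q4]].
    repeat (destruct Hcase as [-> | Hcase]); try subst a; try (exfalso; lia);
      first [replace k with 1%Z by lia | replace k with (-1)%Z by lia | replace k with 2%Z by lia
        | replace k with (-2)%Z by lia | replace k with 3%Z by lia | replace k with (-3)%Z by lia
        | replace k with 6%Z by lia | replace k with (-6)%Z by lia]; auto.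
Qed.

(** * Integral q-expansions of powers of the Hauptmodul *)

Definition QZ (g : C -> C) (z : nat -> Z) : Prop := QE g (ZC z).

Lemma QZ_mult g h y z : QZ g y -> QZ h z -> QZ (fun t => g t * h t) (zconv y z).
Proof.
  intros A B. eapply QE_ext_coef; [| apply (QE_mult _ _ _ _ A B)]. intros n. apply ZC_conv.
Qed.

Fixpoint zpow (z : nat -> Z) (n : nat) : nat -> Z :=
  match n with O => zone | S k => zconv z (zpow z k) end.

Lemma QZ_pow g z n : QZ g z -> QZ (fun t => g t ^ n) (zpow z n).
Proof.
  intros H. induction n; [apply QE_1 |].
  eapply QE_ext; [| apply (QZ_mult _ _ _ _ H IHn)]. intros; reflexivity.
Qed.

Definition zdil (p : nat) (z : nat -> Z) (n : nat) : Z := if Nat.eq_dec (n mod p) 0 then z (n / p)%nat else 0%Z.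

Lemma QZ_dil g z p : (0 < p)%nat -> psum (ZC z) g -> QZ (fun t => g (q t ^ p)) (zdil p z).
Proof.
  intros Hp H. eapply QE_ext_coef; [| apply (QE_psum _ _ (psum_dilate _ _ p Hp H))].
  intros n. unfold ZC, zdil. destruct (Nat.eq_dec (n mod p) 0); reflexivity.
Qed.

Definition qpsi_coef (p : nat) : nat -> Z := zpow (zconv eul (zdil p npart)) (lam p).

Lemma QZ_qpsi p : (0 < p)%nat -> QZ (fun t => q t * psi p t) (qpsi_coef p).
Proof.
  intros Hp. unfold qpsi_coef.
  eapply QE_ext; [| apply QZ_pow, (QZ_mult _ _ _ _ (QE_psum _ _ psum_eul) (QZ_dil _ _ p Hp psum_npart))].
  intros t Ht. unfold psi. pose proof (q_nz t). unfold Cdiv. field. auto.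
Qed.

Lemma QZ_qpsi_pow p m : (0 < p)%nat -> QZ (fun t => q t ^ m * psi p t ^ m) (zpow (qpsi_coef p) m).
Proof.
  intros Hp. eapply QE_ext; [| apply QZ_pow, (QZ_qpsi p Hp)]. intros t Ht. cbv beta. apply Cpow_mult_l.
Qed.

Lemma QZ_phi_ex p : (0 < p)%nat -> exists z, z 0%nat = 0%Z /\ QZ (phi p) z.
Proof.
  intros Hp.
  pose proof (QZ_pow _ _ (lam p) (QZ_mult _ _ _ _ (QZ_dil _ _ p Hp psum_eul) (QE_psum _ _ psum_npart))) as H.
  apply (QE_mulq _ _ 1) in H. eexists (fun n => match n with O => 0%Z | S k => _ end). split; [reflexivity |].
  eapply QE_ext; [| eapply QE_ext_coef; [| exact H]].
  - intros t Ht. unfold phi. rewrite Cpow_1_r. reflexivity.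
  - intros n. destruct n; simpl; [reflexivity |]. rewrite Nat.sub_0_r. reflexivity.
Qed.

Lemma zconv_0 a b : zconv a b 0 = (a 0%nat * b 0%nat)%Z.
Proof. unfold zconv. simpl. lia. Qed.

Lemma QZ_phi_pow p m : (0 < p)%nat -> exists z, z 0%nat = 0%Z /\ QZ (fun t => phi p t ^ S m) z.
Proof.
  intros Hp. destruct (QZ_phi_ex p Hp) as [z [Hz0 Hz]].
  exists (zpow z (S m)). split; [| apply QZ_pow; auto]. cbn [zpow]. rewrite zconv_0, Hz0. reflexivity.
Qed.

(** * Low coefficients by truncated exact computation *)

Definition agree (N : nat) (a b : nat -> Z) : Prop := forall n, (n < N)%nat -> a n = b n.

Lemma agree_conv N a b a' b' : agree N a a' -> agree N b b' -> agree N (zconv a b) (zconv a' b').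
Proof.
  intros A B n Hn. unfold zconv. apply Zsum_ext. intros k Hk. rewrite A, B by lia. reflexivity.
Qed.

Definition list_coef (l : list Z) (n : nat) : Z := nth n l 0%Z.
Definition lmul (N : nat) (a b : list Z) : list Z := map (zconv (list_coef a) (list_coef b)) (seq 0 N).

Lemma agree_lmul N a b : agree N (zconv (list_coef a) (list_coef b)) (list_coef (lmul N a b)).
Proof.
  intros n Hn. unfold lmul, list_coef at 3. rewrite (nth_indep _ _ (zconv (list_coef a) (list_coef b) 0)) by (rewrite length_map, length_seq; auto).
  rewrite map_nth, seq_nth by auto. reflexivity.
Qed.

Lemma agree_trans N a b c : agree N a b -> agree N b c -> agree N a c.
Proof. intros A B n Hn. rewrite A, B; auto. Qed.

Fixpoint lpow (N : nat) (a : list Z) (m : nat) : list Z :=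
  match m with O => (1 :: nil)%Z | S k => lmul N a (lpow N a k) end.

Lemma agree_lpow N z a m : agree N z (list_coef a) -> agree N (zpow z m) (list_coef (lpow N a m)).
Proof.
  intros H. induction m; cbn [zpow lpow].
  - intros n Hn. unfold zone, list_coef. destruct n as [| n]; [reflexivity |]. destruct n; reflexivity.
  - eapply agree_trans; [| apply agree_lmul]. apply agree_conv; auto.
Qed.

(* pentagonal number theorem, modulo x^7 *)
Definition eul_list : list Z := (1 :: -1 :: -1 :: 0 :: 0 :: 1 :: 0 :: nil)%Z.

Definition qpsi_list (p : nat) : list Z := lpow p eul_list (lam p).
Definition qpsi_pow_list (p m : nat) : list Z := lpow p (qpsi_list p) m.

Lemma eul_agree : agree 7 eul (list_coef eul_list).
Proof. intros n Hn. do 7 (destruct n as [| n]; [vm_compute; reflexivity |]). lia. Qed.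

(** Below x^p the factor in x^p contributes its constant term only, so the coefficients are those of
    a power of the Euler product and follow from finitely many of its terms. *)
Lemma qpsi_coef_agree p m : (0 < p <= 7)%nat -> agree p (zpow (qpsi_coef p) m) (list_coef (qpsi_pow_list p m)).
Proof.
  intros Hp. apply agree_lpow. unfold qpsi_coef. apply agree_lpow.
  apply agree_trans with (zconv eul zone).
  - apply agree_conv; [intros n Hn; reflexivity |]. intros n Hn. unfold zdil, zone.
    rewrite Nat.mod_small by lia. destruct (Nat.eq_dec n 0) as [-> |]; auto.
    rewrite Nat.Div0.div_0_l. reflexivity.
  - apply agree_trans with eul.
    + intros n Hn. unfold zconv. rewrite (Zsum_single _ _ n); [| lia |].
      * rewrite Nat.sub_diag. unfold zone. simpl. lia.
      * intros k Hk Hkn. unfold zone. destruct (Nat.eq_dec (n - k) 0); lia.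
    + intros n Hn. apply eul_agree. lia.
Qed.

(** Listed from the leading coefficient, of X^p, down to that of X; there is no constant term. *)
Definition kappa (p : nat) : list Z :=
  match p with
  | 2%nat => (1 :: 48 :: nil)%Z
  | 3%nat => (1 :: 36 :: 270 :: nil)%Z
  | 5%nat => (1 :: 30 :: 315 :: 1300 :: 1575 :: nil)%Z
  | 7%nat => (1 :: 28 :: 322 :: 1904 :: 5915 :: 8624 :: 4018 :: nil)%Z
  | _ => nil
  end.

Definition kap (p k : nat) : Z := nth k (kappa p) 0%Z.

(* The polynomial J with coefficients kappa is determined by J(psi) = q^-p + O(1). *)
Lemma kappa_polar p n : In p (2 :: 3 :: 5 :: 7 :: nil)%nat -> (n < p)%nat ->
  Zsum (fun k => (kap p k * (if le_lt_dec k n then zpow (qpsi_coef p) (p - k) (n - k) else 0))%Z) p = zone n.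
Proof.
  intros Hp Hn. pose proof (In_primes_pos p Hp).
  rewrite (Zsum_ext _ (fun k => (kap p k * (if le_lt_dec k n then list_coef (qpsi_pow_list p (p - k)) (n - k) else 0))%Z)).
  2:{ intros k Hk. f_equal. destruct (le_lt_dec k n); auto. apply qpsi_coef_agree; lia. }
  destruct Hp as [<- | [<- | [<- | [<- | []]]]];
    repeat (destruct n as [| n]; [vm_compute; reflexivity |]); lia.
Qed.

Definition psi_const_term (p m : nat) : Z := zpow (qpsi_coef p) m m.

Lemma psi_const_term_val p m : (0 < p <= 7)%nat -> (m < p)%nat -> psi_const_term p m = list_coef (qpsi_pow_list p m) m.
Proof. intros Hp Hm. apply qpsi_coef_agree; auto. Qed.

Lemma qpsi_coef_pow_0 p m : (0 < p <= 7)%nat -> zpow (qpsi_coef p) m 0 = 1%Z.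
Proof.
  intros Hp. induction m; [reflexivity |]. cbn [zpow]. rewrite zconv_0, IHm.
  assert (E : qpsi_coef p 0 = 1%Z); [| lia].
  unfold qpsi_coef. generalize (lam p). intros l. induction l; [reflexivity |]. cbn [zpow]. rewrite zconv_0, IHl, zconv_0.
  unfold zdil. rewrite Nat.Div0.mod_0_l, Nat.Div0.div_0_l. vm_compute. reflexivity.
Qed.

(** * The trace operator *)

(** The trace, p times the operator U. The division is postponed so that the traces of powers of psi
    and phi stay integral polynomials. *)
Definition V (p : nat) (g : C -> C) (tau : C) : C := Csum (fun l => g ((tau + RtoC (INR l)) / RtoC (INR p))) p.

Lemma V_ext p g h tau : (0 < p)%nat -> (forall t, upper_half_plane t -> g t = h t) -> upper_half_plane tau -> V p g tau = V p h tau.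
Proof.
  intros Hp E Ht. apply Csum_ext. intros l _. apply E. apply uhp_div; [apply lt_0_INR; lia | now apply uhp_shift].
Qed.

Lemma V_plus p g h tau : V p (fun t => g t + h t) tau = V p g tau + V p h tau.
Proof. apply Csum_plus. Qed.

Lemma V_scal p a g tau : V p (fun t => a * g t) tau = a * V p g tau.
Proof. apply (Csum_scal a (fun l => g ((tau + RtoC (INR l)) / RtoC (INR p)))). Qed.

(** The projection formula: on the l-th translate the factor h has argument tau + l, so by
    periodicity it leaves the sum. *)
Lemma V_mult_Vp p h g tau : (0 < p)%nat -> (forall t (n : Z), h (t + RtoC (IZR n)) = h t) ->
  V p (fun t => h (RtoC (INR p) * t) * g t) tau = h tau * V p g tau.
Proof.
  intros Hp Hh. unfold V. rewrite <- Csum_scal. apply Csum_ext. intros l _. f_equal.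
  rewrite <- (Hh tau (Z.of_nat l)), <- INR_IZR_INZ. f_equal. field. apply RtoC_neq0, not_0_INR. lia.
Qed.

(** A pole of order m <= p K has order at most K after the trace: the factor q^(p K) under the trace
    comes out as q^K. *)
Lemma QE_V_polar p K m g c : (0 < p)%nat -> (m <= p * K)%nat -> QE (fun t => q t ^ m * g t) c ->
  QE (fun t => q t ^ K * V p g t)
     (fun n => RtoC (INR p) * (if le_lt_dec (p * K - m) (p * n) then c (p * n - (p * K - m))%nat else 0)).
Proof.
  intros Hp HmK H. apply (QE_mulq _ _ (p * K - m)) in H.
  apply (QE_trace _ _ p Hp) in H. eapply QE_ext; [| exact H].
  intros t Ht. cbv beta.
  change (V p (fun t => q t ^ (p * K - m) * (q t ^ m * g t)) t = q t ^ K * V p g t).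
  rewrite <- (V_mult_Vp p (fun t => q t ^ K) g t Hp) by (intros; now rewrite q_shift_Z).
  apply V_ext; auto. intros s Hs. cbv beta. rewrite <- q_pow, <- Cpow_mult_r, Cmult_assoc, <- Cpow_add_r.
  f_equal. f_equal. lia.
Qed.

(** None of the exponents -m, ..., -1 is a multiple of p, so the trace has no pole. *)
Lemma QE_V_psi p m : (0 < m < p)%nat ->
  QE (V p (fun t => psi p t ^ m)) (fun n => RtoC (INR p) * ZC (zpow (qpsi_coef p) m) (p * n + m)%nat).
Proof.
  intros Hm. pose proof (QE_V_polar p 1 m _ _ ltac:(lia) ltac:(lia) (QZ_qpsi_pow p m ltac:(lia))) as H.
  apply (fun H => QE_divq _ _ 1 H) in H.
  - eapply QE_ext; [| eapply QE_ext_coef; [| exact H]].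
    + intros t Ht. cbv beta. pose proof (q_nz t). rewrite Cpow_1_r. field. auto.
    + intros n. cbv beta. destruct (le_lt_dec (p * 1 - m) (p * (1 + n))) as [L | L]; [| lia].
      f_equal. f_equal. lia.
  - intros n Hn. cbv beta. destruct (le_lt_dec (p * 1 - m) (p * n)); [nia | ring].
Qed.

Lemma QE_V_psi_p p : (0 < p)%nat ->
  QE (fun t => q t * V p (fun t => psi p t ^ p) t) (fun n => RtoC (INR p) * ZC (zpow (qpsi_coef p) p) (p * n)%nat).
Proof.
  intros Hp. pose proof (QE_V_polar p 1 p _ _ Hp ltac:(lia) (QZ_qpsi_pow p p Hp)) as H.
  eapply QE_ext; [| eapply QE_ext_coef; [| exact H]].
  - intros t Ht. cbv beta. now rewrite Cpow_1_r.
  - intros n. cbv beta. destruct (le_lt_dec (p * 1 - p) (p * n)) as [L | L]; [| lia]. f_equal. f_equal. lia.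
Qed.

Definition fricke_phi (p : nat) (t : C) : C := RtoC (IZR (fricke_const p)) * phi p t.

(* The sum of the m-th powers of the p + 1 conjugates of psi(t/p) over the full modular group. *)
Definition tot (p m : nat) (t : C) : C := fricke_phi p t ^ m + V p (fun s => psi p s ^ m) t.

Lemma QE_Y_pow p m : (0 < p)%nat -> exists c : nat -> C, c 0%nat = 0 /\ QE (fun t => fricke_phi p t ^ S m) c.
Proof.
  intros Hp. destruct (QZ_phi_pow p m Hp) as [z [Hz0 Hz]].
  exists (fun n => RtoC (IZR (fricke_const p)) ^ S m * ZC z n). split.
  - unfold ZC. rewrite Hz0. ring.
  - eapply QE_ext; [| apply (QE_scal _ _ _ Hz)]. intros t Ht. unfold fricke_phi. now rewrite Cpow_mult_l.
Qed.

(** The inversion sends the translate l to the l' with l l' = -1 modulo p. *)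
Lemma psi_S p (l l' : nat) (a k : Z) t : In p (2 :: 3 :: 5 :: 7 :: nil)%nat -> upper_half_plane t ->
  (a * k = Z.of_nat p - 1)%Z -> (exists d, Z.of_nat l = a + Z.of_nat p * d)%Z -> (exists d, Z.of_nat l' = k + Z.of_nat p * d)%Z ->
  psi p ((- / t + RtoC (INR l)) / RtoC (INR p)) = psi p ((t + RtoC (INR l')) / RtoC (INR p)).
Proof.
  intros Hp Ht Hak [d Hd] [d' Hd']. pose proof (In_primes_pos p Hp).
  assert (Np : RtoC (INR p) <> 0) by (apply RtoC_neq0, not_0_INR; lia).
  pose proof (star_psi p Hp a k Hak t Ht) as S. pose proof (uhp_nz t Ht) as Nt.
  replace ((- / t + RtoC (INR l)) / RtoC (INR p)) with ((RtoC (IZR a) - / t) / RtoC (INR p) + RtoC (IZR d)).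
  - replace ((t + RtoC (INR l')) / RtoC (INR p)) with ((t + RtoC (IZR k)) / RtoC (INR p) + RtoC (IZR d')).
    + rewrite !psi_shift. exact S.
    + rewrite (INR_IZR_INZ l'), Hd', plus_IZR, mult_IZR, <- INR_IZR_INZ, RtoC_plus, RtoC_mult. field. auto.
  - rewrite (INR_IZR_INZ l), Hd, plus_IZR, mult_IZR, <- INR_IZR_INZ, RtoC_plus, RtoC_mult. field. auto.
Qed.

(** The inversion exchanges [fricke_phi] with the translate l = 0 and permutes the other translates,
    so the sum over all p + 1 conjugates is unchanged. *)
Lemma tot_S p m t : In p (2 :: 3 :: 5 :: 7 :: nil)%nat -> upper_half_plane t -> tot p m (- / t) = tot p m t.
Proof.
  intros Hp Ht. pose proof (In_primes_pos p Hp) as Hp2. pose proof (uhp_nz t Ht) as Nt.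
  assert (Np : RtoC (INR p) <> 0) by (apply RtoC_neq0, not_0_INR; lia).
  assert (E0 : fricke_phi p (- / t) = psi p ((t + RtoC (INR 0)) / RtoC (INR p))).
  { unfold fricke_phi. rewrite <- psi_W by (auto using uhp_neg_inv). f_equal. unfold W. simpl (INR 0). field. auto. }
  assert (E1 : psi p ((- / t + RtoC (INR 0)) / RtoC (INR p)) = fricke_phi p t).
  { unfold fricke_phi. rewrite <- psi_W by auto. f_equal. unfold W. simpl (INR 0). field. auto. }
  unfold tot, V.
  pose proof (fun l l' a k => psi_S p l l' a k t Hp Ht) as PS.
  destruct Hp as [<- | [<- | [<- | [<- | []]]]]; cbn [Csum]; rewrite E0, E1.
  - rewrite (PS 1%nat 1%nat 1%Z 1%Z) by (try reflexivity; exists 0%Z; reflexivity). ring.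
  - rewrite (PS 1%nat 2%nat 1%Z 2%Z) by (try reflexivity; exists 0%Z; reflexivity).
    rewrite (PS 2%nat 1%nat 2%Z 1%Z) by (try reflexivity; exists 0%Z; reflexivity). ring.
  - rewrite (PS 1%nat 4%nat 1%Z 4%Z) by (try reflexivity; exists 0%Z; reflexivity).
    rewrite (PS 2%nat 2%nat 2%Z 2%Z) by (try reflexivity; exists 0%Z; reflexivity).
    rewrite (PS 3%nat 3%nat (-2)%Z (-2)%Z) by (try reflexivity; exists 1%Z; reflexivity).
    rewrite (PS 4%nat 1%nat 4%Z 1%Z) by (try reflexivity; exists 0%Z; reflexivity). ring.
  - rewrite (PS 1%nat 6%nat 1%Z 6%Z) by (try reflexivity; exists 0%Z; reflexivity).
    rewrite (PS 2%nat 3%nat 2%Z 3%Z) by (try reflexivity; exists 0%Z; reflexivity).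
    rewrite (PS 3%nat 2%nat 3%Z 2%Z) by (try reflexivity; exists 0%Z; reflexivity).
    rewrite (PS 4%nat 5%nat (-3)%Z (-2)%Z) by (try reflexivity; exists 1%Z; reflexivity).
    rewrite (PS 5%nat 4%nat (-2)%Z (-3)%Z) by (try reflexivity; exists 1%Z; reflexivity).
    rewrite (PS 6%nat 1%nat 6%Z 1%Z) by (try reflexivity; exists 0%Z; reflexivity). ring.
Qed.

Lemma V_shift1 p g t : (0 < p)%nat -> (forall s (n : Z), g (s + RtoC (IZR n)) = g s) -> V p g (t + 1) = V p g t.
Proof.
  intros Hp Hg. assert (Np : RtoC (INR p) <> 0) by (apply RtoC_neq0, not_0_INR; lia).
  destruct p as [| n]; [lia |]. unfold V.
  rewrite (Csum_head (fun l => g ((t + RtoC (INR l)) / RtoC (INR (S n))))). cbn [Csum].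
  rewrite (Csum_ext (fun k => g ((t + RtoC (INR (S k))) / RtoC (INR (S n)))) (fun k => g ((t + 1 + RtoC (INR k)) / RtoC (INR (S n))))).
  2:{ intros k _. f_equal. f_equal. rewrite S_INR, RtoC_plus. ring. }
  rewrite <- (Hg ((t + RtoC (INR 0)) / RtoC (INR (S n))) 1%Z).
  replace ((t + RtoC (INR 0)) / RtoC (INR (S n)) + RtoC (IZR 1)) with ((t + 1 + RtoC (INR n)) / RtoC (INR (S n))).
  - ring.
  - rewrite S_INR, RtoC_plus in *. simpl (INR 0). field. auto.
Qed.

Lemma tot_T p m t (n : Z) : (0 < p)%nat -> tot p m (t + RtoC (IZR n)) = tot p m t.
Proof.
  intros Hp.
  assert (T1 : forall s, tot p m (s + 1) = tot p m s).
  { intros s. unfold tot, fricke_phi. rewrite V_shift1 by (auto; intros; now rewrite psi_shift).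
    now rewrite (phi_shift p s 1). }
  assert (Tn : forall k s, tot p m (s + RtoC (INR k)) = tot p m s).
  { induction k; intros s; [simpl; now rewrite Cplus_0_r |].
    rewrite S_INR, RtoC_plus, Cplus_assoc, T1. apply IHk. }
  destruct (Z_le_gt_dec 0 n) as [H | H].
  - rewrite <- (Z2Nat.id n H), <- INR_IZR_INZ. apply Tn.
  - rewrite <- (Tn (Z.to_nat (- n))). f_equal. rewrite INR_IZR_INZ, Z2Nat.id, opp_IZR, RtoC_opp by lia. ring.
Qed.

(** In the variable p t the matrices of [star_inv] become the inversion combined with integer
    translations. *)
Lemma tot_star p m : In p (2 :: 3 :: 5 :: 7 :: nil)%nat -> star_inv p (fun t => tot p m (RtoC (INR p) * t)).
Proof.
  intros Hp a k _ s Hs. pose proof (In_primes_pos p Hp).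
  assert (Np : RtoC (INR p) <> 0) by (apply RtoC_neq0, not_0_INR; lia). pose proof (uhp_nz s Hs).
  replace (RtoC (INR p) * ((RtoC (IZR a) - / s) / RtoC (INR p))) with (- / s + RtoC (IZR a)) by (field; auto).
  replace (RtoC (INR p) * ((s + RtoC (IZR k)) / RtoC (INR p))) with (s + RtoC (IZR k)) by (field; auto).
  rewrite !tot_T by lia. apply tot_S; auto.
Qed.

Lemma star_inv_minus p g h : star_inv p g -> star_inv p h -> star_inv p (fun t => g t - h t).
Proof. intros A B a k E s Hs. rewrite (A a k E s Hs), (B a k E s Hs). reflexivity. Qed.

Lemma star_inv_const p c : star_inv p (fun _ => c).
Proof. intros a k E s Hs. reflexivity. Qed.

Lemma tot_pW p m t : In p (2 :: 3 :: 5 :: 7 :: nil)%nat -> upper_half_plane t ->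
  tot p m (RtoC (INR p) * W p t) = tot p m t.
Proof.
  intros Hp Ht. pose proof (In_primes_pos p Hp). pose proof (uhp_nz t Ht).
  assert (Np : RtoC (INR p) <> 0) by (apply RtoC_neq0, not_0_INR; lia).
  replace (RtoC (INR p) * W p t) with (- / t) by (unfold W; field; auto). apply tot_S; auto.
Qed.

(** For 0 < m < p the total has no pole and is invariant under the full modular group. Taken at p s
    it falls under the vanishing theorem at level p, hence it equals its constant term, p times that
    of psi^m. *)
Lemma trace_psi_const p m t : In p (2 :: 3 :: 5 :: 7 :: nil)%nat -> (0 < m < p)%nat -> upper_half_plane t ->
  V p (fun s => psi p s ^ m) t = RtoC (INR p) * RtoC (IZR (psi_const_term p m)) - fricke_phi p t ^ m.
Proof.
  intros Hp Hm Ht. pose proof (In_primes_pos p Hp) as Hp2.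
  set (K := RtoC (INR p) * RtoC (IZR (psi_const_term p m))).
  destruct m as [| m']; [lia |]. destruct (QE_Y_pow p m' ltac:(lia)) as [c [Hc0 Hc]].
  pose proof (QE_minus _ _ _ _ (QE_plus _ _ _ _ Hc (QE_V_psi p (S m') Hm)) (QE_const K)) as H.
  set (d := fun n => c n + RtoC (INR p) * ZC (zpow (qpsi_coef p) (S m')) (p * n + S m')%nat - K * ZC zone n) in *.
  assert (Hd0 : d 0%nat = 0).
  { unfold d. rewrite Hc0, Nat.mul_0_r, Nat.add_0_l. unfold K, psi_const_term, ZC, zone. simpl. ring. }
  assert (Hpp : (0 < INR p)%R) by (apply lt_0_INR; lia).
  assert (Z : forall s, upper_half_plane s -> tot p (S m') (RtoC (INR p) * s) - K = 0).
  { apply (liouville p (fun s => tot p (S m') (RtoC (INR p) * s) - K)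
      (fun n => if Nat.eq_dec (n mod p) 0 then d (n / p)%nat else 0) d); auto.
    - apply (QE_Vp (fun s => tot p (S m') s - K) d p ltac:(lia)). exact H.
    - eapply QE_ext; [| exact H]. intros s Hs. cbv beta. rewrite tot_pW by auto. reflexivity.
    - apply star_inv_minus; [apply tot_star; auto | apply star_inv_const]. }
  specialize (Z (t / RtoC (INR p)) (uhp_div _ _ Hpp Ht)).
  replace (RtoC (INR p) * (t / RtoC (INR p))) with t in Z by (field; apply RtoC_neq0; lra).
  unfold tot in Z. transitivity (fricke_phi p t ^ S m' + V p (fun s => psi p s ^ S m') t - K + K - fricke_phi p t ^ S m'); [ring |].
  rewrite Z. ring.
Qed.

(** * The modular equation *)

Definition has_QE (g : C -> C) : Prop := exists c, QE g c.

Lemma has_QE_plus g h : has_QE g -> has_QE h -> has_QE (fun t => g t + h t).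
Proof. intros [c Hc] [d Hd]. eexists. apply (QE_plus _ _ _ _ Hc Hd). Qed.
Lemma has_QE_minus g h : has_QE g -> has_QE h -> has_QE (fun t => g t - h t).
Proof. intros [c Hc] [d Hd]. eexists. apply (QE_minus _ _ _ _ Hc Hd). Qed.
Lemma has_QE_mult g h : has_QE g -> has_QE h -> has_QE (fun t => g t * h t).
Proof. intros [c Hc] [d Hd]. eexists. apply (QE_mult _ _ _ _ Hc Hd). Qed.
Lemma has_QE_const a : has_QE (fun _ => a).
Proof. eexists. apply QE_const. Qed.
Lemma has_QE_ext g h : (forall t, upper_half_plane t -> g t = h t) -> has_QE g -> has_QE h.
Proof. intros E [c Hc]. exists c. apply (QE_ext _ _ _ E Hc). Qed.
Lemma has_QE_pow g n : has_QE g -> has_QE (fun t => g t ^ n).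
Proof.
  intros H. induction n; [apply (has_QE_const 1) |].
  apply (has_QE_ext (fun t => g t * g t ^ n)); [intros; reflexivity | apply has_QE_mult; auto].
Qed.
Lemma has_QE_Csum (f : nat -> C -> C) N : (forall k, (k < N)%nat -> has_QE (f k)) -> has_QE (fun t => Csum (fun k => f k t) N).
Proof.
  induction N; intros H; cbn [Csum]; [apply has_QE_const |].
  apply has_QE_plus; [apply IHN; intros; apply H; lia | apply H; lia].
Qed.
Lemma has_QE_Vp g p : (0 < p)%nat -> has_QE g -> has_QE (fun t => g (RtoC (INR p) * t)).
Proof. intros Hp [c Hc]. eexists. apply (QE_Vp _ _ p Hp Hc). Qed.
Lemma has_QE_q : has_QE q.
Proof.
  eexists. eapply QE_ext; [| apply (QE_mulq _ _ 1 QE_1)]. intros; simpl; ring.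
Qed.
Lemma has_QE_phi p : (0 < p)%nat -> has_QE (phi p).
Proof. intros Hp. destruct (QZ_phi_ex p Hp) as [z [_ Hz]]. eexists; exact Hz. Qed.
Lemma has_QE_Y p : (0 < p)%nat -> has_QE (fricke_phi p).
Proof. intros Hp. apply has_QE_mult; [apply has_QE_const | apply has_QE_phi; auto]. Qed.
Lemma has_QE_qpsi p : (0 < p)%nat -> has_QE (fun t => q t * psi p t).
Proof. intros Hp. eexists. apply (QZ_qpsi p Hp). Qed.

Lemma has_QE_domain g h : has_QE g -> has_QE h -> (forall t, upper_half_plane t -> g t * h t = 0) ->
  (forall t, upper_half_plane t -> g t = 0) \/ (forall t, upper_half_plane t -> h t = 0).
Proof.
  intros [c Hc] [d Hd] H.
  assert (Zc : forall n, conv c d n = 0).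
  { intros n. rewrite (QE_unique _ _ (fun n => 0 * ZC zone n) (QE_mult _ _ _ _ Hc Hd)); [ring |].
    eapply QE_ext; [| apply (QE_const 0)]. intros t Ht. symmetry. now apply H. }
  assert (Zero : forall (h : C -> C) e, QE h e -> (forall n, e n = 0) -> forall t, upper_half_plane t -> h t = 0).
  { intros k e He E t Ht. specialize (He t Ht).
    apply (Cser_unique _ _ _ He). eapply Cser_ext; [| apply Cser_0]. intros n. simpl. rewrite E. ring. }
  destruct (conv_domain c d Zc) as [E | E]; [left | right]; eapply Zero; eauto.
Qed.

Lemma QE_Csum (f : nat -> C -> C) (c : nat -> nat -> C) N : (forall k, (k < N)%nat -> QE (f k) (c k)) ->
  QE (fun t => Csum (fun k => f k t) N) (fun n => Csum (fun k => c k n) N).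
Proof.
  induction N; intros H; cbn [Csum].
  - eapply QE_ext_coef; [| apply (QE_const 0)]. intros n; simpl; ring.
  - apply QE_plus; [apply IHN; intros; apply H; lia | apply H; lia].
Qed.

Definition kappaC (p k : nat) : C := RtoC (IZR (kap p k)).

Definition Jp (p : nat) (X : C) : C := Csum (fun k => kappaC p k * X ^ (p - k)) p.

Lemma Csum_IZR f n : Csum (fun k => RtoC (IZR (f k))) n = RtoC (IZR (Zsum f n)).
Proof. induction n; simpl; auto. now rewrite IHn, plus_IZR, RtoC_plus. Qed.

Lemma fricke_phi_inv p t : In p (2 :: 3 :: 5 :: 7 :: nil)%nat -> upper_half_plane t -> fricke_phi p (W p t) = psi p t.
Proof.
  intros Hp Ht. pose proof (In_primes_pos p Hp). unfold fricke_phi.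
  rewrite <- psi_W, W_invol by (auto; try lia; apply uhp_W; auto; lia). reflexivity.
Qed.

Lemma star_inv_fun p g (F : C -> C) : star_inv p g -> star_inv p (fun t => F (g t)).
Proof. intros A a k E s Hs. now rewrite (A a k E s Hs). Qed.

Lemma star_inv_ext p g h : (0 < p)%nat -> (forall t, upper_half_plane t -> g t = h t) -> star_inv p g -> star_inv p h.
Proof.
  intros Hp E A a k Hak s Hs. assert (Hpp : (0 < INR p)%R) by (apply lt_0_INR; lia).
  rewrite <- !E; [now apply A | |].
  - apply uhp_div; auto. now apply uhp_shift.
  - apply uhp_div; auto. unfold Cminus. rewrite Cplus_comm. now apply uhp_shift, uhp_neg_inv.
Qed.

Lemma star_inv_plus p g h : star_inv p g -> star_inv p h -> star_inv p (fun t => g t + h t).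
Proof. intros A B a k E s Hs. rewrite (A a k E s Hs), (B a k E s Hs). reflexivity. Qed.

Lemma star_inv_Y p : In p (2 :: 3 :: 5 :: 7 :: nil)%nat -> star_inv p (fricke_phi p).
Proof.
  intros Hp. pose proof (In_primes_pos p Hp).
  apply (star_inv_ext p (fun t => RtoC (IZR (fricke_const p)) * / psi p t)); [lia | |].
  - intros t Ht. unfold fricke_phi. rewrite phi_inv by (auto; lia). reflexivity.
  - apply (star_inv_fun p (psi p) (fun x => RtoC (IZR (fricke_const p)) * / x)). apply star_psi; auto.
Qed.

Lemma QE_qtot p : (0 < p <= 7)%nat -> exists e : nat -> C, e 0%nat = RtoC (INR p) /\ QE (fun t => q t * tot p p t) e.
Proof.
  intros Hp. destruct p as [| p']; [lia |]. set (p := S p') in *.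
  destruct (QE_Y_pow p p' ltac:(lia)) as [c [Hc0 Hc]]. fold p in Hc.
  apply (QE_mulq _ _ 1) in Hc. pose proof (QE_plus _ _ _ _ Hc (QE_V_psi_p p ltac:(lia))) as H.
  eexists. split; [| eapply QE_ext; [| exact H]].
  - cbv beta. destruct (le_lt_dec 1 0); [lia |]. rewrite Nat.mul_0_r. unfold ZC. rewrite qpsi_coef_pow_0 by lia. ring.
  - intros t Ht. cbv beta. unfold tot. rewrite Cpow_1_r. ring.
Qed.

(** Both sides equal [tot p p] at p t, divided by p, up to one common constant. On the left the
    choice of kappa makes the poles at infinity agree, and at the cusp 0 the pole of psi agrees with
    that of the total. The right side is the left side taken at W (p t). *)
Lemma J_relation p t : In p (2 :: 3 :: 5 :: 7 :: nil)%nat -> upper_half_plane t ->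
  Jp p (psi p t) + fricke_phi p t = Jp p (fricke_phi p (RtoC (INR p) * t)) + psi p (RtoC (INR p) * t).
Proof.
  intros Hp. pose proof (In_primes_pos p Hp) as Hp2. revert t.
  assert (Hpp : (0 < INR p)%R) by (apply lt_0_INR; lia).
  assert (Np : RtoC (INR p) <> 0) by (apply RtoC_neq0; lra).
  destruct (QE_qtot p ltac:(lia)) as [e [He0 He]].
  destruct (QE_Y_pow p 0 ltac:(lia)) as [y [Hy0 Hy]].
  set (c1 := fun n => Csum (fun k => kappaC p k * (if le_lt_dec k n then ZC (zpow (qpsi_coef p) (p - k)) (n - k) else 0)) p).
  assert (H1 : QE (fun t => q t ^ p * Jp p (psi p t)) c1).
  { eapply QE_ext; [| apply (QE_Csum (fun k t => kappaC p k * (q t ^ k * (q t ^ (p - k) * psi p t ^ (p - k)))))].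
    - intros t Ht. cbv beta. unfold Jp. rewrite <- Csum_scal. apply Csum_ext. intros k Hk.
      assert (E : q t ^ p = q t ^ k * q t ^ (p - k)) by (rewrite <- Cpow_add_r; f_equal; lia).
      rewrite E. ring.
    - intros k Hk. apply QE_scal. apply (QE_mulq _ _ k). apply (QZ_qpsi_pow p (p - k)). lia. }
  assert (Hc1 : forall n, (n < p)%nat -> c1 n = ZC zone n).
  { intros n Hn. unfold ZC. rewrite <- (kappa_polar p n Hp Hn), <- Csum_IZR. apply Csum_ext. intros k Hk.
    unfold kappaC. rewrite mult_IZR, RtoC_mult. f_equal. destruct (le_lt_dec k n); reflexivity. }
  pose proof (QE_mulq _ _ p Hy) as H2.
  pose proof (QE_scal (/ RtoC (INR p)) _ _ (QE_Vp _ _ p ltac:(lia) He)) as H3.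
  pose proof (QE_minus _ _ _ _ (QE_plus _ _ _ _ H1 H2) H3) as H4.
  match type of H4 with QE _ ?d => set (c4 := d) in H4 end.
  assert (Hc4 : forall n, (n < p)%nat -> c4 n = 0).
  { intros n Hn. unfold c4. rewrite Hc1 by auto. destruct (le_lt_dec p n); [lia |].
    rewrite Nat.mod_small by lia. unfold ZC, zone. destruct (Nat.eq_dec n 0) as [-> | Hn0].
    - rewrite Nat.Div0.div_0_l, He0. simpl. field. auto.
    - simpl. ring. }
  pose proof (QE_divq _ _ p H4 Hc4) as H5. set (C0 := c4 (p + 0)%nat).
  pose proof (QE_minus _ _ _ _ H5 (QE_const C0)) as H6.
  set (D := fun t => Jp p (psi p t) + fricke_phi p t - / RtoC (INR p) * tot p p (RtoC (INR p) * t) - C0).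
  assert (HDinf : QE D (fun n => c4 (p + n)%nat - C0 * ZC zone n)).
  { eapply QE_ext; [| exact H6]. intros t Ht. cbv beta. unfold D. rewrite <- q_pow, Cpow_1_r.
    pose proof (Cpow_nz _ p (q_nz t)). field. auto. }
  assert (EDW : forall t, upper_half_plane t -> D (W p t) = Jp p (fricke_phi p t) + psi p t - / RtoC (INR p) * tot p p t - C0).
  { intros t Ht. unfold D. rewrite tot_pW, fricke_phi_inv, psi_W by auto. reflexivity. }
  assert (HDW : has_QE (fun t => D (W p t))).
  { apply (has_QE_ext (fun t => Jp p (fricke_phi p t) + (psi p t - / RtoC (INR p) * tot p p t) - C0)).
    { intros t Ht. rewrite EDW by auto. ring. }
    apply has_QE_minus; [apply has_QE_plus | apply has_QE_const].
    - apply has_QE_Csum. intros k Hk. apply has_QE_mult; [apply has_QE_const | apply has_QE_pow, has_QE_Y; lia].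
    - pose proof (QE_minus _ _ _ _ (QZ_qpsi p ltac:(lia)) (QE_scal (/ RtoC (INR p)) _ _ He)) as H7.
      apply (fun H => QE_divq _ _ 1 H) in H7.
      + eexists. eapply QE_ext; [| exact H7]. intros t Ht. cbv beta. pose proof (q_nz t). rewrite Cpow_1_r. field. auto.
      + intros n Hn. replace n with 0%nat by lia. rewrite He0. unfold ZC.
        replace (qpsi_coef p 0) with 1%Z; [field; auto |]. rewrite <- (qpsi_coef_pow_0 p 1 ltac:(lia)).
        cbn [zpow]. rewrite zconv_0. unfold zone. simpl. lia. }
  destruct HDW as [b Hb].
  assert (ZD : forall t, upper_half_plane t -> D t = 0).
  { apply (liouville p D _ b Hp HDinf Hb).
    - unfold D. apply star_inv_minus; [| apply star_inv_const]. apply star_inv_minus.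
      + apply star_inv_plus; [apply (star_inv_fun p (psi p) (Jp p)), star_psi; auto | apply star_inv_Y; auto].
      + apply (star_inv_fun p _ (fun x => / RtoC (INR p) * x)). apply tot_star; auto.
    - left. unfold C0, ZC, zone. simpl. ring. }
  intros t Ht. assert (Hpt : upper_half_plane (RtoC (INR p) * t)) by (apply uhp_scal; auto).
  pose proof (ZD t Ht) as E1. pose proof (ZD _ (uhp_W p _ ltac:(lia) Hpt)) as E2. rewrite EDW in E2 by auto.
  unfold D in E1.
  transitivity (Jp p (psi p t) + fricke_phi p t - / RtoC (INR p) * tot p p (RtoC (INR p) * t) - C0
    + (/ RtoC (INR p) * tot p p (RtoC (INR p) * t) + C0)); [ring |]. rewrite E1, <- E2. ring.
Qed.

Lemma geom_diff (x y : C) n : (x - y) * Csum (fun j => x ^ (n - 1 - j) * y ^ j) n = x ^ n - y ^ n.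
Proof.
  induction n; [simpl; ring |].
  destruct n as [| n]; [simpl; ring |].
  cbn [Csum]. rewrite (Csum_ext _ (fun k => x * (x ^ (S n - 1 - k) * y ^ k))).
  - rewrite Csum_scal. replace (S (S n) - 1 - n)%nat with 1%nat by lia. replace (S (S n) - 1 - S n)%nat with 0%nat by lia.
    cbn [Csum] in IHn. replace (S n - 1 - n)%nat with 0%nat in IHn by lia. rewrite Cpow_1_r.
    set (A := Csum (fun k => x ^ (S n - 1 - k) * y ^ k) n) in *.
    transitivity (x * ((x - y) * (A + x ^ 0 * y ^ n)) + (x - y) * y ^ S n); [simpl; ring |].
    rewrite IHn. simpl. ring.
  - intros k Hk. replace (S (S n) - 1 - k)%nat with (S (S n - 1 - k)) by lia. simpl. ring.
Qed.

(** With x = psi(t) and y = Y(p t) the preceding relation reads J(x) - J(y) = (x - y) phi(t) psi(p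
    t). The factor x - y is cancelled in the domain of q-series, after powers of q have cleared the
    poles, so its zeros do no harm. *)
Lemma modular_equation p t : In p (2 :: 3 :: 5 :: 7 :: nil)%nat -> upper_half_plane t ->
  phi p t * psi p (RtoC (INR p) * t)
  = Csum (fun k => Csum (fun j => kappaC p k * (psi p t ^ (p - k - 1 - j) * fricke_phi p (RtoC (INR p) * t) ^ j)) (p - k)) p.
Proof.
  intros Hp. pose proof (In_primes_pos p Hp) as Hp2. revert t.
  assert (Hpp : (0 < INR p)%R) by (apply lt_0_INR; lia).
  assert (Np : RtoC (INR p) <> 0) by (apply RtoC_neq0; lra).
  assert (Nc : RtoC (IZR (fricke_const p)) <> 0) by (rewrite fricke_const_INR; apply Cpow_nz; auto).
  set (S := fun t => Csum (fun k => Csum (fun j => kappaC p k * (psi p t ^ (p - k - 1 - j) * fricke_phi p (RtoC (INR p) * t) ^ j)) (p - k)) p).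
  set (G := fun t => q t * (psi p t - fricke_phi p (RtoC (INR p) * t))).
  set (B := fun t => q t ^ p * (S t - phi p t * psi p (RtoC (INR p) * t))).
  assert (HYp : has_QE (fun t => fricke_phi p (RtoC (INR p) * t))) by (apply (has_QE_Vp (fricke_phi p)); [lia | apply has_QE_Y; lia]).
  assert (HG : has_QE G).
  { apply (has_QE_ext (fun t => q t * psi p t - q t * fricke_phi p (RtoC (INR p) * t))).
    - intros t Ht. unfold G. ring.
    - apply has_QE_minus; [apply has_QE_qpsi; lia | apply has_QE_mult; [apply has_QE_q | auto]]. }
  assert (HB : has_QE B).
  { apply (has_QE_ext (fun t => Csum (fun k => Csum (fun j => kappaC p k * (q t ^ (k + 1 + j) * (q t * psi p t) ^ (p - k - 1 - j) * fricke_phi p (RtoC (INR p) * t) ^ j)) (p - k)) p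
       - phi p t * (q (RtoC (INR p) * t) * psi p (RtoC (INR p) * t)))).
    - intros t Ht. unfold B, S. unfold Cminus at 2. rewrite Cmult_plus_distr_l, <- Csum_scal.
      unfold Cminus. f_equal.
      + apply Csum_ext. intros k Hk. rewrite <- Csum_scal. apply Csum_ext. intros j Hj.
        assert (E : q t ^ p = q t ^ (k + 1 + j) * q t ^ (p - k - 1 - j)) by (rewrite <- Cpow_add_r; f_equal; lia).
        rewrite E, Cpow_mult_l. ring.
      + rewrite <- q_pow. ring.
    - apply has_QE_minus.
      + apply has_QE_Csum. intros k Hk. apply has_QE_Csum. intros j Hj. apply has_QE_mult; [apply has_QE_const |].
        apply has_QE_mult; [apply has_QE_mult |]; apply has_QE_pow; auto using has_QE_q. apply has_QE_qpsi; lia.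
      + apply has_QE_mult; [apply has_QE_phi; lia |]. apply (has_QE_Vp (fun t => q t * psi p t)); [lia | apply has_QE_qpsi; lia]. }
  assert (Prod : forall t, upper_half_plane t -> G t * B t = 0).
  { intros t Ht. assert (Hpt : upper_half_plane (RtoC (INR p) * t)) by (apply uhp_scal; auto).
    pose proof (J_relation p t Hp Ht) as J. unfold G, B.
    set (x := psi p t) in *. set (y := fricke_phi p (RtoC (INR p) * t)) in *.
    assert (E1 : (x - y) * S t = Jp p x - Jp p y).
    { unfold S, Jp. fold x y. rewrite <- Csum_minus, <- Csum_scal. apply Csum_ext. intros k Hk.
      rewrite Csum_scal. transitivity (kappaC p k * ((x - y) * Csum (fun j => x ^ (p - k - 1 - j) * y ^ j) (p - k))); [ring |].
      rewrite geom_diff. ring. }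
    assert (E2 : (x - y) * (phi p t * psi p (RtoC (INR p) * t)) = psi p (RtoC (INR p) * t) - fricke_phi p t).
    { pose proof (psi_phi p t ltac:(lia) Ht) as P1. pose proof (psi_phi p _ ltac:(lia) Hpt) as P2. fold x in P1.
      unfold y, fricke_phi. transitivity ((x * phi p t) * psi p (RtoC (INR p) * t) - RtoC (IZR (fricke_const p)) * phi p t * (psi p (RtoC (INR p) * t) * phi p (RtoC (INR p) * t))); [ring |].
      rewrite P1, P2. ring. }
    transitivity (q t * q t ^ p * ((x - y) * S t - (x - y) * (phi p t * psi p (RtoC (INR p) * t)))); [ring |].
    rewrite E1, E2.
    transitivity (q t * q t ^ p * ((Jp p x + fricke_phi p t) - (Jp p y + psi p (RtoC (INR p) * t)))); [ring |].
    rewrite J. ring. }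
  intros t Ht. destruct (has_QE_domain G B HG HB Prod) as [Z | Z].
  (* The difference x - y is not identically zero: q x has constant term 1, while q y has none. *)
  - exfalso. destruct HYp as [y Hy].
    pose proof (QE_minus _ _ _ _ (QZ_qpsi p ltac:(lia)) (QE_mulq _ _ 1 Hy)) as H7.
    assert (H8 : QE (fun _ => 0) (fun n => 0 * ZC zone n)) by apply QE_const.
    assert (E0 := QE_unique (fun t => q t * psi p t - q t ^ 1 * fricke_phi p (RtoC (INR p) * t)) _ (fun n => 0 * ZC zone n) H7).
    specialize (E0 ltac:(eapply QE_ext; [| exact H8]; intros s Hs; rewrite <- (Z s Hs); unfold G; rewrite Cpow_1_r; ring) 0%nat).
    cbv beta in E0. destruct (le_lt_dec 1 0); [lia |]. unfold ZC in E0.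
    assert (Es : qpsi_coef p 0 = 1%Z).
    { rewrite <- (qpsi_coef_pow_0 p 1 ltac:(lia)). cbn [zpow]. rewrite zconv_0. unfold zone. simpl. lia. }
    rewrite Es in E0. apply C1_nz. transitivity (RtoC (IZR 1) - 0); [ring |]. rewrite E0. ring.
  - specialize (Z t Ht). unfold B in Z. pose proof (Cpow_nz _ p (q_nz t)) as Nq.
    fold (S t). transitivity (S t - / q t ^ p * (q t ^ p * (S t - phi p t * psi p (RtoC (INR p) * t)))); [field; auto |].
    rewrite Z. ring.
Qed.

(** * The recursion *)

Definition phi_zpow (p : nat) (e : Z) (t : C) : C :=
  if Z_le_dec 0 e then phi p t ^ Z.to_nat e else psi p t ^ Z.to_nat (- e).

Lemma phi_zpow_succ p e t : (0 < p)%nat -> upper_half_plane t -> phi_zpow p (e + 1) t = phi p t * phi_zpow p e t.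
Proof.
  intros Hp Ht. pose proof (psi_phi p t Hp Ht) as P. unfold phi_zpow.
  destruct (Z_le_dec 0 e), (Z_le_dec 0 (e + 1)); try lia.
  - replace (Z.to_nat (e + 1)) with (S (Z.to_nat e)) by lia. reflexivity.
  - replace e with (-1)%Z by lia. change (Z.to_nat (-1 + 1)) with 0%nat. change (Z.to_nat (- -1)) with 1%nat.
    rewrite Cpow_1_r, Cmult_comm, P. reflexivity.
  - replace (Z.to_nat (- e)) with (S (Z.to_nat (- (e + 1)))) by lia. rewrite Cpow_S.
    transitivity (psi p t * phi p t * psi p t ^ Z.to_nat (- (e + 1))); [rewrite P; ring | ring].
Qed.

Lemma phi_zpow_pred p e t n : (0 < p)%nat -> upper_half_plane t -> psi p t ^ n * phi_zpow p e t = phi_zpow p (e - Z.of_nat n) t.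
Proof.
  intros Hp Ht. pose proof (psi_phi p t Hp Ht) as P. revert e. induction n; intros e.
  - rewrite Z.sub_0_r. simpl. ring.
  - rewrite Cpow_S. replace (e - Z.of_nat (S n))%Z with ((e - 1) - Z.of_nat n)%Z by lia. rewrite <- IHn.
    replace (phi_zpow p e t) with (phi p t * phi_zpow p (e - 1) t).
    + transitivity (psi p t * phi p t * (psi p t ^ n * phi_zpow p (e - 1) t)); [ring |]. rewrite P. ring.
    + rewrite <- phi_zpow_succ by auto. f_equal. lia.
Qed.

Lemma V_Csum p (f : nat -> C -> C) N tau : V p (fun t => Csum (fun k => f k t) N) tau = Csum (fun k => V p (f k) tau) N.
Proof. unfold V. apply (Csum_swap (fun l k => f k ((tau + RtoC (INR l)) / RtoC (INR p)))). Qed.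

Lemma fricke_phi_shift p t (n : Z) : fricke_phi p (t + RtoC (IZR n)) = fricke_phi p t.
Proof. unfold fricke_phi. now rewrite phi_shift. Qed.

(** Multiply the modular equation by phi^(E - 1) and take the trace; psi(p t) and the powers of Y(p
    t) leave it by the projection formula. The exponents on the right run from E - p to E - 1. *)
Lemma trace_recursion p (E : Z) t : In p (2 :: 3 :: 5 :: 7 :: nil)%nat -> upper_half_plane t ->
  psi p t * V p (phi_zpow p E) t
  = Csum (fun k => Csum (fun j => kappaC p k * (fricke_phi p t ^ j * V p (phi_zpow p (E - Z.of_nat p + Z.of_nat k + Z.of_nat j)) t)) (p - k)) p.
Proof.
  intros Hp Ht. pose proof (In_primes_pos p Hp) as Hp2.
  rewrite <- (V_mult_Vp p (psi p)) by (try lia; intros; apply psi_shift).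
  rewrite (V_ext p _ (fun t => Csum (fun k => Csum (fun j => kappaC p k * (fricke_phi p (RtoC (INR p) * t) ^ j *
      phi_zpow p (E - Z.of_nat p + Z.of_nat k + Z.of_nat j) t)) (p - k)) p)); [| lia | | auto].
  - rewrite (V_Csum p (fun k t => Csum _ (p - k))). apply Csum_ext. intros k Hk.
    rewrite (V_Csum p (fun j t => kappaC p k * (fricke_phi p (RtoC (INR p) * t) ^ j * phi_zpow p (E - Z.of_nat p + Z.of_nat k + Z.of_nat j) t))).
    apply Csum_ext. intros j Hj. rewrite (V_scal p (kappaC p k)). f_equal.
    apply (V_mult_Vp p (fun t => fricke_phi p t ^ j)); [lia |]. intros; now rewrite fricke_phi_shift.
  - intros s Hs. replace (phi_zpow p E s) with (phi p s * phi_zpow p (E - 1) s).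
    2:{ rewrite <- phi_zpow_succ by (auto; lia). f_equal. lia. }
    transitivity ((phi p s * psi p (RtoC (INR p) * s)) * phi_zpow p (E - 1) s); [ring |].
    rewrite modular_equation by auto. rewrite Cmult_comm, <- Csum_scal. apply Csum_ext. intros k Hk.
    rewrite <- Csum_scal. apply Csum_ext. intros j Hj.
    replace (E - Z.of_nat p + Z.of_nat k + Z.of_nat j)%Z with (E - 1 - Z.of_nat (p - k - 1 - j))%Z by lia.
    rewrite <- phi_zpow_pred by (auto; lia). ring.
Qed.

(** * Lattices of modular functions *)

(** Finite integral combinations, with equality demanded on the upper half-plane only, since
    elsewhere the functions take uncontrolled values. The index type is general so that the same
    closure lemmas serve all the bases. *)
Inductive span {I : Type} (B : I -> C -> C) : (C -> C) -> Prop :=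
| span_0 (g : C -> C) : (forall t, upper_half_plane t -> g t = 0) -> span B g
| span_S (g h : C -> C) (z : Z) i : span B h -> (forall t, upper_half_plane t -> g t = h t + RtoC (IZR z) * B i t) -> span B g.

Lemma span_ext {I : Type} (B : I -> C -> C) g g' : (forall t, upper_half_plane t -> g t = g' t) -> span B g -> span B g'.
Proof.
  intros E H. destruct H as [g H | g h z i H1 H2].
  - apply span_0. intros t Ht. rewrite <- E; auto.
  - apply (span_S B g' h z i H1). intros t Ht. rewrite <- E; auto.
Qed.

Lemma span_plus {I : Type} (B : I -> C -> C) g h : span B g -> span B h -> span B (fun t => g t + h t).
Proof.
  intros Hg Hh. induction Hg as [g Hg | g k z i Hk IH Hg].
  - apply (span_ext B h); auto. intros t Ht. rewrite Hg by auto. ring.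
  - apply (span_S B _ (fun t => k t + h t) z i IH). intros t Ht. rewrite Hg by auto. ring.
Qed.

Lemma span_gen {I : Type} (B : I -> C -> C) (z : Z) i : span B (fun t => RtoC (IZR z) * B i t).
Proof.
  apply (span_S B _ (fun _ => 0) z i); [apply span_0; auto |]. intros; ring.
Qed.

Lemma span_scal {I : Type} (B : I -> C -> C) (y : Z) g : span B g -> span B (fun t => RtoC (IZR y) * g t).
Proof.
  intros Hg. induction Hg as [g Hg | g k z i Hk IH Hg].
  - apply span_0. intros t Ht. rewrite Hg by auto. ring.
  - apply (span_S B _ (fun t => RtoC (IZR y) * k t) (y * z) i IH).
    intros t Ht. rewrite Hg, mult_IZR, RtoC_mult by auto. ring.
Qed.

Lemma span_Csum {I : Type} (B : I -> C -> C) (f : nat -> C -> C) N : (forall k, (k < N)%nat -> span B (f k)) -> span B (fun t => Csum (fun k => f k t) N).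
Proof.
  induction N; intros H; cbn [Csum]; [apply span_0; auto |].
  apply span_plus; [apply IHN; intros; apply H; lia | apply H; lia].
Qed.

Lemma span_mult {I J : Type} (B : I -> C -> C) (B' : J -> C -> C) (m g : C -> C) :
  (forall i, span B' (fun t => m t * B i t)) -> span B g -> span B' (fun t => m t * g t).
Proof.
  intros H Hg. induction Hg as [g Hg | g k z i Hk IH Hg].
  - apply span_0. intros t Ht. rewrite Hg by auto. ring.
  - apply (span_ext B' (fun t => m t * k t + RtoC (IZR z) * (m t * B i t))).
    + intros t Ht. rewrite Hg by auto. ring.
    + apply span_plus; auto. apply span_scal; auto.
Qed.

Lemma span_V {I J : Type} p (B : I -> C -> C) (B' : J -> C -> C) g : (0 < p)%nat ->
  (forall i, span B' (V p (B i))) -> span B g -> span B' (V p g).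
Proof.
  intros Hp H Hg. induction Hg as [g Hg | g k z i Hk IH Hg].
  - apply span_0. intros t Ht. rewrite (V_ext p g (fun t => 0 * 0)) by (auto; intros; rewrite Hg by auto; ring).
    rewrite (V_scal p 0 (fun _ => 0)). ring.
  - apply (span_ext B' (fun t => V p k t + RtoC (IZR z) * V p (B i) t)).
    + intros t Ht. rewrite (V_ext p g (fun t => k t + RtoC (IZR z) * B i t)) by auto.
      rewrite V_plus, V_scal. reflexivity.
    + apply span_plus; auto. apply span_scal; auto.
Qed.

Definition pC (p : nat) : C := RtoC (INR p).

Lemma pC_pow p e : pC p ^ e = RtoC (IZR (Z.of_nat p ^ Z.of_nat e)).
Proof. unfold pC. rewrite <- RtoC_pow, INR_IZR_INZ, pow_IZR. reflexivity. Qed.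

Lemma pC_nz p : (0 < p)%nat -> pC p <> 0.
Proof. intros. apply RtoC_neq0, not_0_INR. lia. Qed.

Lemma fricke_const_pC p : RtoC (IZR (fricke_const p)) = pC p ^ half_lam p.
Proof. apply fricke_const_INR. Qed.

(** ** Traces of powers of psi *)

Definition trace_basis (p : nat) (i : nat + nat) (t : C) : C :=
  match i with inl i => pC p * psi p t ^ i | inr i => fricke_phi p t ^ S i end.

Lemma psi_Y p t : (0 < p)%nat -> upper_half_plane t -> psi p t * fricke_phi p t = pC p ^ half_lam p.
Proof.
  intros Hp Ht. unfold fricke_phi. rewrite fricke_const_pC.
  transitivity (pC p ^ half_lam p * (psi p t * phi p t)); [ring |]. rewrite psi_phi by auto. ring.
Qed.

Lemma half_lam_pos p : In p (2 :: 3 :: 5 :: 7 :: nil)%nat -> (1 <= half_lam p)%nat.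
Proof. intros [<- | [<- | [<- | [<- | []]]]]; cbv; lia. Qed.

(** The product psi Y is p^(lambda/2), a multiple of p, so multiplying Y by psi falls back into p
    Z[psi]. *)
Lemma trace_basis_psi p i : In p (2 :: 3 :: 5 :: 7 :: nil)%nat -> span (trace_basis p) (fun t => psi p t * trace_basis p i t).
Proof.
  intros Hp. pose proof (In_primes_pos p Hp) as Hp2. pose proof (half_lam_pos p Hp) as Hh.
  destruct i as [i | i].
  - apply (span_ext _ (fun t => RtoC (IZR 1) * trace_basis p (inl (S i)) t)); [| apply span_gen].
    intros t Ht. cbn [trace_basis]. rewrite Cpow_S. ring.
  - destruct i as [| i].
    + apply (span_ext _ (fun t => RtoC (IZR (Z.of_nat p ^ Z.of_nat (half_lam p - 1))) * trace_basis p (inl 0%nat) t)); [| apply span_gen].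
      intros t Ht. cbn [trace_basis]. rewrite Cpow_1_r, psi_Y, <- pC_pow by (auto; lia).
      replace (half_lam p) with (S (half_lam p - 1)) at 2 by lia. rewrite Cpow_S. simpl. ring.
    + apply (span_ext _ (fun t => RtoC (IZR (fricke_const p)) * trace_basis p (inr i) t)); [| apply span_gen].
      intros t Ht. cbn [trace_basis]. rewrite fricke_const_pC, <- (psi_Y p t) by (auto; lia). rewrite (Cpow_S _ (S i)). ring.
Qed.

(** The element p is sent to a multiple of Y, and from psi^(i + 1) the factor psi Y splits off as a
    constant. With the preceding lemma the lattice is a module over Z[psi, Y], as the recursion
    requires. *)
Lemma trace_basis_Y p i : In p (2 :: 3 :: 5 :: 7 :: nil)%nat -> span (trace_basis p) (fun t => fricke_phi p t * trace_basis p i t).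
Proof.
  intros Hp. pose proof (In_primes_pos p Hp) as Hp2.
  destruct i as [i | i].
  - destruct i as [| i].
    + apply (span_ext _ (fun t => RtoC (IZR (Z.of_nat p)) * trace_basis p (inr 0%nat) t)); [| apply span_gen].
      intros t Ht. cbn [trace_basis]. rewrite <- INR_IZR_INZ. fold (pC p). simpl. ring.
    + apply (span_ext _ (fun t => RtoC (IZR (fricke_const p)) * trace_basis p (inl i) t)); [| apply span_gen].
      intros t Ht. cbn [trace_basis]. rewrite fricke_const_pC, <- (psi_Y p t) by (auto; lia). rewrite (Cpow_S _ i). ring.
  - apply (span_ext _ (fun t => RtoC (IZR 1) * trace_basis p (inr (S i)) t)); [| apply span_gen].
    intros t Ht. cbn [trace_basis]. rewrite (Cpow_S _ (S i)). ring.
Qed.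

Lemma trace_basis_Y_pow p g j : In p (2 :: 3 :: 5 :: 7 :: nil)%nat -> span (trace_basis p) g -> span (trace_basis p) (fun t => fricke_phi p t ^ j * g t).
Proof.
  intros Hp Hg. induction j.
  - apply (span_ext _ g); auto. intros; simpl; ring.
  - apply (span_ext _ (fun t => fricke_phi p t * (fricke_phi p t ^ j * g t))); [intros; rewrite Cpow_S; ring |].
    apply (span_mult (trace_basis p)); auto. intros i. apply trace_basis_Y; auto.
Qed.

Lemma V_one p t : V p (fun _ => 1) t = pC p.
Proof. unfold V. rewrite Csum_const. unfold pC. ring. Qed.

Lemma kappaC_0 p : In p (2 :: 3 :: 5 :: 7 :: nil)%nat -> kappaC p 0 = 1.
Proof. intros [<- | [<- | [<- | [<- | []]]]]; reflexivity. Qed.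

Lemma phi_zpow_neg p m t : phi_zpow p (- Z.of_nat m) t = psi p t ^ m.
Proof.
  unfold phi_zpow. destruct (Z_le_dec 0 (- Z.of_nat m)) as [H | H].
  - replace m with 0%nat by lia. reflexivity.
  - f_equal. lia.
Qed.

Lemma phi_zpow_pos p m t : phi_zpow p (Z.of_nat m) t = phi p t ^ m.
Proof. unfold phi_zpow. destruct (Z_le_dec 0 (Z.of_nat m)); [f_equal; lia | lia]. Qed.

Lemma Csum_triangle_head (F : nat -> nat -> C) n n' : n = S n' ->
  Csum (fun k => Csum (fun j => F k j) (n - k)) n
  = F 0%nat 0%nat + Csum (fun j => F 0%nat (S j)) n' + Csum (fun k => Csum (fun j => F (S k) j) (n - S k)) n'.
Proof.
  intros ->. rewrite Csum_head, Nat.sub_0_r. rewrite (Csum_head _ n'). reflexivity.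
Qed.

(** Strong induction. For m >= p the recursion at E = p - m is solved for its lowest term, the trace
    of psi^m, whose coefficient is kappa_0 = 1; the other exponents are larger than -m and at most
    0. For 0 < m < p the trace is known explicitly. *)
Lemma trace_psi_span p m : In p (2 :: 3 :: 5 :: 7 :: nil)%nat -> span (trace_basis p) (V p (phi_zpow p (- Z.of_nat m))).
Proof.
  intros Hp. pose proof (In_primes_pos p Hp) as Hp2.
  induction m as [m IH] using lt_wf_ind.
  destruct (Nat.eq_dec m 0) as [-> | Hm0]; [| destruct (le_lt_dec p m) as [Hpm | Hpm]].
  - apply (span_ext _ (fun t => RtoC (IZR 1) * trace_basis p (inl 0%nat) t)); [| apply span_gen].
    intros t Ht. rewrite (V_ext p _ (fun _ => 1)) by (try lia; auto; intros; apply phi_zpow_neg).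
    rewrite V_one. simpl. ring.
  - assert (IH' : forall e : Z, (- Z.of_nat m < e <= 0)%Z -> span (trace_basis p) (V p (phi_zpow p e))).
    { intros e He. replace e with (- Z.of_nat (Z.to_nat (- e)))%Z by lia. apply IH. lia. }
    set (E := (Z.of_nat p - Z.of_nat m)%Z).
    assert (Ep : exists p', p = S p') by (exists (p - 1)%nat; lia). destruct Ep as [p' Ep].
    apply (span_ext _ (fun t => psi p t * V p (phi_zpow p E) t + RtoC (IZR (-1)) *
        (Csum (fun j => kappaC p 0 * (fricke_phi p t ^ S j * V p (phi_zpow p (- Z.of_nat m + 1 + Z.of_nat j)) t)) p'
         + Csum (fun k => Csum (fun j => kappaC p (S k) * (fricke_phi p t ^ j * V p (phi_zpow p (- Z.of_nat m + 1 + Z.of_nat k + Z.of_nat j)) t)) (p - S k)) p'))).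
    + intros t Ht. rewrite trace_recursion by auto.
      rewrite (Csum_triangle_head _ p p' Ep), kappaC_0 by auto. cbv beta.
      replace (E - Z.of_nat p + Z.of_nat 0 + Z.of_nat 0)%Z with (- Z.of_nat m)%Z by lia.
      rewrite (Csum_ext (fun k => 1 * (fricke_phi p t ^ S k * V p (phi_zpow p (E - Z.of_nat p + Z.of_nat 0 + Z.of_nat (S k))) t))
        (fun j => 1 * (fricke_phi p t ^ S j * V p (phi_zpow p (- Z.of_nat m + 1 + Z.of_nat j)) t))).
      2:{ intros j Hj. replace (E - Z.of_nat p + Z.of_nat 0 + Z.of_nat (S j))%Z with (- Z.of_nat m + 1 + Z.of_nat j)%Z by lia. reflexivity. }
      rewrite (Csum_ext (fun k => Csum (fun j => kappaC p (S k) * (fricke_phi p t ^ j * V p (phi_zpow p (E - Z.of_nat p + Z.of_nat (S k) + Z.of_nat j)) t)) (p - S k))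
        (fun k => Csum (fun j => kappaC p (S k) * (fricke_phi p t ^ j * V p (phi_zpow p (- Z.of_nat m + 1 + Z.of_nat k + Z.of_nat j)) t)) (p - S k))).
      2:{ intros k Hk. apply Csum_ext. intros j Hj.
          replace (E - Z.of_nat p + Z.of_nat (S k) + Z.of_nat j)%Z with (- Z.of_nat m + 1 + Z.of_nat k + Z.of_nat j)%Z by lia. reflexivity. }
      change (fricke_phi p t ^ 0) with (RtoC 1). replace (RtoC (IZR (-1))) with (- (1)) by (apply Ceq; simpl; ring). ring.
    + apply span_plus.
      * apply (span_mult (trace_basis p)); [intros i; apply trace_basis_psi; auto |]. apply IH'. unfold E. lia.
      * apply span_scal. apply span_plus.
        -- apply span_Csum. intros j Hj. apply span_scal. apply trace_basis_Y_pow; auto. apply IH'. lia.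
        -- apply span_Csum. intros k Hk. apply span_Csum. intros j Hj. apply span_scal. apply trace_basis_Y_pow; auto. apply IH'. lia.
  - apply (span_ext _ (fun t => RtoC (IZR (psi_const_term p m)) * trace_basis p (inl 0%nat) t + RtoC (IZR (-1)) * trace_basis p (inr (m - 1)%nat) t)).
    + intros t Ht. rewrite (V_ext p _ (fun s => psi p s ^ m)) by (try lia; auto; intros; apply phi_zpow_neg).
      rewrite trace_psi_const by (auto; lia). cbn [trace_basis]. replace (S (m - 1)) with m by lia. fold (pC p).
      replace (RtoC (IZR (-1))) with (- (1)) by (apply Ceq; simpl; ring). simpl. ring.
    + apply span_plus; apply span_gen.
Qed.

(** ** Traces of powers of phi *)

(* In terms of x = p^phi_weight phi, the trace maps x^j into p^(slope + 1) x Z[x]. *)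
Definition phi_weight (p : nat) : nat := match p with 2%nat => 4 | 3%nat => 2 | _ => 1 end.
Definition slope (p : nat) : nat := match p with 2%nat => 3 | 3%nat => 2 | _ => 1 end.

(** The two inequalities that the induction on j consumes: the first pays for the factors Y^i, the
    second for the one place where the trace of 1 appears. *)
Lemma weight_slope p : In p (2 :: 3 :: 5 :: 7 :: nil)%nat -> (2 * phi_weight p <= half_lam p /\ slope p <= phi_weight p * (p - 1))%nat.
Proof. intros [<- | [<- | [<- | [<- | []]]]]; cbv; lia. Qed.

Definition phi_basis (p e : nat) (i : nat) (t : C) : C := pC p ^ e * (pC p ^ (phi_weight p * i) * phi p t ^ S i).

Fixpoint pev (l : list Z) (x : C) : C :=
  match l with nil => 0 | a :: l' => RtoC (IZR a) + x * pev l' x end.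

Fixpoint padd (l m : list Z) : list Z :=
  match l, m with
  | nil, _ => m
  | _, nil => l
  | a :: l', b :: m' => (a + b)%Z :: padd l' m'
  end.

Definition pscal (a : Z) (l : list Z) : list Z := map (Z.mul a) l.

Definition pshift (n : nat) (l : list Z) : list Z := repeat 0%Z n ++ l.

Lemma pev_add l m x : pev (padd l m) x = pev l x + pev m x.
Proof.
  revert m. induction l as [| a l IH]; intros m; [simpl; ring |].
  destruct m as [| b m]; [simpl; ring |]. cbn [padd pev]. rewrite IH, plus_IZR, RtoC_plus. ring.
Qed.

Lemma pev_scal a l x : pev (pscal a l) x = RtoC (IZR a) * pev l x.
Proof.
  induction l as [| b l IH]; [simpl; ring |]. unfold pscal in *. cbn [map pev].
  rewrite IH, mult_IZR, RtoC_mult. ring.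
Qed.

Lemma pev_shift n l x : pev (pshift n l) x = x ^ n * pev l x.
Proof.
  induction n; [change (pshift 0 l) with l; change (x ^ 0) with (RtoC 1); ring |]. change (pshift (S n) l) with (0%Z :: pshift n l). cbn [pev]. rewrite IHn, Cpow_S. ring.
Qed.

Fixpoint psumn (f : nat -> list Z) (n : nat) : list Z :=
  match n with O => nil | S k => padd (psumn f k) (f k) end.

Lemma pev_sumn f n x : pev (psumn f n) x = Csum (fun k => pev (f k) x) n.
Proof. induction n; simpl; auto. now rewrite pev_add, IHn. Qed.

(** The right side of [trace_up] on coefficient lists: the shift by S j and the power of
    [fricke_const] encode the factor phi Y^j. *)
Definition rec_poly (p : nat) (w : list (list Z)) : list Z :=
  psumn (fun k => psumn (fun j => pscal (kap p k * fricke_const p ^ Z.of_nat j)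
     (pshift (S j) (nth (k + j) w nil))) (p - k)) p.

Definition rec_step (p : nat) (w : list (list Z)) : list (list Z) := tl w ++ rec_poly p w :: nil.

(* The traces of p consecutive powers, each a polynomial in phi; the recursion advances them by one. *)
Definition window (p : nat) (E : Z) (w : list (list Z)) : Prop :=
  length w = p /\ forall i, (i < p)%nat -> forall t, upper_half_plane t ->
    V p (phi_zpow p (E - Z.of_nat p + Z.of_nat i)) t = pev (nth i w nil) (phi p t).

Lemma trace_up p (E : Z) t : In p (2 :: 3 :: 5 :: 7 :: nil)%nat -> upper_half_plane t ->
  V p (phi_zpow p E) t
  = Csum (fun k => Csum (fun j => kappaC p k * (phi p t * fricke_phi p t ^ j * V p (phi_zpow p (E - Z.of_nat p + Z.of_nat k + Z.of_nat j)) t)) (p - k)) p.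
Proof.
  intros Hp Ht. pose proof (In_primes_pos p Hp) as Hp2.
  transitivity (phi p t * (psi p t * V p (phi_zpow p E) t)).
  - transitivity ((psi p t * phi p t) * V p (phi_zpow p E) t); [rewrite psi_phi by (auto; lia); ring | ring].
  - rewrite trace_recursion by auto. rewrite <- Csum_scal. apply Csum_ext. intros k Hk.
    rewrite <- Csum_scal. apply Csum_ext. intros j Hj. ring.
Qed.

Lemma window_step p E w : In p (2 :: 3 :: 5 :: 7 :: nil)%nat -> window p E w -> window p (E + 1) (rec_step p w).
Proof.
  intros Hp [Hlen Hw]. pose proof (In_primes_pos p Hp) as Hp2.
  destruct w as [| w0 w]; [simpl in Hlen; lia |]. simpl in Hlen. split.
  - unfold rec_step. rewrite length_app. simpl. lia.
  - intros i Hi t Ht. unfold rec_step. cbn [tl].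
    destruct (Nat.eq_dec i (p - 1)) as [-> | Hi2].
    + rewrite app_nth2 by lia. replace (p - 1 - length w)%nat with 0%nat by lia. cbn [nth].
      replace (E + 1 - Z.of_nat p + Z.of_nat (p - 1))%Z with E by lia.
      rewrite trace_up by auto. unfold rec_poly. rewrite pev_sumn. apply Csum_ext. intros k Hk.
      rewrite pev_sumn. apply Csum_ext. intros j Hj. rewrite pev_scal, pev_shift.
      rewrite <- Hw by (auto; lia).
      replace (E - Z.of_nat p + Z.of_nat k + Z.of_nat j)%Z with (E - Z.of_nat p + Z.of_nat (k + j))%Z by lia.
      rewrite mult_IZR, RtoC_mult. unfold kappaC, fricke_phi. rewrite <- pow_IZR, RtoC_pow, Cpow_mult_l, Cpow_S. ring.
    + rewrite app_nth1 by lia.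
      replace (E + 1 - Z.of_nat p + Z.of_nat i)%Z with (E - Z.of_nat p + Z.of_nat (S i))%Z by lia.
      rewrite (Hw (S i)) by (auto; lia). reflexivity.
Qed.

(** The trace of psi^m for m < p as a polynomial in phi: p times a constant term, minus Y^m. The
    case m = 0 stands apart, as the trace of 1 is p without the subtraction. *)
Definition trace_neg (p m : nat) : list Z :=
  match m with
  | O => Z.of_nat p :: nil
  | _ => padd ((Z.of_nat p * list_coef (qpsi_pow_list p m) m)%Z :: nil) (pshift m ((- fricke_const p ^ Z.of_nat m)%Z :: nil))
  end.

(** The exponents run from 1 - p up to 0, hence the reversed index. *)
Definition window0 (p : nat) : list (list Z) := map (fun i => trace_neg p (p - 1 - i)) (seq 0 p).

Lemma window_0 p : In p (2 :: 3 :: 5 :: 7 :: nil)%nat -> window p 1 (window0 p).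
Proof.
  intros Hp. pose proof (In_primes_pos p Hp) as Hp2. unfold window0. split; [now rewrite length_map, length_seq |].
  intros i Hi t Ht. rewrite (nth_indep _ _ (trace_neg p (p - 1 - 0))) by (rewrite length_map, length_seq; auto).
  rewrite (map_nth (fun i => trace_neg p (p - 1 - i))), seq_nth by auto. cbn [Nat.add].
  replace (1 - Z.of_nat p + Z.of_nat i)%Z with (- Z.of_nat (p - 1 - i))%Z by lia.
  set (m := (p - 1 - i)%nat). assert (Hm : (m < p)%nat) by (unfold m; lia). clearbody m.
  rewrite (V_ext p _ (fun s => psi p s ^ m)) by (try lia; auto; intros; apply phi_zpow_neg).
  destruct m as [| m].
  - rewrite (V_ext p _ (fun _ => 1)) by (try lia; auto). rewrite V_one. simpl. rewrite <- INR_IZR_INZ. unfold pC. ring.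
  - rewrite trace_psi_const by (auto; lia). unfold trace_neg. rewrite pev_add, pev_shift, psi_const_term_val by lia. cbn [pev].
    rewrite mult_IZR, RtoC_mult, <- INR_IZR_INZ, opp_IZR, RtoC_opp, <- pow_IZR, RtoC_pow. unfold fricke_phi.
    rewrite Cpow_mult_l. ring.
Qed.

Lemma window_iter p n : In p (2 :: 3 :: 5 :: 7 :: nil)%nat ->
  window p (1 + Z.of_nat n) (Nat.iter n (rec_step p) (window0 p)).
Proof.
  intros Hp. induction n; [apply window_0; auto |].
  replace (1 + Z.of_nat (S n))%Z with (1 + Z.of_nat n + 1)%Z by lia. apply window_step; auto.
Qed.

Fixpoint divok (p e off : nat) (l : list Z) : bool :=
  match l with
  | nil => true
  | a :: l' => (Z.eqb (a mod Z.of_nat p ^ Z.of_nat (e + phi_weight p * off)) 0 && divok p e (S off) l')%bool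
  end.

Lemma divok_span p e off l : (0 < p)%nat -> divok p e off l = true -> span (phi_basis p e) (fun t => phi p t ^ S off * pev l (phi p t)).
Proof.
  intros Hp. revert off. induction l as [| a l IH]; intros off H.
  - apply span_0. intros; simpl; ring.
  - cbn [divok] in H. apply andb_prop in H. destruct H as [H1 H2]. apply Z.eqb_eq in H1.
    apply Z.mod_divide in H1; [| apply Z.pow_nonzero; lia]. destruct H1 as [z Hz].
    apply (span_ext _ (fun t => RtoC (IZR z) * phi_basis p e off t + phi p t ^ S (S off) * pev l (phi p t))).
    + intros t Ht. cbn [pev]. rewrite Hz, mult_IZR, RtoC_mult. unfold phi_basis.
      rewrite <- pC_pow, Cpow_add_r, (Cpow_S _ (S off)). ring.
    + apply span_plus; [apply span_gen | apply IH; auto].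
Qed.

(** After j steps the last entry of the window is the trace of phi^j. Its constant coefficient must
    literally be 0; the remaining ones are tested after scaling by p^(w (j - 1)), with w the
    weight. *)
Definition base_ok (p j : nat) : bool :=
  match nth (p - 1) (Nat.iter j (rec_step p) (window0 p)) nil with
  | 0%Z :: l => divok p (slope p + 1) 0 (pscal (Z.of_nat p ^ Z.of_nat (phi_weight p * (j - 1))) l)
  | _ => false
  end.

(** The finitely many exact traces on which the slope rests. *)
Lemma base_check p j : In p (2 :: 3 :: 5 :: 7 :: nil)%nat -> (1 <= j < p)%nat -> base_ok p j = true.
Proof.
  intros Hp Hj. assert (H : forallb (base_ok p) (seq 1 (p - 1)) = true).
  { destruct Hp as [<- | [<- | [<- | [<- | []]]]]; vm_compute; reflexivity. }
  rewrite forallb_forall in H. apply H, in_seq. lia.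
Qed.

Lemma phi_basis_x p e i r : span (phi_basis p e) (fun t => (pC p ^ phi_weight p * phi p t) ^ r * phi_basis p e i t).
Proof.
  apply (span_ext _ (fun t => RtoC (IZR 1) * phi_basis p e (r + i) t)); [| apply span_gen].
  intros t Ht. unfold phi_basis. rewrite Nat.mul_add_distr_l, <- Nat.add_succ_r, !Cpow_add_r, Cpow_mult_l, <- Cpow_mult_r. ring.
Qed.

(** Induction on j by the recursion. In the term with indices k and i, passing to j' = j - p + k +
    i, the powers of p from Y^i and from the scaling exceed those required by (lambda/2 - 2 w) i + w
    (p - 1 - k), which is nonnegative. *)
Lemma trace_phi_span p j : In p (2 :: 3 :: 5 :: 7 :: nil)%nat -> (1 <= j)%nat ->
  span (phi_basis p (slope p + 1)) (fun t => pC p ^ (phi_weight p * (j - 1)) * V p (phi_zpow p (Z.of_nat j)) t).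
Proof.
  intros Hp. pose proof (In_primes_pos p Hp) as Hp2. destruct (weight_slope p Hp) as [W1 W2].
  induction j as [j IH] using lt_wf_ind. intros Hj.
  destruct (le_lt_dec p j) as [Hpj | Hpj].
  - apply (span_ext _ (fun t => Csum (fun k => Csum (fun i => pC p ^ (phi_weight p * (j - 1)) *
        (kappaC p k * (phi p t * fricke_phi p t ^ i * V p (phi_zpow p (Z.of_nat j - Z.of_nat p + Z.of_nat k + Z.of_nat i)) t))) (p - k)) p)).
    { intros t Ht. rewrite (trace_up p (Z.of_nat j)) by auto. rewrite <- Csum_scal. apply Csum_ext. intros k Hk.
      rewrite <- Csum_scal. reflexivity. }
    apply span_Csum. intros k Hk. apply span_Csum. intros i Hi.
    destruct (Nat.eq_dec (j - p + k + i) 0) as [E0 | E0].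
    (* The exponent 0 occurs only here; the trace is then the constant p, and w (p - 1) >= slope
       supplies the divisibility. *)
    + assert (Ek : k = 0%nat /\ i = 0%nat /\ j = p) by lia. destruct Ek as [-> [-> ->]].
      apply (span_ext _ (fun t => RtoC (IZR (Z.of_nat p ^ Z.of_nat (phi_weight p * (p - 1) - slope p))) * phi_basis p (slope p + 1) 0 t)); [| apply span_gen].
      intros t Ht. unfold phi_basis. rewrite kappaC_0, <- pC_pow by auto.
      replace (Z.of_nat p - Z.of_nat p + Z.of_nat 0 + Z.of_nat 0)%Z with (- Z.of_nat 0)%Z by lia.
      rewrite (V_ext p _ (fun _ => 1)) by (try lia; auto; intros; apply phi_zpow_neg). rewrite V_one.
      assert (E : pC p ^ (phi_weight p * (p - 1)) * pC p = pC p ^ (phi_weight p * (p - 1) - slope p) * pC p ^ (slope p + 1)).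
      { rewrite <- Cpow_add_r. rewrite Cmult_comm, <- Cpow_S. f_equal. lia. }
      rewrite Nat.mul_0_r. rewrite Cpow_1_r. change (pC p ^ 0) with (RtoC 1). change (fricke_phi p t ^ 0) with (RtoC 1).
      transitivity (pC p ^ (phi_weight p * (p - 1) - slope p) * pC p ^ (slope p + 1) * phi p t); [ring |]. rewrite <- E. ring.
    + set (j' := (j - p + k + i)%nat).
      replace (Z.of_nat j - Z.of_nat p + Z.of_nat k + Z.of_nat i)%Z with (Z.of_nat j') by (unfold j'; lia).
      specialize (IH j' ltac:(unfold j'; lia) ltac:(unfold j'; lia)).
      apply (span_ext _ (fun t => RtoC (IZR (kap p k * Z.of_nat p ^ Z.of_nat ((half_lam p - 2 * phi_weight p) * i + phi_weight p * (p - 1 - k)))) *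
         ((pC p ^ phi_weight p * phi p t) ^ S i * (pC p ^ (phi_weight p * (j' - 1)) * V p (phi_zpow p (Z.of_nat j')) t)))).
      * intros t Ht. rewrite mult_IZR, RtoC_mult, <- pC_pow. fold (kappaC p k). unfold fricke_phi. rewrite fricke_const_pC.
        rewrite !Cpow_mult_l, <- !Cpow_mult_r.
        assert (E : pC p ^ (phi_weight p * (j - 1)) * pC p ^ (half_lam p * i)
          = pC p ^ ((half_lam p - 2 * phi_weight p) * i + phi_weight p * (p - 1 - k)) * (pC p ^ (phi_weight p * S i) * pC p ^ (phi_weight p * (j' - 1)))).
        { rewrite <- !Cpow_add_r. f_equal.
          assert (Hx : (half_lam p = (half_lam p - 2 * phi_weight p) + 2 * phi_weight p)%nat) by lia. rewrite Hx at 1.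
          assert (Hy : (j - 1 + 2 * i = (p - 1 - k) + S i + (j' - 1))%nat) by (unfold j'; lia). nia. }
        transitivity (kappaC p k * (pC p ^ ((half_lam p - 2 * phi_weight p) * i + phi_weight p * (p - 1 - k)) * (pC p ^ (phi_weight p * S i) * pC p ^ (phi_weight p * (j' - 1))))
          * (phi p t ^ S i * V p (phi_zpow p (Z.of_nat j')) t)); [ring |]. rewrite <- E, Cpow_S. ring.
      * apply span_scal. apply (span_mult (phi_basis p (slope p + 1)) _ (fun t => (pC p ^ phi_weight p * phi p t) ^ S i)); auto.
        intros i'. apply phi_basis_x.
  - pose proof (base_check p j Hp ltac:(lia)) as Hb. unfold base_ok in Hb.
    pose proof (window_iter p j Hp) as [_ Hw]. specialize (Hw (p - 1)%nat ltac:(lia)).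
    destruct (nth (p - 1) (Nat.iter j (rec_step p) (window0 p)) nil) as [| a l]; [discriminate |].
    destruct a; try discriminate.
    apply (divok_span p _ 0) in Hb; [| lia]. eapply span_ext; [| exact Hb].
    intros t Ht. cbv beta. replace (Z.of_nat j) with (1 + Z.of_nat j - Z.of_nat p + Z.of_nat (p - 1))%Z by lia.
    rewrite Hw by auto. cbn [pev]. rewrite pev_scal, <- pC_pow. simpl. ring.
Qed.

(** * The operator U *)

Definition U (p : nat) (g : C -> C) (t : C) : C := / pC p * V p g t.

Lemma U_ext p g h t : (0 < p)%nat -> (forall t, upper_half_plane t -> g t = h t) -> upper_half_plane t -> U p g t = U p h t.
Proof. intros Hp E Ht. unfold U. now rewrite (V_ext p g h t Hp E Ht). Qed.

Lemma U_plus p g h t : U p (fun t => g t + h t) t = U p g t + U p h t.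
Proof. unfold U. rewrite V_plus. ring. Qed.

Lemma U_scal p a g t : U p (fun t => a * g t) t = a * U p g t.
Proof. unfold U. rewrite V_scal. ring. Qed.

Lemma phi_basis_div p e g : (0 < p)%nat -> span (phi_basis p (S e)) g -> span (phi_basis p e) (fun t => / pC p * g t).
Proof.
  intros Hp. apply (span_mult (phi_basis p (S e)) (phi_basis p e) (fun _ => / pC p)). intros i.
  apply (span_ext _ (fun t => RtoC (IZR 1) * phi_basis p e i t)); [| apply span_gen].
  intros t Ht. unfold phi_basis. rewrite (Cpow_S (pC p) e). field. now apply pC_nz.
Qed.

Lemma phi_basis_le p e e' g : (e <= e')%nat -> span (phi_basis p e') g -> span (phi_basis p e) g.
Proof.
  intros He H. apply (span_ext _ (fun t => 1 * g t)); [intros; ring |].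
  apply (span_mult (phi_basis p e') (phi_basis p e) (fun _ => 1)); auto. intros i.
  apply (span_ext _ (fun t => RtoC (IZR (Z.of_nat p ^ Z.of_nat (e' - e))) * phi_basis p e i t)); [| apply span_gen].
  intros t Ht. unfold phi_basis. rewrite <- pC_pow. replace e' with ((e' - e) + e)%nat at 2 by lia. rewrite Cpow_add_r. ring.
Qed.

(** The trace gains slope + 1 powers of p, and the division by p in [U] takes one of them back. *)
Lemma U_phi_basis p e g : In p (2 :: 3 :: 5 :: 7 :: nil)%nat -> span (phi_basis p e) g -> span (phi_basis p (e + slope p)) (U p g).
Proof.
  intros Hp Hg. pose proof (In_primes_pos p Hp) as Hp2. unfold U. apply phi_basis_div; [lia |].
  apply (span_V p (phi_basis p e)); auto; [lia |]. intros i.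
  apply (span_ext _ (fun t => pC p ^ e * (pC p ^ (phi_weight p * (S i - 1)) * V p (phi_zpow p (Z.of_nat (S i))) t))).
  - intros t Ht. replace (S i - 1)%nat with i by lia.
    rewrite (V_ext p (phi_zpow p (Z.of_nat (S i))) (fun t => phi p t ^ S i)) by (try lia; auto; intros; apply phi_zpow_pos).
    unfold phi_basis. rewrite (V_scal p (pC p ^ e)), (V_scal p (pC p ^ (phi_weight p * i))). reflexivity.
  - apply (span_mult (phi_basis p (slope p + 1)) _ (fun _ => pC p ^ e)); [| apply trace_phi_span; auto; lia].
    intros k. apply (span_ext _ (fun t => RtoC (IZR 1) * phi_basis p (S (e + slope p)) k t)); [| apply span_gen].
    intros t Ht. unfold phi_basis. replace (S (e + slope p)) with (e + (slope p + 1))%nat by lia. rewrite (Cpow_add_r _ e). ring.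
Qed.

Definition psi_basis (p i : nat) (t : C) : C := psi p t ^ S i.

(** The constant may be any complex number: [U] fixes constants, and only coefficients of positive
    index are in question. *)
Definition polar_dec (p e : nat) (g : C -> C) : Prop :=
  exists (A : C -> C) (c0 : C) (L : C -> C), span (psi_basis p) A /\ span (phi_basis p e) L /\ forall t, upper_half_plane t -> g t = A t + c0 + L t.

Lemma polar_dec_ext p e g h : (forall t, upper_half_plane t -> g t = h t) -> polar_dec p e g -> polar_dec p e h.
Proof.
  intros E [A [c0 [L [HA [HL H]]]]]. exists A, c0, L. repeat split; auto. intros t Ht. rewrite <- E; auto.
Qed.

Lemma polar_dec_plus p e g h : polar_dec p e g -> polar_dec p e h -> polar_dec p e (fun t => g t + h t).
Proof.
  intros [A [c0 [L [HA [HL H]]]]] [A' [c0' [L' [HA' [HL' H']]]]].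
  exists (fun t => A t + A' t), (c0 + c0'), (fun t => L t + L' t). repeat split; try apply span_plus; auto.
  intros t Ht. rewrite H, H' by auto. ring.
Qed.

Lemma polar_dec_scal p e (z : Z) g : polar_dec p e g -> polar_dec p e (fun t => RtoC (IZR z) * g t).
Proof.
  intros [A [c0 [L [HA [HL H]]]]].
  exists (fun t => RtoC (IZR z) * A t), (RtoC (IZR z) * c0), (fun t => RtoC (IZR z) * L t).
  repeat split; try apply span_scal; auto. intros t Ht. rewrite H by auto. ring.
Qed.

(** Dividing the trace lattice by p returns Z[psi], while Y^(i + 1) / p keeps p^((lambda/2)(i + 1) -
    1). This is the origin of the initial exponent lambda/2 - 1, that is 11, 5, 2, 1. *)
Lemma polar_dec_U_psi p m : In p (2 :: 3 :: 5 :: 7 :: nil)%nat -> polar_dec p (half_lam p - 1) (U p (fun t => psi p t ^ m)).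
Proof.
  intros Hp. pose proof (In_primes_pos p Hp) as Hp2. pose proof (half_lam_pos p Hp) as Hh. destruct (weight_slope p Hp) as [W1 _].
  apply (polar_dec_ext p _ (fun t => / pC p * V p (phi_zpow p (- Z.of_nat m)) t)).
  { intros t Ht. unfold U. f_equal. apply V_ext; auto; [lia |]. intros; apply phi_zpow_neg. }
  pose proof (trace_psi_span p m Hp) as H. revert H. generalize (V p (phi_zpow p (- Z.of_nat m))). intros g Hg.
  induction Hg as [g Hg | g k z i Hk IH Hg].
  - exists (fun _ => RtoC 0), (RtoC 0), (fun _ => RtoC 0). repeat split; try (apply span_0; auto). intros t Ht. rewrite Hg by auto. ring.
  - apply (polar_dec_ext p _ (fun t => / pC p * k t + RtoC (IZR z) * (/ pC p * trace_basis p i t))).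
    { intros t Ht. rewrite Hg by auto. ring. }
    apply polar_dec_plus; auto. apply polar_dec_scal. pose proof (pC_nz p ltac:(lia)) as NP. destruct i as [i | i].
    + destruct i as [| i].
      * exists (fun _ => RtoC 0), (RtoC 1), (fun _ => RtoC 0). repeat split; try (apply span_0; auto). intros t Ht. cbn [trace_basis]. simpl. field. auto.
      * exists (psi_basis p i), (RtoC 0), (fun _ => RtoC 0). repeat split; [| apply span_0; auto |].
        -- apply (span_ext _ (fun t => RtoC (IZR 1) * psi_basis p i t)); [intros; ring | apply span_gen].
        -- intros t Ht. cbn [trace_basis]. unfold psi_basis. field. auto.
    + exists (fun _ => RtoC 0), (RtoC 0), (fun t => / pC p * trace_basis p (inr i) t). repeat split; [apply span_0; auto | | intros; ring].
      apply (span_ext _ (fun t => RtoC (IZR (Z.of_nat p ^ Z.of_nat ((half_lam p - phi_weight p) * i))) * phi_basis p (half_lam p - 1) i t)); [| apply span_gen].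
      intros t Ht. cbn [trace_basis]. unfold phi_basis, fricke_phi. rewrite fricke_const_pC, <- pC_pow, Cpow_mult_l, <- Cpow_mult_r.
      assert (E : pC p ^ (half_lam p * S i) = pC p * (pC p ^ ((half_lam p - phi_weight p) * i) * (pC p ^ (half_lam p - 1) * pC p ^ (phi_weight p * i)))).
      { rewrite <- !Cpow_add_r, <- Cpow_S. f_equal.
        assert (Hx : (half_lam p = (half_lam p - phi_weight p) + phi_weight p)%nat) by lia. nia. }
      rewrite E. field. auto.
Qed.

Lemma U_const p c t : (0 < p)%nat -> U p (fun _ => c) t = c.
Proof. intros Hp. unfold U, V. rewrite Csum_const. fold (pC p). field. now apply pC_nz. Qed.

(** As long as psi is present it feeds new terms at level lambda/2 - 1, so the gain made on the phi
    part is given up here; it counts once the pole is gone. *)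
Lemma polar_dec_U p g : In p (2 :: 3 :: 5 :: 7 :: nil)%nat -> polar_dec p (half_lam p - 1) g -> polar_dec p (half_lam p - 1) (U p g).
Proof.
  intros Hp [A [c0 [L [HA [HL H]]]]]. pose proof (In_primes_pos p Hp) as Hp2.
  apply (polar_dec_ext p _ (fun t => U p A t + (c0 + U p L t))).
  { intros t Ht. rewrite (U_ext p g (fun t => A t + (c0 + L t))) by (try lia; auto; intros; rewrite H by auto; ring).
    rewrite (U_plus p A), (U_plus p (fun _ => c0)), U_const by lia. reflexivity. }
  apply polar_dec_plus.
  - clear H HL. induction HA as [A HA | A k z i Hk IH HA].
    + exists (fun _ => RtoC 0), (RtoC 0), (fun _ => RtoC 0). repeat split; try (apply span_0; auto).
      intros t Ht. rewrite (U_ext p A (fun _ => 0)), U_const by (auto; lia). ring.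
    + apply (polar_dec_ext p _ (fun t => U p k t + RtoC (IZR z) * U p (psi_basis p i) t)).
      * intros t Ht. rewrite (U_ext p A (fun t => k t + RtoC (IZR z) * psi_basis p i t)) by (auto; lia).
        rewrite U_plus, U_scal. reflexivity.
      * apply polar_dec_plus; auto. apply polar_dec_scal, polar_dec_U_psi; auto.
  - exists (fun _ => RtoC 0), c0, (U p L). repeat split; [apply span_0; auto | | intros; ring].
    apply (phi_basis_le p _ (half_lam p - 1 + slope p)); [lia |]. apply U_phi_basis; auto.
Qed.

(** * Iterating U on f and reading off the congruences *)

Fixpoint Un (p n : nat) (g : C -> C) : C -> C :=
  match n with O => g | S k => U p (Un p k g) end.

Lemma QE_U p g c : (0 < p)%nat -> QE g c -> QE (U p g) (fun n => c (p * n)%nat).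
Proof.
  intros Hp H. pose proof (QE_scal (/ pC p) _ _ (QE_trace _ _ p Hp H)) as A.
  eapply QE_ext_coef; [| exact A]. intros n. cbv beta. fold (pC p). field. now apply pC_nz.
Qed.

(** The sum over roots of unity annihilates q^-m unless p divides m. *)
Lemma U_q_neg p m t : (0 < p)%nat -> upper_half_plane t ->
  U p (fun t => / q t ^ m) t = if Nat.eq_dec (m mod p) 0 then / q t ^ (m / p) else 0.
Proof.
  intros Hp Ht. assert (NP := pC_nz p Hp). assert (Hp0 : INR p <> 0%R) by (apply not_0_INR; lia).
  unfold U, V.
  rewrite (Csum_ext _ (fun l => / q (t / pC p) ^ m * ee (IZR (- Z.of_nat m) * INR l / INR p))).
  - rewrite Csum_scal, unity_sum by auto. fold (pC p).
    destruct (Nat.eq_dec (m mod p) 0) as [E | E]; destruct (Z.eq_dec ((- Z.of_nat m) mod Z.of_nat p) 0) as [E' | E'].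
    + replace (q (t / pC p) ^ m) with (q t ^ (m / p)); [field; split; auto; apply Cpow_nz, q_nz |].
      pose proof (Nat.div_mod m p ltac:(lia)) as D. rewrite D at 2. rewrite E, Nat.add_0_r, Cpow_mult_r. f_equal.
      rewrite q_pow. fold (pC p). f_equal. field. auto.
    + exfalso. apply E'. apply Z.mod_divide; [lia |]. apply Z.divide_opp_r.
      apply Nat.Div0.mod_divides in E. destruct E as [d ->]. exists (Z.of_nat d). lia.
    + exfalso. apply E. apply Z.mod_divide in E'; [| lia]. apply Z.divide_opp_r in E'. destruct E' as [d Hd].
      apply Nat.Div0.mod_divides. exists (Z.to_nat d). nia.
    + ring.
  - intros l _. replace ((t + RtoC (INR l)) / RtoC (INR p)) with (t / pC p + RtoC (INR l / INR p)).
    + rewrite q_plus, Cpow_mult_l, ee_pow, opp_IZR, <- INR_IZR_INZ.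
      replace (- INR m * INR l / INR p)%R with (- (INR m * (INR l / INR p)))%R by (field; auto).
      assert (P : ee (INR m * (INR l / INR p)) * ee (- (INR m * (INR l / INR p))) = 1).
      { rewrite <- ee_plus. replace (_ + _)%R with (IZR 0) by (simpl; ring). apply ee_Z. }
      set (x := ee (INR m * (INR l / INR p))) in *. set (y := ee (- (INR m * (INR l / INR p)))) in *.
      assert (Nx : x <> 0) by apply ee_nz. assert (Nq := Cpow_nz _ m (q_nz (t / pC p))).
      transitivity (x * y / (q (t / pC p) ^ m * x)); [rewrite P; field; auto | field; auto].
    + unfold pC. rewrite RtoC_div by auto. field. auto.
Qed.

(** Multiples of powers of psi are subtracted, highest first. Since q^k psi^k starts with 1 and is
    integral, integrality of the first k coefficients is preserved by each subtraction. *)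
Lemma polar_reduction p k g : In p (2 :: 3 :: 5 :: 7 :: nil)%nat ->
  (exists c z, QE (fun t => q t ^ k * g t) c /\ forall n, (n < k)%nat -> c n = ZC z n) ->
  exists A, span (psi_basis p) A /\ has_QE (fun t => g t - A t).
Proof.
  intros Hp. pose proof (In_primes_pos p Hp) as Hp2. revert g. induction k; intros g [c [z [Hc Hz]]].
  - exists (fun _ => RtoC 0). split; [apply span_0; auto |]. exists c. eapply QE_ext; [| exact Hc].
    intros t Ht. cbv beta. simpl. ring.
  - set (a := z 0%nat).
    pose proof (QE_minus _ _ _ _ Hc (QE_scal (RtoC (IZR a)) _ _ (QZ_qpsi_pow p (S k) ltac:(lia)))) as H.
    assert (H0 : forall n, (n < 1)%nat -> c n - RtoC (IZR a) * ZC (zpow (qpsi_coef p) (S k)) n = 0).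
    { intros n Hn. replace n with 0%nat by lia. rewrite Hz by lia. unfold ZC. rewrite qpsi_coef_pow_0 by lia. fold a. simpl. ring. }
    pose proof (QE_divq _ _ 1 H H0) as H1.
    destruct (IHk (fun t => g t - RtoC (IZR a) * psi p t ^ S k)) as [A [HA HQA]].
    + eexists. exists (fun n => z (S n) - a * zpow (qpsi_coef p) (S k) (S n))%Z. split.
      * eapply QE_ext; [| exact H1]. intros t Ht. cbv beta. rewrite Cpow_1_r, (Cpow_S (q t) k). field. apply q_nz.
      * intros n Hn. cbv beta. rewrite Hz by lia. unfold ZC. rewrite minus_IZR, mult_IZR, RtoC_minus, RtoC_mult. reflexivity.
    + exists (fun t => A t + RtoC (IZR a) * psi_basis p k t). split; [apply span_plus; [auto | apply span_gen] |].
      eapply has_QE_ext; [| exact HQA]. intros t Ht. cbv beta. unfold psi_basis. ring.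
Qed.

Lemma span_psi_basis_star p A : In p (2 :: 3 :: 5 :: 7 :: nil)%nat -> span (psi_basis p) A -> star_inv p A.
Proof.
  intros Hp HA. pose proof (In_primes_pos p Hp). induction HA as [A HA | A k z i Hk IH HA].
  - apply (star_inv_ext p (fun _ => 0)); [lia | intros; now rewrite HA | apply star_inv_const].
  - apply (star_inv_ext p (fun t => k t + RtoC (IZR z) * psi p t ^ S i)); [lia | intros; now rewrite HA |].
    apply star_inv_plus; auto. apply (star_inv_fun p (psi p) (fun x => RtoC (IZR z) * x ^ S i)), star_psi; auto.
Qed.

(** The function psi becomes Y under the involution, and the series of Y has no constant term. *)
Lemma span_psi_basis_W p A : In p (2 :: 3 :: 5 :: 7 :: nil)%nat -> span (psi_basis p) A ->
  exists b : nat -> C, b 0%nat = 0 /\ QE (fun t => A (W p t)) b.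
Proof.
  intros Hp HA. pose proof (In_primes_pos p Hp). induction HA as [A HA | A k z i Hk [b [Hb0 Hb]] HA].
  - exists (fun n => 0 * ZC zone n). split; [ring |]. eapply QE_ext; [| apply (QE_const 0)].
    intros t Ht. rewrite HA; auto. apply uhp_W; auto; lia.
  - destruct (QE_Y_pow p i ltac:(lia)) as [y [Hy0 Hy]].
    exists (fun n => b n + RtoC (IZR z) * y n). split; [rewrite Hb0, Hy0; ring |].
    eapply QE_ext; [| apply (QE_plus _ _ _ _ Hb (QE_scal (RtoC (IZR z)) _ _ Hy))].
    intros t Ht. cbv beta. rewrite HA by (apply uhp_W; auto; lia). unfold psi_basis. rewrite psi_W by auto. reflexivity.
Qed.

(** The matrix with rows (a, -1) and (p, -k) has determinant p - a k = 1. *)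
Lemma Gamma0_star p f : (0 < p)%nat -> Gamma0_invariant p f -> star_inv p f.
Proof.
  intros Hp H a k Hak s Hs. assert (Hpp : (0 < INR p)%R) by (apply lt_0_INR; lia).
  assert (Np : RtoC (INR p) <> 0) by (apply RtoC_neq0; lra). pose proof (uhp_nz s Hs) as Ns.
  assert (Ek : RtoC (IZR a) * RtoC (IZR k) = RtoC (INR p) - 1).
  { rewrite <- RtoC_mult, <- mult_IZR, Hak, minus_IZR, <- INR_IZR_INZ, RtoC_minus. reflexivity. }
  set (t := (s + RtoC (IZR k)) / RtoC (INR p)).
  assert (Ht : upper_half_plane t) by (apply uhp_div; auto; now apply uhp_shift).
  rewrite <- (H a (-1)%Z (Z.of_nat p) (- k)%Z) with (tau := t); auto.
  - f_equal. rewrite <- INR_IZR_INZ, opp_IZR, RtoC_opp.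
    replace (RtoC (IZR (-1))) with (- (1)) by (apply Ceq; simpl; ring).
    replace (RtoC (INR p) * t + - RtoC (IZR k)) with s by (unfold t; field; auto).
    replace (RtoC (IZR a) * t + - (1)) with ((RtoC (IZR a) * s - 1) / RtoC (INR p)).
    + field. auto.
    + unfold t. transitivity ((RtoC (IZR a) * s + (RtoC (IZR a) * RtoC (IZR k)) - RtoC (INR p)) / RtoC (INR p));
        [rewrite Ek; field; auto | field; auto].
  - split; [lia | exists 1%Z; lia].
Qed.

Lemma span_phi_basis_QE p e L : (0 < p)%nat -> span (phi_basis p e) L -> exists z, QE L (fun n => pC p ^ e * ZC z n).
Proof.
  intros Hp HL. induction HL as [L HL | L k y i Hk [z Hz] HL].
  - exists (fun _ => 0%Z). eapply QE_ext_coef; [| eapply QE_ext; [| apply (QE_const 0)]].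
    + intros n. unfold ZC at 2. simpl. ring.
    + intros t Ht. now rewrite HL.
  - destruct (QZ_phi_pow p i Hp) as [x [_ Hx]].
    exists (fun n => z n + y * (Z.of_nat p ^ Z.of_nat (phi_weight p * i) * x n))%Z.
    eapply QE_ext; [| eapply QE_ext_coef; [| apply (QE_plus _ _ _ _ Hz (QE_scal (RtoC (IZR y) * (pC p ^ e * pC p ^ (phi_weight p * i))) _ _ Hx))]].
    + intros t Ht. cbv beta. rewrite HL by auto. unfold phi_basis. ring.
    + intros n. cbv beta. unfold ZC. rewrite plus_IZR, RtoC_plus, !mult_IZR, !RtoC_mult, <- pC_pow. ring.
Qed.

Lemma coefficient_divisible p m alpha m' f a : In p (2 :: 3 :: 5 :: 7 :: nil)%nat ->
  (1 <= m)%nat -> m = (p ^ alpha * m')%nat -> Nat.gcd m' p = 1%nat -> is_f0 p m f a ->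
  forall r n, (1 <= n)%nat ->
  cong0_mod (a (p ^ (alpha + 1 + r) * n)%nat) (Z.of_nat p ^ Z.of_nat (half_lam p - 1 + slope p * r)).
Proof.
  intros Hp Hm Hmp Hg [[_ [Hinv _]] [Ha [b [Hb0 Hb]]]] r n Hn.
  pose proof (In_primes_pos p Hp) as Hp2. change (QE (fun t => f (W p t)) b) in Hb.
  assert (Hstar := Gamma0_star p f ltac:(lia) Hinv).
  (* Liouville: f is an integral polynomial in psi. *)
  assert (HfA : exists A, span (psi_basis p) A /\ has_QE (fun t => f t - A t)).
  { apply (polar_reduction p m f Hp).
    pose proof (QE_plus _ _ _ _ QE_1 (QE_mulq _ _ m Ha)) as H.
    eexists. exists zone. split; [eapply QE_ext; [| exact H] |].
    - intros t Ht. cbv beta. field. apply Cpow_nz, q_nz.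
    - intros k Hk. cbv beta. destruct (le_lt_dec m k); [lia | ring]. }
  destruct HfA as [A [HA [c Hc]]]. destruct (span_psi_basis_W p A Hp HA) as [b' [Hb'0 Hb']].
  assert (Ef : forall t, upper_half_plane t -> f t = A t).
  { intros t Ht. apply Ceq_minus.
    apply (liouville p (fun t => f t - A t) c _ Hp Hc (QE_minus _ _ _ _ Hb Hb')); auto.
    - apply star_inv_minus; auto. apply span_psi_basis_star; auto.
    - right. rewrite Hb0, Hb'0. ring. }
  assert (HDec : forall k, polar_dec p (half_lam p - 1) (Un p k f)).
  { induction k; [| apply polar_dec_U; auto].
    exists A, (RtoC 0), (fun _ => RtoC 0). repeat split; [auto | apply span_0; auto |].
    intros t Ht. simpl. rewrite Ef by auto. ring. }
  (* Each of the first alpha applications divides the order of the pole by p. *)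
  assert (Hexp : forall k, (k <= alpha)%nat -> QE (fun t => Un p k f t - / q t ^ (p ^ (alpha - k) * m')) (fun n => a (p ^ k * n)%nat)).
  { induction k; intros Hk.
    - rewrite Nat.sub_0_r. eapply QE_ext_coef; [| eapply QE_ext; [| exact Ha]].
      + intros i. cbv beta. f_equal. simpl. lia.
      + intros t Ht. cbv beta. rewrite Hmp. reflexivity.
    - specialize (IHk ltac:(lia)). apply (QE_U p _ _ ltac:(lia)) in IHk.
      eapply QE_ext_coef; [| eapply QE_ext; [| exact IHk]].
      + intros i. cbv beta. f_equal. simpl. lia.
      + intros t Ht. cbv beta. cbn [Un].
        rewrite (U_ext p (fun t => Un p k f t - / q t ^ (p ^ (alpha - k) * m')) (fun t => Un p k f t + - (1) * / q t ^ (p ^ (alpha - k) * m')))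
          by (try lia; auto; intros; ring).
        rewrite U_plus, (U_scal p (- (1))), U_q_neg by (auto; lia).
        replace (p ^ (alpha - k) * m')%nat with (p * (p ^ (alpha - S k) * m'))%nat
          by (replace (alpha - k)%nat with (S (alpha - S k)) by lia; simpl; lia).
        rewrite Nat.mul_comm, Nat.Div0.mod_mul, Nat.div_mul by lia. destruct (Nat.eq_dec 0 0); [ring | lia]. }
  (* The order m' that then remains is prime to p, so one further application removes the pole. *)
  assert (Hm'p : (m' mod p <> 0)%nat).
  { intros E. apply Nat.Lcm0.mod_divide in E. assert (D : Nat.divide p (Nat.gcd m' p)) by (apply Nat.gcd_greatest; auto; apply Nat.divide_refl).
    rewrite Hg in D. apply Nat.divide_1_r in D. lia. }
  assert (Hexp1 : QE (Un p (alpha + 1) f) (fun n => a (p ^ (alpha + 1) * n)%nat)).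
  { pose proof (Hexp alpha (Nat.le_refl _)) as H. rewrite Nat.sub_diag in H. apply (QE_U p _ _ ltac:(lia)) in H.
    eapply QE_ext_coef; [| eapply QE_ext; [| exact H]].
    - intros i. cbv beta. f_equal. rewrite Nat.pow_add_r, Nat.pow_1_r. lia.
    - intros t Ht. cbv beta. replace (alpha + 1)%nat with (S alpha) by lia. cbn [Un].
      rewrite (U_ext p (fun t => Un p alpha f t - / q t ^ (p ^ 0 * m')) (fun t => Un p alpha f t + - (1) * / q t ^ (p ^ 0 * m')))
        by (try lia; auto; intros; ring).
      rewrite U_plus, (U_scal p (- (1))), U_q_neg by (auto; lia).
      rewrite Nat.pow_0_r, Nat.mul_1_l. destruct (Nat.eq_dec (m' mod p) 0); [lia | ring]. }
  assert (HexpS : forall k, QE (Un p (alpha + 1 + k) f) (fun n => a (p ^ (alpha + 1 + k) * n)%nat)).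
  { induction k; [rewrite Nat.add_0_r; auto |]. apply (QE_U p _ _ ltac:(lia)) in IHk.
    rewrite Nat.add_succ_r. cbn [Un]. eapply QE_ext_coef; [| exact IHk]. intros i. cbv beta. f_equal. simpl. lia. }
  (* After alpha + 1 steps the pole at infinity is gone, so Liouville removes the polynomial part. *)
  assert (HL : exists c0 L, span (phi_basis p (half_lam p - 1)) L /\ forall t, upper_half_plane t -> Un p (alpha + 1) f t = c0 + L t).
  { destruct (HDec (alpha + 1)%nat) as [A1 [c0 [L [HA1 [HL H]]]]]. exists c0, L. split; auto.
    destruct (span_phi_basis_QE p _ L ltac:(lia) HL) as [z Hz]. destruct (span_psi_basis_W p A1 Hp HA1) as [b1 [Hb10 Hb1]].
    assert (Z : forall t, upper_half_plane t -> A1 t = 0).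
    { apply (liouville p A1 (fun i => a (p ^ (alpha + 1) * i)%nat - c0 * ZC zone i - pC p ^ (half_lam p - 1) * ZC z i) b1 Hp); auto.
      - eapply QE_ext; [| apply (QE_minus _ _ _ _ (QE_minus _ _ _ _ Hexp1 (QE_const c0)) Hz)].
        intros t Ht. cbv beta. rewrite H by auto. ring.
      - apply span_psi_basis_star; auto. }
    intros t Ht. rewrite H, Z by auto. ring. }
  destruct HL as [c0 [L0 [HL0 HUL]]].
  assert (HLk : forall k, exists L, span (phi_basis p (half_lam p - 1 + slope p * k)) L /\ forall t, upper_half_plane t -> Un p (alpha + 1 + k) f t = c0 + L t).
  { induction k.
    - exists L0. rewrite Nat.mul_0_r, !Nat.add_0_r. auto.
    - destruct IHk as [L [HL H]]. exists (U p L). split.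
      + replace (half_lam p - 1 + slope p * S k)%nat with (half_lam p - 1 + slope p * k + slope p)%nat by lia. apply U_phi_basis; auto.
      + intros t Ht. rewrite Nat.add_succ_r. cbn [Un].
        rewrite (U_ext p (Un p (alpha + 1 + k) f) (fun t => c0 + L t)) by (auto; lia).
        rewrite (U_plus p (fun _ => c0)), U_const by lia. reflexivity. }
  destruct (HLk r) as [L [HL H]]. destruct (span_phi_basis_QE p _ L ltac:(lia) HL) as [z Hz].
  assert (E : a (p ^ (alpha + 1 + r) * n)%nat = c0 * ZC zone n + pC p ^ (half_lam p - 1 + slope p * r) * ZC z n).
  { assert (HX : QE (Un p (alpha + 1 + r) f) (fun i => c0 * ZC zone i + pC p ^ (half_lam p - 1 + slope p * r) * ZC z i)).
    { eapply QE_ext; [| apply (QE_plus _ _ _ _ (QE_const c0) Hz)]. intros t Ht. symmetry. now apply H. }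
    exact (QE_unique _ _ _ (HexpS r) HX n). }
  exists (Z.of_nat p ^ Z.of_nat (half_lam p - 1 + slope p * r) * z n)%Z. split.
  (* Since n >= 1, the constant [c0] does not contribute to this coefficient. *)
  - rewrite E, mult_IZR, RtoC_mult, <- pC_pow. unfold ZC, zone. destruct (Nat.eq_dec n 0); [lia |]. simpl. ring.
  - apply Z.divide_factor_l.
Qed.

Theorem theorem1p2 (p m alpha m' : nat) (f : C -> C) (a : nat -> C)
  (hp : In p (2 :: 3 :: 5 :: 7 :: nil)%nat)
  (hm : (1 <= m)%nat)
  (hmp : m = (p ^ alpha * m')%nat)
  (hm' : Nat.gcd m' p = 1%nat)
  (hf : is_f0 p m f a) :
  forall beta n : nat, (alpha < beta)%nat -> (1 <= n)%nat ->
    (p = 2%nat ->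
       cong0_mod (a (2 ^ beta * n)%nat) (2 ^ (3 * Z.of_nat (beta - alpha) + 8))%Z) /\
    (p = 3%nat ->
       cong0_mod (a (3 ^ beta * n)%nat) (3 ^ (2 * Z.of_nat (beta - alpha) + 3))%Z) /\
    (p = 5%nat ->
       cong0_mod (a (5 ^ beta * n)%nat) (5 ^ (Z.of_nat (beta - alpha) + 1))%Z) /\
    (p = 7%nat ->
       cong0_mod (a (7 ^ beta * n)%nat) (7 ^ Z.of_nat (beta - alpha))%Z).
Proof.
  intros beta n Hb Hn.
  (* With r = beta - alpha - 1 the exponents are 11 + 3 r, 5 + 2 r, 2 + r and 1 + r. *)
  pose proof (coefficient_divisible p m alpha m' f a hp hm hmp hm' hf (beta - alpha - 1) n Hn) as H.
  replace (alpha + 1 + (beta - alpha - 1))%nat with beta in H by lia.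
  repeat split; intros ->; change (Z.of_nat 2) with 2%Z in H || change (Z.of_nat 3) with 3%Z in H
    || change (Z.of_nat 5) with 5%Z in H || change (Z.of_nat 7) with 7%Z in H.
  - replace (3 * Z.of_nat (beta - alpha) + 8)%Z with (Z.of_nat (half_lam 2 - 1 + slope 2 * (beta - alpha - 1))); auto.
    change (half_lam 2) with 12%nat. cbn [slope]. lia.
  - replace (2 * Z.of_nat (beta - alpha) + 3)%Z with (Z.of_nat (half_lam 3 - 1 + slope 3 * (beta - alpha - 1))); auto.
    change (half_lam 3) with 6%nat. cbn [slope]. lia.
  - replace (Z.of_nat (beta - alpha) + 1)%Z with (Z.of_nat (half_lam 5 - 1 + slope 5 * (beta - alpha - 1))); auto.
    change (half_lam 5) with 3%nat. cbn [slope]. lia.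
  - replace (Z.of_nat (beta - alpha)) with (Z.of_nat (half_lam 7 - 1 + slope 7 * (beta - alpha - 1))); auto.
    change (half_lam 7) with 2%nat. cbn [slope]. lia.
Qed.
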